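(* Let $\omega=e^{2\pi i/3}$, let $N$ be a positive integer, $c=4\operatorname{Im}\omega/N$, $r>0$, and let $\Gamma_c' := \langle\Lambda_{\omega,c},\ (\omega/2,\ 2c/3+\operatorname{Im}\omega/6)\,\mu(\omega)\rangle\subset\mathbb{H}\rtimes S^1$, assumed to be a Heisenberg Bieberbach group. Let $M'=\Gamma_c'\backslash\mathbb{H}$, equipped with the CR structure induced from $\mathbb{H}$ and the contact form $r\theta_{\mathbb{H}}$, and let $\Delta_b$ and $T$ be its sub-Laplacian and Reeb vector field. For $n\in\mathbb{Z}\setminus\{0\}$ and $k\in\mathbb{Z}_{\ge0}$, the multiplicity $m_{n,k}'$ of $$\sigma_{n,k}=\left(\frac{(4k+2)\pi|n|}{cr},\frac{2\pi n}{cr}\right)$$ in the joint spectrum of $\Delta_b$ and $i^{-1}T$ on $M'$ is given by $$m_{n,k}'=\frac13\left(|n|N+\frac{4}{\sqrt3}\cos\left(\frac{2\pi(|n|+k)}{3}-\frac{\pi}{6}\right)+\frac{2}{\sqrt3}\cos\left(\frac{2\pi(|n|+k+|n|N)}{3}-\frac{\pi}{6}\right)\right).$$ Moreover, for any $\kappa>0$, the multiplicity of $(\kappa,0)$ in the joint spectrum is equal to $\#E_\kappa/3$, where $E_\kappa=\{\zeta\in L_\omega' : \pi^2|\zeta|^2/r=\kappa\}$.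
   Context: The Heisenberg group is $\mathbb{H} = \mathbb{C}\times\mathbb{R}$ with multiplication $(z,t)\cdot(z',t') = (z+z', t+t'+2\operatorname{Im}(z\bar z'))$. For $\lambda\in\mathbb{C}^*$ let $\mu(\lambda)(z,t)=(\lambda z,|\lambda|^2t)$. $\mathbb{H}\rtimes\mathbb{C}^*$ has multiplication $(g,\lambda)\cdot(h,\nu)=(g\cdot\mu(\lambda)(h),\lambda\nu)$ and acts on $\mathbb{H}$ by $(g,\lambda)h=g\cdot\mu(\lambda)(h)$; $(g,\lambda)$ is also written $g\,\mu(\lambda)$, $\mathbb{H}$ is identified with the elements $(g,1)$, and $\mathbb{H}\rtimes S^1$ is the subgroup with $|\lambda|=1$. A Heisenberg Bieberbach group is a discrete torsion-free subgroup $\Gamma\subset\mathbb{H}\rtimes S^1$ with $\Gamma\backslash\mathbb{H}$ compact. For $4\operatorname{Im}\tau/c\in\mathbb{Z}_{>0}$, $\Lambda_{\tau,c}=\langle(1,0),(\tau,0),(0,c)\rangle\subset\mathbb{H}$; here $\tau=\omega$, and $N=4\operatorname{Im}\omega/c=\#(Z(\Lambda_{\omega,c})/[\Lambda_{\omega,c},\Lambda_{\omega,c}])$. $L_\omega=\mathbb{Z}+\mathbb{Z}\omega$, and $L_\omega'=\{\zeta\in\mathbb{C} : \operatorname{Re}(\zeta\bar z)\in\mathbb{Z}\text{ for all }z\in L_\omega\}$ is its dual lattice. The CR structure on $\mathbb{H}$ is spanned by $Z=\partial_z+i\bar z\,\partial_t$, and $\theta_{\mathbb{H}}=dt+i(z\,d\bar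 z-\bar z\,dz)$; both are invariant under $\mathbb{H}\rtimes S^1$ and so descend to the quotient. Functions on $M'$ are identified with $\Gamma_c'$-invariant functions on $\mathbb{H}$. With respect to $r\theta_{\mathbb{H}}$, the sub-Laplacian is $\Delta_b=-\frac{1}{2r}(Z\bar Z+\bar ZZ)$ and the Reeb vector field is $T=\frac1r\partial_t$. The multiplicity of $(a,b)\in\mathbb{R}^2$ in the joint spectrum is the complex dimension of $\{f\in C^\infty(M';\mathbb{C}) : \Delta_bf=af,\ i^{-1}Tf=bf\}$ (zero if $(a,b)$ is not a joint eigenvalue). *)

(* Defs.v *)
From HB Require Import structures.
From mathcomp Require Import all_boot all_order all_algebra.
From mathcomp Require Import all_classical all_reals all_analysis.
From mathcomp Require Import complex ring.

Set Implicit Arguments.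
Unset Strict Implicit.
Unset Printing Implicit Defensive.

Import Order.TTheory GRing.Theory Num.Theory.
Import numFieldNormedType.Exports.

Local Open Scope classical_set_scope.
Local Open Scope ring_scope.

(* The modulus, as a real number; the norm `|z| of R[i] has values in R[i]. *)
Definition cmod (R : realType) (z : R[i]) : R := Normc.normc z.

Section Subgroups.
Local Open Scope group_scope.
Variable G : groupType.

Record subgroup := Subgroup {
  subgroup_set :> set G;
  subgroup1 : subgroup_set 1;
  subgroupM : forall x y,
    subgroup_set x -> subgroup_set y -> subgroup_set (x * y);
  subgroupV : forall x, subgroup_set x -> subgroup_set x^-1 }.

Program Definition generated (S : set G) : subgroup :=
  @Subgroup (\bigcap_(H in [set H : subgroup | S `<=` H]) H) _ _ _.
Next Obligation. by move=> S H /= _; exact: subgroup1. Qed.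
Next Obligation.
by move=> S x y Sx Sy H SH; apply: subgroupM; [exact: Sx|exact: Sy].
Qed.
Next Obligation. by move=> S x Sx H SH; apply: subgroupV; exact: Sx. Qed.

Definition torsion_free (H : subgroup) : Prop :=
  forall (x : G) (n : nat), subgroup_set H x -> (0 < n)%N -> x ^+ n = 1 -> x = 1.

End Subgroups.

Record cstar (R : realType) := CStar {
  cstar_val :> R[i];
  cstar_neq0 : cstar_val != 0 }.

HB.instance Definition _ (R : realType) := [isSub for @cstar_val R].
HB.instance Definition _ (R : realType) := [Choice of cstar R by <:].

Section CStarGroup.
Variable R : realType.
Implicit Types x y z : cstar R.

Definition cstar1 : cstar R := CStar (oner_neq0 _).

Lemma cstar_mul_subproof x y : (x : R[i]) * y != 0.
Proof. by rewrite mulf_neq0 ?cstar_neq0. Qed.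
Definition cstar_mul x y : cstar R := CStar (cstar_mul_subproof x y).

Lemma cstar_inv_subproof x : (x : R[i])^-1 != 0.
Proof. by rewrite invr_eq0 cstar_neq0. Qed.
Definition cstar_inv x : cstar R := CStar (cstar_inv_subproof x).

Lemma cstar_mulA : associative cstar_mul.
Proof. by move=> x y z; apply/val_inj; exact: mulrA. Qed.
Lemma cstar_1mul : left_id cstar1 cstar_mul.
Proof. by move=> x; apply/val_inj; exact: mul1r. Qed.
Lemma cstar_mul1 : right_id cstar1 cstar_mul.
Proof. by move=> x; apply/val_inj; exact: mulr1. Qed.
Lemma cstar_Vmul : left_inverse cstar1 cstar_inv cstar_mul.
Proof. by move=> x; apply/val_inj; exact: mulVf (cstar_neq0 x). Qed.
Lemma cstar_mulV : right_inverse cstar1 cstar_inv cstar_mul.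
Proof. by move=> x; apply/val_inj; exact: mulfV (cstar_neq0 x). Qed.

HB.instance Definition _ := isGroup.Build (cstar R)
  cstar_mulA cstar_1mul cstar_mul1 cstar_Vmul cstar_mulV.

End CStarGroup.

Record heis (R : realType) := Heis { hz : R[i]; ht : R }.

Definition heis_pair (R : realType) (g : heis R) : R[i]^o * R^o := (hz g, ht g).
Definition pair_heis (R : realType) (p : R[i]^o * R^o) : heis R := Heis p.1 p.2.

Lemma heis_pairK (R : realType) : cancel (@heis_pair R) (@pair_heis R).
Proof. by case. Qed.

HB.instance Definition _ (R : realType) :=
  Choice.copy (heis R) (can_type (@heis_pairK R)).
HB.instance Definition _ (R : realType) :=
  Topological.copy (heis R) (initial_topology (@heis_pair R)).

Section HeisGroup.
Variable R : realType.
Implicit Types g h k : heis R.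

Definition heis1 : heis R := Heis 0 0.
Definition heis_mul g h : heis R :=
  Heis (hz g + hz h) (ht g + ht h + 2 * complex.Im (hz g * (hz h)^*%C)).
Definition heis_inv g : heis R := Heis (- hz g) (- ht g).

Lemma heis_mulA : associative heis_mul.
Proof.
move=> [[a b] s] [[a' b'] s'] [[a'' b''] s'']; rewrite /heis_mul /=.
by congr Heis; [rewrite addrA|ring].
Qed.
Lemma heis_1mul : left_id heis1 heis_mul.
Proof.
by move=> [[a b] s]; rewrite /heis_mul /=; congr Heis; [rewrite add0r|ring].
Qed.
Lemma heis_mul1 : right_id heis1 heis_mul.
Proof.
by move=> [[a b] s]; rewrite /heis_mul /=; congr Heis; [rewrite addr0|ring].
Qed.
Lemma heis_Vmul : left_inverse heis1 heis_inv heis_mul.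
Proof.
by move=> [[a b] s]; rewrite /heis_mul /=; congr Heis; [rewrite addNr|ring].
Qed.
Lemma heis_mulV : right_inverse heis1 heis_inv heis_mul.
Proof.
by move=> [[a b] s]; rewrite /heis_mul /=; congr Heis; [rewrite addrN|ring].
Qed.

HB.instance Definition _ := isGroup.Build (heis R)
  heis_mulA heis_1mul heis_mul1 heis_Vmul heis_mulV.

Definition mu (l : cstar R) h : heis R :=
  Heis ((l : R[i]) * hz h) (cmod l ^+ 2 * ht h).

Lemma cmod_sqr (z : R[i]) : cmod z ^+ 2 = complex.Re z ^+ 2 + complex.Im z ^+ 2.
Proof.
by case: z => a b; rewrite /cmod /= sqr_sqrtr // addr_ge0 ?sqr_ge0.
Qed.

Lemma mu1 h : mu 1%g h = h.
Proof.
case: h => z s; rewrite /mu cmod_sqr /= mul1r; congr Heis; ring.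
Qed.

Lemma muM l m h : mu (l * m)%g h = mu l (mu m h).
Proof.
case: h => z s; rewrite /mu /= mulrA; congr Heis.
by rewrite mulrA -exprMn; congr (_ ^+ 2 * _); exact: Normc.normcM.
Qed.

Lemma mu_mul l g h : mu l (g * h)%g = (mu l g * mu l h)%g.
Proof.
case: g h => [[a b] s] [[a' b'] s']; rewrite /mu /=; congr Heis.
  by rewrite mulrDr.
rewrite cmod_sqr; case: (l : R[i]) => u v /=; ring.
Qed.

Lemma mu_1 l : mu l 1%g = 1%g.
Proof. by rewrite /mu /= !mulr0. Qed.

End HeisGroup.

(* The semidirect product of the Heisenberg group by C^*;
   Sim g l stands for (g, l) = g mu(l). *)
Record sim (R : realType) := Sim { simg : heis R; siml : cstar R }.

Definition sim_pair (R : realType) (x : sim R) : heis R * cstar R :=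
  (simg x, siml x).
Definition pair_sim (R : realType) (p : heis R * cstar R) : sim R :=
  Sim p.1 p.2.

Lemma sim_pairK (R : realType) : cancel (@sim_pair R) (@pair_sim R).
Proof. by case. Qed.

(* C^* carries the topology induced from C, and the semidirect product carries
   the product topology. *)
Definition sim_emb (R : realType) (x : sim R) : heis R * R[i]^o :=
  (simg x, cstar_val (siml x)).

HB.instance Definition _ (R : realType) :=
  Choice.copy (sim R) (can_type (@sim_pairK R)).
HB.instance Definition _ (R : realType) :=
  Topological.copy (sim R) (initial_topology (@sim_emb R)).

Section SimGroup.
Local Open Scope group_scope.
Variable R : realType.
Implicit Types (x y z : sim R) (h : heis R).

Definition sim1 : sim R := Sim 1 1.
Definition sim_mul x y : sim R :=
  Sim (simg x * mu (siml x) (simg y)) (siml x * siml y).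
Definition sim_inv x : sim R :=
  Sim (mu (siml x)^-1 (simg x)^-1) (siml x)^-1.

Lemma sim_mulA : associative sim_mul.
Proof.
by move=> [g l] [h m] [k n]; rewrite /sim_mul /= mu_mul muM !mulgA.
Qed.
Lemma sim_1mul : left_id sim1 sim_mul.
Proof. by move=> [g l]; rewrite /sim_mul /= mu1 !mul1g. Qed.
Lemma sim_mul1 : right_id sim1 sim_mul.
Proof. by move=> [g l]; rewrite /sim_mul /= mu_1 !mulg1. Qed.
Lemma sim_Vmul : left_inverse sim1 sim_inv sim_mul.
Proof. by move=> [g l]; rewrite /sim_mul /= -mu_mul !mulVg mu_1. Qed.
Lemma sim_mulV : right_inverse sim1 sim_inv sim_mul.
Proof. by move=> [g l]; rewrite /sim_mul /= -muM !mulgV mu1 mulgV. Qed.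

HB.instance Definition _ := isGroup.Build (sim R)
  sim_mulA sim_1mul sim_mul1 sim_Vmul sim_mulV.

Definition sim_act x h : heis R := simg x * mu (siml x) h.

Lemma sim_act1 h : sim_act 1 h = h.
Proof. by rewrite /sim_act /= mu1 mul1g. Qed.

Lemma sim_actM x y h : sim_act (x * y) h = sim_act x (sim_act y h).
Proof. by rewrite /sim_act /= mu_mul muM mulgA. Qed.

Definition heis_in_sim h : sim R := Sim h 1.

Definition sim_S1 : set (sim R) := [set x | cmod (siml x) = 1%R].

Section Orbits.
Variable H : subgroup (sim R).

Definition orbit_rel : rel (heis R) :=
  fun h k => `[< exists2 x, subgroup_set H x & sim_act x h = k >].

Lemma orbit_rel_refl : reflexive orbit_rel.
Proof.
by move=> h; apply/asboolP; exists 1; [exact: subgroup1|exact: sim_act1].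
Qed.

Lemma orbit_rel_symW h k : orbit_rel h k -> orbit_rel k h.
Proof.
move=> /asboolP[x Hx <-]; apply/asboolP; exists x^-1; first exact: subgroupV.
by rewrite -sim_actM mulVg sim_act1.
Qed.

Lemma orbit_rel_sym : symmetric orbit_rel.
Proof. by move=> h k; apply/idP/idP; exact: orbit_rel_symW. Qed.

Lemma orbit_rel_trans : transitive orbit_rel.
Proof.
move=> k h m /asboolP[x Hx <-] /asboolP[y Hy <-]; apply/asboolP.
by exists (y * x); [exact: subgroupM|rewrite sim_actM].
Qed.

Definition orbit_equiv : equiv_rel (heis R) :=
  EquivRel orbit_rel orbit_rel_refl orbit_rel_sym orbit_rel_trans.

Definition orbit_space : topologicalType :=
  quotient_topology {eq_quot orbit_equiv}%qT.

End Orbits.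

Definition heisenberg_bieberbach (H : subgroup (sim R)) : Prop :=
  [/\ H `<=` sim_S1,
      forall x, subgroup_set H x -> isolated H x,
      torsion_free H &
      compact [set: orbit_space H]].

End SimGroup.

Section Calculus.
Variable R : realType.
Implicit Types (f : heis R -> R[i]^o) (v : R[i] * R) (p : heis R).

Definition hline v p (s : R) : heis R :=
  Heis (hz p + s%:C%C * v.1) (ht p + s * v.2).

Definition hderivable v f : Prop := forall p,
  derivable (fun s : R => complex.Re (f (hline v p s)) : R^o) 0 1 /\
  derivable (fun s : R => complex.Im (f (hline v p s)) : R^o) 0 1.

Definition hderive v f : heis R -> R[i]^o := fun p =>
  Complex (derive1 (fun s : R => complex.Re (f (hline v p s)) : R^o) 0)
          (derive1 (fun s : R => complex.Im (f (hline v p s)) : R^o) 0).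

(* The coordinate directions of x, y, t, where z = x + i y. *)
Definition dirx : R[i] * R := (1, 0).
Definition diry : R[i] * R := ('i%C, 0).
Definition dirt : R[i] * R := (0, 1).

(* Cn n f: f has continuous partial derivatives in x, y, t up to order n. *)
Fixpoint Cn (n : nat) f : Prop :=
  continuous f /\
  if n is n'.+1 then
    [/\ hderivable dirx f /\ Cn n' (hderive dirx f),
        hderivable diry f /\ Cn n' (hderive diry f) &
        hderivable dirt f /\ Cn n' (hderive dirt f)]
  else True.

Definition smooth f : Prop := forall n, Cn n f.

Definition d_z f : heis R -> R[i]^o := fun p =>
  2^-1 * (hderive dirx f p - 'i%C * hderive diry f p).
Definition d_zbar f : heis R -> R[i]^o := fun p =>
  2^-1 * (hderive dirx f p + 'i%C * hderive diry f p).

Definition Zfield f : heis R -> R[i]^o := fun p =>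
  d_z f p + 'i%C * (hz p)^*%C * hderive dirt f p.
Definition Zbarfield f : heis R -> R[i]^o := fun p =>
  d_zbar f p - 'i%C * hz p * hderive dirt f p.

(* Sub-Laplacian and Reeb vector field of the contact form
   r (dt + i (z d(zbar) - zbar dz)), for the CR structure spanned by Zfield. *)
Definition sub_laplacian (r : R) f : heis R -> R[i]^o := fun p =>
  - ((2 * r)^-1)%:C%C * (Zfield (Zbarfield f) p + Zbarfield (Zfield f) p).
Definition reeb (r : R) f : heis R -> R[i]^o := fun p =>
  (r^-1)%:C%C * hderive dirt f p.

(* Functions on the quotient by H are identified with H-invariant ones. *)
Definition invariant_fun (H : subgroup (sim R)) f : Prop :=
  forall x p, subgroup_set H x -> f (sim_act x p) = f p.

Definition joint_eigenspace (r : R) (H : subgroup (sim R)) (ab : R * R) :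
    set (heis R -> R[i]^o) :=
  [set f | [/\ smooth f, invariant_fun H f,
    forall p, sub_laplacian r f p = ab.1%:C%C * f p &
    forall p, 'i%C^-1 * reeb r f p = ab.2%:C%C * f p]].

End Calculus.

Definition has_dim (K : fieldType) (L : lmodType K) (V : set L) (m : nat) :
    Prop :=
  exists b : 'I_m -> L,
    [/\ forall i, V (b i),
        forall a : 'I_m -> K, \sum_i a i *: b i = 0 -> forall i, a i = 0 &
        forall f, V f -> exists a : 'I_m -> K, f = \sum_i a i *: b i].

Definition multiplicity (R : realType) (r : R) (H : subgroup (sim R))
    (ab : R * R) (m : nat) : Prop :=
  has_dim (joint_eigenspace r H ab) m.

Section Lattices.
Variable R : realType.

Definition expi (x : R) : R[i] := Complex (cos x) (sin x).

Lemma expi_neq0 x : expi x != 0.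
Proof.
apply/eqP => -[c0 s0]; have := cos2Dsin2 x.
by rewrite c0 s0 !expr0n /= addr0 => /eqP; rewrite eq_sym oner_eq0.
Qed.

Definition omega : cstar R := CStar (expi_neq0 (2 * pi / 3)).

Definition Lambda (tau : R[i]) (c : R) : subgroup (heis R) :=
  generated [set Heis 1 0; Heis tau 0; Heis 0 c].

Definition Gamma' (c : R) : subgroup (sim R) :=
  generated ((@heis_in_sim R) @` Lambda omega c `|`
    [set Sim (Heis ((omega : R[i]) / 2) (2 * c / 3 + complex.Im omega / 6)) omega]).

Definition plane_lattice (tau : R[i]) : set R[i] :=
  [set z | exists a b : int, z = a%:~R + b%:~R * tau].

Definition dual_lattice (L : set R[i]) : set R[i] :=
  [set zeta | forall z, L z -> complex.Re (zeta * z^*%C) \is a Num.int].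

Definition E_kappa (r kappa : R) : set R[i] :=
  [set zeta | dual_lattice (plane_lattice omega) zeta /\
              pi ^+ 2 * cmod zeta ^+ 2 / r = kappa].

End Lattices.

(* Main.v *)
Require Import Defs.
From HB Require Import structures.
From mathcomp Require Import all_boot all_order all_algebra.
From mathcomp Require Import all_classical all_reals all_analysis.
From mathcomp Require Import finmap complex ring lra zify.

Set Implicit Arguments.
Unset Strict Implicit.
Unset Printing Implicit Defensive.

Import Order.TTheory GRing.Theory Num.Theory.
Import numFieldNormedType.Exports.

Local Open Scope classical_set_scope.
Local Open Scope ring_scope.

(** Write f(z,t) for a function on the Heisenberg group and nu for its frequency
    in the central variable t. Everything rests on three observations.

    The translation by [centre] conjugates the given generators to the two
    lattice translations composed with central elements, the centre, and the
    rotation z -> omega z composed with a central element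
    ([invariant_fun_generators], [recentre_trans], [recentre_sigma]). For a
    fixed central frequency, invariance therefore says that f has prescribed
    unitary multipliers under the translations by 1 and omega and a prescribed
    eigenvalue under the rotation.

    If nu is nonzero, complex conjugation reduces to nu > 0
    ([has_dim_conj]). The commutator of Z and its conjugate is a multiple of
    T, so the eigenvalues of the sub-Laplacian form a ladder: the conjugate of
    Z is an isomorphism from level k + 1 onto level k which multiplies the
    rotation eigenvalue by omega ([has_dim_level]), and at level 0 the maximum
    principle shows that it annihilates f ([level0_Zbar]). Functions of level
    0 are theta functions of degree M = |n| N. There are at most M independent
    ones, because the Fourier coefficients of f(z,0) exp(- 2 i nu y z), where y
    is the imaginary part of z, are determined by M consecutive ones
    ([theta_dependent]). There are three theta functions of degree one
    with multipliers 1/2, -1/6 and 1/6 of a full turn for both translations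
    ([sfun]), on which the rotation acts by omega, 1 and 1 ([sfun_rot_om],
    [sfun_rot1]). Their monomials of degree M with the right multipliers are
    sorted by the rotation eigenvalue omega^e into three families of sizes
    [edim M e] which add up to M ([edim_sum]). Each family is independent, since
    the cube of the ratio of two of the functions takes arbitrarily small
    nonzero values ([mono_free]), so the upper bound makes each of them a basis
    ([has_dim_level0]). The level k with rotation eigenvalue omega^n has
    the dimension of the level 0 with omega^(n + k), and the cosines in the
    formula evaluate the residues modulo 3 ([edim_formula]).

    If nu = 0, then f is a function on the torus C / L on which the eigenvalue
    equation is diagonalised by the characters of the dual lattice
    ([fourier_laplacian], [fourier_zero]). Those with eigenvalue kappa are
    indexed by E_kappa, and the rotation permutes them in orbits of length 3
    since kappa > 0 ([perm_sector]); the orbit sums form a basis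
    ([has_dim_flat_sector]). *)

(** * Complex-valued functions of a real variable *)

Section ComplexCalculus.
Variable R : realType.
Implicit Types (F G : R -> R[i]) (x : R) (z w l : R[i]).
Local Notation Re := (@complex.Re R).
Local Notation Im := (@complex.Im R).

Lemma ReD z w : Re (z + w) = Re z + Re w. Proof. by case: z w => [a b] []. Qed.
Lemma ImD z w : Im (z + w) = Im z + Im w. Proof. by case: z w => [a b] []. Qed.
Lemma ReN z : Re (- z) = - Re z. Proof. by case: z. Qed.
Lemma ImN z : Im (- z) = - Im z. Proof. by case: z. Qed.
Lemma ReM z w : Re (z * w) = Re z * Re w - Im z * Im w.
Proof. by case: z w => [a b] []. Qed.
Lemma ImM z w : Im (z * w) = Re z * Im w + Im z * Re w.
Proof. by case: z w => [a b] []. Qed.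
Lemma ReC (a : R) : Re a%:C%C = a. Proof. by []. Qed.
Lemma ImC (a : R) : Im a%:C%C = 0. Proof. by []. Qed.
Lemma Rei : Re 'i%C = 0. Proof. by []. Qed.
Lemma Imi : Im 'i%C = 1. Proof. by []. Qed.
Lemma ReJ z : Re z^*%C = Re z. Proof. by case: z. Qed.
Lemma ImJ z : Im z^*%C = - Im z. Proof. by case: z. Qed.
Lemma Re0 : Re 0 = 0. Proof. by []. Qed.
Lemma Im0 : Im 0 = 0. Proof. by []. Qed.
Lemma Re1 : Re 1 = 1. Proof. by []. Qed.
Lemma Im1 : Im 1 = 0. Proof. by []. Qed.
Definition ReImE := (Rei, Imi, Re0, Im0, Re1, Im1, ReD, ImD, ReN, ImN, ReM, ImM,
  ReC, ImC, ReJ, ImJ).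

Lemma complexP z w : Re z = Re w -> Im z = Im w -> z = w.
Proof. by case: z w => [a b] [c d] /= -> ->. Qed.

Lemma normCE z : `|z| = (cmod z)%:C%C :> R[i].
Proof. by case: z. Qed.

Lemma cmodM z w : cmod (z * w) = cmod z * cmod w.
Proof. exact: Normc.normcM. Qed.

Lemma cmod_ge0 z : 0 <= cmod z.
Proof. by rewrite -ler0c -normCE. Qed.

Lemma cmod_eq0 z : (cmod z == 0) = (z == 0).
Proof. by rewrite -(inj_eq (@complexI R)) -normCE normr_eq0. Qed.

Lemma ler_cmodD z w : cmod (z + w) <= cmod z + cmod w.
Proof. by rewrite -lecR rmorphD -!normCE ler_normD. Qed.

Lemma cmodN z : cmod (- z) = cmod z.
Proof. by apply: (@complexI R); rewrite -!normCE normrN. Qed.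

Lemma cmod_real (a : R) : cmod a%:C%C = `|a|.
Proof. by rewrite /cmod /= expr0n addr0 sqrtr_sqr. Qed.

Lemma Re_le_cmod z : `|Re z| <= cmod z.
Proof. by rewrite -lecR -normCE normc_ge_Re. Qed.

Lemma Im_le_cmod z : `|Im z| <= cmod z.
Proof. by case: z => a b; rewrite /cmod /= -sqrtr_sqr ler_wsqrtr // lerDr sqr_ge0. Qed.

Lemma cmod_le_ReIm z : cmod z <= `|Re z| + `|Im z|.
Proof.
rewrite {1}[z]complexE; apply: (le_trans (ler_cmodD _ _)).
rewrite cmodM !cmod_real.
have -> : cmod ('i%C : R[i]) = 1 by rewrite /cmod /= expr0n add0r expr1n sqrtr1.
by rewrite mul1r.
Qed.

Lemma cmod_sqrE z : (cmod z ^+ 2)%:C%C = z * z^*%C.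
Proof. by rewrite cmod_sqr; apply: complexP; rewrite !ReImE; ring. Qed.

(** R[i] carries the topology of its norm; all limits are reduced to the two
    real components, where the calculus of real functions applies. *)
Lemma cvg_complexP (T : Type) (Fl : set_system T) (FF : Filter Fl)
   (f : T -> R[i]^o) (l : R[i]^o) :
  (f x @[x --> Fl] --> l) <->
  ((Re (f x) @[x --> Fl] --> Re l) /\ (Im (f x) @[x --> Fl] --> Im l)).
Proof.
split.
  move=> /cvgrPdist_le H; split; apply/cvgrPdist_le => e e0.
    have /H : (0 : R[i]) < e%:C%C by rewrite ltcR.
    apply: filterS => x; rewrite normCE lecR; apply: le_trans.
    by rewrite -ReN -ReD Re_le_cmod.
  have /H : (0 : R[i]) < e%:C%C by rewrite ltcR.
  apply: filterS => x; rewrite normCE lecR; apply: le_trans.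
  by rewrite -ImN -ImD Im_le_cmod.
move=> [/cvgrPdist_le H1 /cvgrPdist_le H2]; apply/cvgrPdist_le => e e0.
have ee : e = (Re e)%:C%C by rewrite RRe_real // ger0_real // ltW.
have e1 : 0 < Re e / 2 by rewrite divr_gt0 // -ltcR -ee.
apply: filterS2 (H1 _ e1) (H2 _ e1) => x h1 h2.
rewrite ee normCE lecR; apply: (le_trans (cmod_le_ReIm _)).
by rewrite !ReImE [leRHS]splitr lerD.
Qed.

Lemma continuous_complexP (T : topologicalType) (f : T -> R[i]^o) :
  continuous f <->
  continuous (fun x : T => Re (f x)) /\ continuous (fun x : T => Im (f x)).
Proof.
split=> [H|[H1 H2] x]; first by split=> x; case/cvg_complexP: (H x).
by apply/cvg_complexP; split; [exact: H1|exact: H2].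
Qed.

(** The derivative of a complex-valued function of a real variable, through its
    two components. *)
Definition cdrv F x l :=
  is_derive x 1 (fun s => Re (F s)) (Re l) /\ is_derive x 1 (fun s => Im (F s)) (Im l).

Lemma cdrv_eq F x l l' : cdrv F x l' -> l' = l -> cdrv F x l.
Proof. by move=> H <-. Qed.

Lemma cdrv_ext F G x l : F =1 G -> cdrv F x l -> cdrv G x l.
Proof. by move=> /funext ->. Qed.

Lemma cdrv_cst l x : cdrv (fun=> l) x 0.
Proof. by split; exact: is_derive_cst. Qed.

Lemma cdrvD F G x l l' : cdrv F x l -> cdrv G x l' ->
  cdrv (fun s => F s + G s) x (l + l').
Proof.
move=> [h1 h2] [h3 h4]; split; rewrite ReImE; under eq_fun do rewrite ReImE.
  exact: is_deriveD.
exact: is_deriveD.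
Qed.

Lemma cdrvN F x l : cdrv F x l -> cdrv (fun s => - F s) x (- l).
Proof.
move=> [h1 h2]; split; rewrite ReImE; under eq_fun do rewrite ReImE.
  exact: is_deriveN.
exact: is_deriveN.
Qed.

Lemma cdrvB F G x l l' : cdrv F x l -> cdrv G x l' ->
  cdrv (fun s => F s - G s) x (l - l').
Proof. by move=> h1 /cdrvN; exact: cdrvD. Qed.

Lemma cdrvM F G x l l' : cdrv F x l -> cdrv G x l' ->
  cdrv (fun s => F s * G s) x (l * G x + F x * l').
Proof.
move=> [h1 h2] [h3 h4]; split; rewrite !ReImE; under eq_fun do rewrite ReImE.
  apply: (@is_derive_eq _ _ _ _ _ _ _ _ (is_deriveB (is_deriveM h1 h3) (is_deriveM h2 h4))).
  rewrite /GRing.scale /=; ring.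
apply: (@is_derive_eq _ _ _ _ _ _ _ _ (is_deriveD (is_deriveM h1 h4) (is_deriveM h2 h3))).
rewrite /GRing.scale /=; ring.
Qed.

Lemma cdrvZ a F x l : cdrv F x l -> cdrv (fun s => a * F s) x (a * l).
Proof.
move=> h; apply: cdrv_eq (cdrvM (cdrv_cst a x) h) _; rewrite mul0r add0r //.
Qed.

Lemma cdrv_real (f : R -> R) x (d : R) : is_derive x 1 f d ->
  cdrv (fun s => (f s)%:C%C) x d%:C%C.
Proof. by split => //=; exact: is_derive_cst. Qed.

Lemma cdrv_id x : cdrv (fun s => s%:C%C) x 1.
Proof. by apply: (@cdrv_real id); exact: is_derive_id. Qed.

Lemma cdrvJ F x l : cdrv F x l -> cdrv (fun s => (F s)^*%C) x l^*%C.
Proof.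
move=> [h1 h2]; split; rewrite ReImE; under eq_fun do rewrite ReImE.
  exact: h1.
exact: is_deriveN.
Qed.

Lemma is_derive_compE (f g : R -> R) x (a b d : R) :
  is_derive (g x) 1 f a -> is_derive x 1 g b -> a * b = d ->
  is_derive x 1 (fun s => f (g s)) d.
Proof. by move=> hf hg <-; exact: (@is_derive1_comp _ f g _ _ _ hf hg). Qed.

Lemma cdrv_cont F x l : cdrv F x l -> {for x, continuous (F : R -> R[i]^o)}.
Proof.
move=> [h1 h2]; apply/cvg_complexP; split.
  by apply: differentiable_continuous; apply/derivable1_diffP; case: h1.
by apply: differentiable_continuous; apply/derivable1_diffP; case: h2.
Qed.

Definition cexp z : R[i] := (expR (Re z))%:C%C * expi (Im z).

Lemma cexpD z w : cexp (z + w) = cexp z * cexp w.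
Proof.
rewrite /cexp ReD ImD expRD rmorphM -mulrACA; congr (_ * _).
by apply: complexP; rewrite ReImE /= ?cosD ?sinD //; ring.
Qed.

Lemma cexp0 : cexp 0 = 1.
Proof. by rewrite /cexp /expi /= expR0 cos0 sin0 mul1r. Qed.

Lemma cexp_neq0 z : cexp z != 0.
Proof.
apply/eqP => h; have := cexpD z (- z); rewrite subrr cexp0 h mul0r => /eqP.
by rewrite oner_eq0.
Qed.

Lemma cexpN z : cexp (- z) = (cexp z)^-1.
Proof.
by apply: (mulIf (cexp_neq0 z)); rewrite -cexpD addNr cexp0 mulVf ?cexp_neq0.
Qed.

Lemma cmod_expi (a : R) : cmod (expi a) = 1.
Proof. by rewrite /cmod /expi /= cos2Dsin2 sqrtr1. Qed.

Lemma cmod_cexp z : cmod (cexp z) = expR (Re z).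
Proof. by rewrite cmodM cmod_expi mulr1 cmod_real gtr0_norm // expR_gt0. Qed.

Lemma cexpJ z : (cexp z)^*%C = cexp z^*%C.
Proof.
by case: z => a b; apply: complexP; rewrite !ReImE /= ?cosN ?sinN; ring.
Qed.

Lemma cdrv_cexp F x l : cdrv F x l -> cdrv (fun s => cexp (F s)) x (l * cexp (F x)).
Proof.
move=> [h1 h2].
have e1 : cdrv (fun s => (expR (Re (F s)))%:C%C) x (Re l * expR (Re (F x)))%:C%C.
  by apply: cdrv_real; apply: is_derive_compE (is_derive_expR _) h1 _; rewrite mulrC.
have e2 : cdrv (fun s => expi (Im (F s))) x ('i%C * (Im l)%:C%C * expi (Im (F x))).
  split => /=.
    by apply: is_derive_compE (is_derive_cos _) h2 _; ring.
  by apply: is_derive_compE (is_derive_sin _) h2 _; ring.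
apply: cdrv_eq (cdrvM e1 e2) _; rewrite /cexp {3}[l]complexE rmorphM; ring.
Qed.

(** The mean value theorem applied to both components. *)
Lemma cdrv0_cst F : (forall x, cdrv F x 0) -> forall x y, F x = F y.
Proof.
move=> H x y; apply: complexP.
  by apply: (@is_derive_0_is_cst R (fun s => Re (F s))) => s; case: (H s).
by apply: (@is_derive_0_is_cst R (fun s => Im (F s))) => s; case: (H s).
Qed.

(** The scalar linear equation with constant coefficient has only the
    exponential solutions. *)
Lemma cdrv_ode F a : (forall x, cdrv F x (a * F x)) ->
  forall x, F x = cexp (x%:C%C * a) * F 0.
Proof.
move=> H x.
have H1 : forall s, cdrv (fun s => cexp (- a * s%:C%C) * F s) s 0.
  move=> s; apply: cdrv_eq (cdrvM (cdrv_cexp (cdrvZ (- a) (cdrv_id s))) (H s)) _.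
  ring.
have := cdrv0_cst H1 x 0; rewrite mulr0 cexp0 mul1r => <-.
by rewrite mulrA -cexpD mulNr [a * _]mulrC subrr cexp0 mul1r.
Qed.

End ComplexCalculus.

(** * Differentiation along lines in the Heisenberg group *)

Section RealCalculus.
Variable R : realType.
Implicit Types (f df : R -> R).

(** A formulation with explicit constants, convenient when the increment of the
    function is estimated along a broken line. *)
Lemma is_derive_eps f (x l : R) :
  (forall e, 0 < e -> exists2 d, 0 < d &
    forall s, `|s| < d -> `|f (x + s) - f x - l * s| <= e * `|s|) ->
  is_derive x 1 f l.
Proof.
move=> H.
have c : h^-1 *: ((f \o shift x) (h *: (1 : R)) - f x) @[h --> 0^'] --> l.
  apply/cvgrPdist_le => e e0; have [d d0 Hd] := H e e0.
  near=> h.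
  have h0 : h != 0 by near: h; exact: nbhs_dnbhs_neq.
  rewrite /= [h *: 1]mulr1.
  have -> : l - h^-1 *: (f (h + x) - f x) = - h^-1 * (f (x + h) - f x - l * h).
    by rewrite /GRing.scale /= (addrC h x); field.
  rewrite normrM normrN normfV ler_pdivrMl ?normr_gt0 // [leRHS]mulrC Hd //.
  near: h; apply: dnbhs0_lt => //.
apply: DeriveDef; first by apply/cvg_ex; exists l.
exact: cvg_lim c.
Unshelve. all: end_near. Qed.

(** The mean value theorem with the intermediate point bounded by the increment,
    for increments of either sign. *)
Lemma MVT_abs f df : (forall x : R, is_derive x 1 f (df x)) ->
  forall s, exists2 t, `|t| <= `|s| & f s - f 0 = df t * s.
Proof.
move=> H s.
have cf a b : {within `[a, b], continuous f}.
  apply: continuous_subspaceT => x; apply: differentiable_continuous.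
  by apply/derivable1_diffP; case: (H x).
have [s0|s0] := leP 0 s.
  have [c] := MVT_segment s0 (fun x _ => H x) (cf _ _).
  rewrite in_itv /= => /andP[c0 cs] ->; exists c; last by rewrite subr0.
  by rewrite !ger0_norm.
have [c] := MVT_segment (ltW s0) (fun x _ => H x) (cf _ _).
rewrite in_itv /= => /andP[c0 cs] E; exists c.
  by rewrite !ler0_norm ?lerN2 // ltW.
by apply: oppr_inj; rewrite opprB E sub0r mulrN.
Qed.

End RealCalculus.

Section HeisCalculus.
Variable R : realType.
Implicit Types (p q : heis R) (v w : R[i] * R).
Local Notation Re := (@complex.Re R).
Local Notation Im := (@complex.Im R).

Lemma heisP p q : Re (hz p) = Re (hz q) -> Im (hz p) = Im (hz q) ->
  ht p = ht q -> p = q.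
Proof. by case: p q => [[a b] s] [[a' b'] s'] /= -> -> ->. Qed.

Lemma continuous_hz : continuous (@hz R : heis R -> R[i]^o).
Proof.
move=> p; apply: (@continuous_comp _ _ _ (@heis_pair R) fst).
  exact: initial_continuous.
exact: cvg_fst.
Qed.

Lemma continuous_ht : continuous (@ht R : heis R -> R^o).
Proof.
move=> p; apply: (@continuous_comp _ _ _ (@heis_pair R) snd).
  exact: initial_continuous.
exact: cvg_snd.
Qed.

Lemma continuous_heisP (T : topologicalType) (g : T -> heis R) :
  continuous (fun x : T => Re (hz (g x))) -> continuous (fun x : T => Im (hz (g x))) ->
  continuous (fun x : T => ht (g x)) -> continuous g.
Proof.
move=> c1 c2 c3; apply: continuous_comp_initial => x.
have c12 : (hz (g y) : R[i]^o) @[y --> x] --> (hz (g x) : R[i]^o).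
  by apply/cvg_complexP; split; [exact: c1|exact: c2].
exact: (cvg_pair c12 (c3 x)).
Qed.

Lemma continuous_hline v : continuous (fun x : heis R * R => hline v x.1 x.2).
Proof.
have cc (h : heis R -> R) : continuous h -> continuous (fun x : heis R * R => h x.1).
  by move=> ch y; apply: (@continuous_comp _ _ _ fst h); [exact: cvg_fst|exact: ch].
have /continuous_complexP[cR cI] := continuous_hz.
apply: continuous_heisP.
- have -> : (fun x : heis R * R => Re (hz (hline v x.1 x.2))) =
   fun x => Re (hz x.1) + x.2 * Re v.1.
    by apply/funext => x; rewrite /= !ReImE mul0r subr0.
  move=> x; apply: cvgD.
    exact: (cc _ cR).
  by apply: cvgM; [exact: cvg_snd|exact: cvg_cst].
- have -> : (fun x : heis R * R => Im (hz (hline v x.1 x.2))) =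
   fun x => Im (hz x.1) + x.2 * Im v.1.
    by apply/funext => x; rewrite /= !ReImE mul0r addr0.
  move=> x; apply: cvgD.
    exact: (cc _ cI).
  by apply: cvgM; [exact: cvg_snd|exact: cvg_cst].
- move=> x /=; apply: cvgD.
    exact: (cc _ continuous_ht).
  by apply: cvgM; [exact: cvg_snd|exact: cvg_cst].
Qed.

Lemma hz_hline v p s : hz (hline v p s) = hz p + s%:C%C * v.1. Proof. by []. Qed.
Lemma ht_hline v p s : ht (hline v p s) = ht p + s * v.2. Proof. by []. Qed.

Lemma hline0 v p : hline v p 0 = p.
Proof. by apply: heisP; rewrite /= ?ReImE; ring. Qed.

Lemma hlineD v p s s' : hline v p (s + s') = hline v (hline v p s) s'.
Proof. by apply: heisP; rewrite /= ?ReImE; ring. Qed.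

Lemma hlineC v w p s t : hline v (hline w p s) t = hline w (hline v p t) s.
Proof. by apply: heisP; rewrite /= ?ReImE; ring. Qed.

(** Broken lines of up to three segments occur in the chain rule and in second
    differences. *)
Lemma continuous_hline3 (u : heis R -> R) p v1 v2 v3 : continuous u ->
  forall e, 0 < e -> exists2 d, 0 < d &
    forall s1 s2 s3, `|s1| < d -> `|s2| < d -> `|s3| < d ->
     `|u (hline v3 (hline v2 (hline v1 p s1) s2) s3) - u p| < e.
Proof.
move=> cu e e0.
pose g (x : R * R * R) := hline v3 (hline v2 (hline v1 p x.1.1) x.1.2) x.2.
have cg : continuous (g : R * R * R -> heis R).
  have cL v (h : R * R * R -> heis R) (k : R * R * R -> R) :
     continuous h -> continuous k -> continuous (fun x => hline v (h x) (k x)).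
    move=> ch ck y.
    apply: (@continuous_comp _ _ _ (fun y => (h y, k y)) (fun x => hline v x.1 x.2)).
      exact: (cvg_pair (ch y) (ck y)).
    exact: continuous_hline.
  have c1 : continuous (fun x : R * R * R => x.1.1).
    by move=> y; apply: (@continuous_comp _ _ _ fst fst); exact: cvg_fst.
  have c2 : continuous (fun x : R * R * R => x.1.2).
    by move=> y; apply: (@continuous_comp _ _ _ fst snd); [exact: cvg_fst|exact: cvg_snd].
  have c3 : continuous (fun x : R * R * R => x.2) by move=> y; exact: cvg_snd.
  have cp : continuous ((fun=> p) : R * R * R -> heis R) by move=> ?; exact: cvg_cst.
  exact: (cL v3 _ _ (cL v2 _ _ (cL v1 _ _ cp c1) c2) c3).
have cug : continuous (u \o g) by move=> x; apply: continuous_comp; [exact: cg|exact: cu].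
have g0 : (u \o g) (0, 0, 0) = u p by rewrite /g /= !hline0.
have := cug (0, 0, 0); rewrite /continuous_at g0.
move=> /cvgrPdist_lt /(_ e e0) [[A B]] /= [[[A1 A2] /= [[d1 /= d10 H1] [d2 /= d20 H2]] HA]].
move=> [d3 /= d30 H3] HAB.
exists (Num.min d1 (Num.min d2 d3)); first by rewrite !lt_min d10 d20 d30.
move=> s1 s2 s3; rewrite !lt_min => /and3P[h1 _ _] /and3P[_ h2 _] /and3P[_ _ h3].
rewrite distrC; apply: (HAB (s1, s2, s3)); split => /=.
  apply: HA; split => /=; [apply: H1|apply: H2]; by rewrite /ball /= sub0r normrN.
by apply: H3; rewrite /ball /= sub0r normrN.
Qed.

Definition hdr v (u u' : heis R -> R) :=
  forall p, is_derive (0 : R) 1 (fun s : R => u (hline v p s)) (u' p).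

Lemma hdr_at v u u' : hdr v u u' -> forall p s,
  is_derive (s : R) 1 (fun s : R => u (hline v p s)) (u' (hline v p s)).
Proof.
move=> H p s.
have -> : (fun s => u (hline v p s)) = fun x => u (hline v (hline v p s) (x - s)).
  by apply/funext => x; rewrite -hlineD addrC subrK.
have h : is_derive (s : R) 1 (fun x : R => x - s) 1.
  apply: (@is_derive_eq _ _ _ _ _ _ _ _ (is_deriveB (is_derive_id _ _) (is_derive_cst _ _ _))).
  by rewrite subr0.
apply: (@is_derive_compE _ (fun x => u (hline v (hline v p s) x)) (fun x => x - s) s _ _ _ _ h).
  by rewrite subrr; exact: H.
by rewrite mulr1.
Qed.

Lemma hdr_MVT v u u' : hdr v u u' -> forall p s,
  exists2 t, `|t| <= `|s| & u (hline v p s) - u p = u' (hline v p t) * s.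
Proof.
move=> H p s; have [t ts E] := MVT_abs (hdr_at H p) s.
by exists t => //; move: E; rewrite hline0.
Qed.

(** The increment along v is split into increments along the coordinate
    directions; on each piece the mean value theorem gives a value of the partial
    derivative at a nearby point. *)
Lemma hdr_chain (u ux uy ut : heis R -> R) v :
  continuous ux -> continuous uy -> continuous ut ->
  hdr (dirx R) u ux -> hdr (diry R) u uy -> hdr (dirt R) u ut ->
  hdr v u (fun p => Re v.1 * ux p + Im v.1 * uy p + v.2 * ut p).
Proof.
move=> cx cy ct hx hy ht p; apply: is_derive_eps => e e0.
set K := `|Re v.1| + `|Im v.1| + `|v.2| + 1.
have K0 : 0 < K by rewrite /K ltr_wpDl // !addr_ge0.
have eK : 0 < e / K by rewrite divr_gt0.
have [d1 d10 H1] := continuous_hline3 p (dirx R) (diry R) (dirt R) cx eK.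
have [d2 d20 H2] := continuous_hline3 p (dirx R) (diry R) (dirt R) cy eK.
have [d3 d30 H3] := continuous_hline3 p (dirx R) (diry R) (dirt R) ct eK.
exists (Num.min d1 (Num.min d2 d3) / K).
  by rewrite divr_gt0 // !lt_min d10 d20 d30.
move=> s; rewrite ltr_pdivlMr // add0r => sK.
have small a d (t : R) : `|a| <= K -> Num.min d1 (Num.min d2 d3) <= d ->
    `|t| <= `|s * a| -> `|t| < d.
  move=> aK dd ts; apply: (le_lt_trans ts); rewrite normrM.
  apply: lt_le_trans dd; apply: le_lt_trans sK.
  by rewrite ler_wpM2l.
have aK : `|Re v.1| <= K by rewrite /K -!addrA lerDl !addr_ge0.
have bK : `|Im v.1| <= K by rewrite /K -!addrA [leRHS]addrCA lerDl !addr_ge0.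
have cK : `|v.2| <= K by rewrite /K -addrA [leRHS]addrCA lerDl !addr_ge0.
have m1 : Num.min d1 (Num.min d2 d3) <= d1 by rewrite ge_min lexx.
have m2 : Num.min d1 (Num.min d2 d3) <= d2 by rewrite !ge_min lexx orbT.
have m3 : Num.min d1 (Num.min d2 d3) <= d3 by rewrite !ge_min lexx !orbT.
have -> : hline v p s = hline (dirt R) (hline (diry R) (hline (dirx R) p
   (s * Re v.1)) (s * Im v.1)) (s * v.2).
  by apply: heisP; rewrite /dirx /diry /dirt ?(hz_hline, ht_hline);
    cbn [fst snd]; rewrite ?ReImE; ring.
set p1 := hline _ p _; set p2 := hline _ p1 _; set p3 := hline _ p2 _.
have [t1 ht1 E1] := hdr_MVT hx p (s * Re v.1).
have [t2 ht2 E2] := hdr_MVT hy p1 (s * Im v.1).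
have [t3 ht3 E3] := hdr_MVT ht p2 (s * v.2).
have z0 d : Num.min d1 (Num.min d2 d3) <= d -> `|0 : R| < d.
  by rewrite normr0; apply: lt_le_trans; rewrite !lt_min d10 d20 d30.
have B1 : `|ux (hline (dirx R) p t1) - ux p| < e / K.
  have := H1 t1 0 0 (small _ _ _ aK m1 ht1) (z0 _ m1) (z0 _ m1).
  by rewrite !hline0.
have B2 : `|uy (hline (diry R) p1 t2) - uy p| < e / K.
  have := H2 _ t2 0 (small _ _ _ aK m2 (lexx _)) (small _ _ _ bK m2 ht2) (z0 _ m2).
  by rewrite !hline0.
have B3 : `|ut (hline (dirt R) p2 t3) - ut p| < e / K.
  exact: H3 (small _ _ _ aK m3 (lexx _)) (small _ _ _ bK m3 (lexx _)) (small _ _ _ cK m3 ht3).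
rewrite hline0.
have -> : u p3 - u p - (Re v.1 * ux p + Im v.1 * uy p + v.2 * ut p) * s =
  (ux (hline (dirx R) p t1) - ux p) * (s * Re v.1) +
  (uy (hline (diry R) p1 t2) - uy p) * (s * Im v.1) +
  (ut (hline (dirt R) p2 t3) - ut p) * (s * v.2).
  rewrite !mulrBl -E1 -E2 -E3 -/p1 -/p2 -/p3; ring.
apply: (@le_trans _ _ (e / K * (`|s| * `|Re v.1|) + e / K * (`|s| * `|Im v.1|) +
   e / K * (`|s| * `|v.2|))).
  apply: (le_trans (ler_normD _ _)); apply: lerD.
    apply: (le_trans (ler_normD _ _)); apply: lerD.
      by rewrite !normrM ler_wpM2r ?mulr_ge0 // ltW.
    by rewrite !normrM ler_wpM2r ?mulr_ge0 // ltW.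
  by rewrite !normrM ler_wpM2r ?mulr_ge0 // ltW.
rewrite -!mulrDr mulrCA mulrC ler_wpM2r //.
rewrite -mulrA ler_piMr ?(ltW e0) // ler_pdivrMl // mulr1.
by rewrite /K lerDl.
Qed.

(** Symmetry of second derivatives: both mixed derivatives are limits of the
    same second difference quotient. *)
Lemma hdr_symmetric (u uv uw uvw uwv : heis R -> R) v w :
  continuous uvw -> continuous uwv ->
  hdr v u uv -> hdr w u uw -> hdr w uv uvw -> hdr v uw uwv -> uvw = uwv.
Proof.
move=> c1 c2 hv hw hvw hwv; apply/funext => p.
apply/eqP; rewrite -subr_eq0; apply/eqP/normr0_eq0/eqP; rewrite eq_le normr_ge0 andbT.
apply/ler_addgt0Pr => e e0; rewrite add0r.
have e2 : 0 < e / 2 by rewrite divr_gt0.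
have [d1 d10 H1] := continuous_hline3 p v w w c1 e2.
have [d2 d20 H2] := continuous_hline3 p v w w c2 e2.
pose s := Num.min d1 d2 / 2.
have s0 : 0 < s by rewrite divr_gt0 // lt_min d10 d20.
have sd : s < Num.min d1 d2 by rewrite ltr_pdivrMr // ltr_pMr ?lt_min ?d10 ?d20 // ltr1n.
have [sd1 sd2] : s < d1 /\ s < d2 by move: sd; rewrite lt_min => /andP[].
pose phi q := u (hline w q s) - u q.
have hphi : hdr v phi (fun q => uv (hline w q s) - uv q).
  move=> q; apply: is_deriveB; last exact: hv.
  have -> : (fun s0 => u (hline w (hline v q s0) s)) = fun t => u (hline v (hline w q s) t).
    by apply/funext => t; rewrite hlineC.
  exact: hv.
pose psi q := u (hline v q s) - u q.
have hpsi : hdr w psi (fun q => uw (hline v q s) - uw q).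
  move=> q; apply: is_deriveB; last exact: hw.
  have -> : (fun s0 => u (hline v (hline w q s0) s)) = fun t => u (hline w (hline v q s) t).
    by apply/funext => t; rewrite hlineC.
  exact: hw.
have [t1 ht1 E1] := hdr_MVT hphi p s.
have [t2 ht2 E2] := hdr_MVT hvw (hline v p t1) s.
have [t3 ht3 E3] := hdr_MVT hpsi p s.
have [t4 ht4 E4] := hdr_MVT hwv (hline w p t3) s.
have ss : `|s| = s by rewrite gtr0_norm.
have eqD : phi (hline v p s) - phi p = psi (hline w p s) - psi p.
  rewrite /phi /psi (hlineC w v p s s); ring.
have E : uvw (hline w (hline v p t1) t2) = uwv (hline v (hline w p t3) t4).
  have := eqD; rewrite E1 E3 E2 E4 => /mulIf; rewrite gt_eqF // => /(_ isT) /mulIf.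
  by rewrite gt_eqF // => /(_ isT).
have n0 : `|0 : R| < d1 /\ `|0 : R| < d2 by rewrite normr0.
have := H1 t1 t2 0; have := H2 t4 t3 0.
rewrite !hline0 (hlineC w v) -E.
rewrite !ss in ht1 ht2 ht3 ht4.
move=> /(_ (le_lt_trans ht4 sd2) (le_lt_trans ht3 sd2) n0.2) B2.
move=> /(_ (le_lt_trans ht1 sd1) (le_lt_trans ht2 sd1) n0.1) B1.
set A := uvw (hline _ _ _) in B1 B2.
have -> : uvw p - uwv p = (A - uwv p) - (A - uvw p) by ring.
apply: (le_trans (ler_normB _ _)); rewrite [leRHS]splitr; apply: lerD; exact: ltW.
Qed.

End HeisCalculus.

(** * Smooth complex functions on the Heisenberg group *)

Section Continuity.
Variables (R : realType) (T : topologicalType).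
Local Notation Re := (@complex.Re R).
Local Notation Im := (@complex.Im R).

Lemma continuous_RD (f g : T -> R) : continuous f -> continuous g ->
  continuous (fun p => f p + g p).
Proof. by move=> cf cg p; apply: cvgD; [exact: cf|exact: cg]. Qed.

Lemma continuous_RN (f : T -> R) : continuous f -> continuous (fun p => - f p).
Proof. by move=> cf p; apply: cvgN; exact: cf. Qed.

Lemma continuous_RM (f g : T -> R) : continuous f -> continuous g ->
  continuous (fun p => f p * g p).
Proof. by move=> cf cg p; apply: cvgM; [exact: cf|exact: cg]. Qed.

Lemma continuous_comp_all (U V : topologicalType) (f : T -> U) (g : U -> V) :
  continuous f -> continuous g -> continuous (fun p => g (f p)).
Proof. by move=> cf cg p; apply: (@continuous_comp _ _ _ f g); [exact: cf|exact: cg]. Qed.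

Lemma continuous_complexD (f g : T -> R[i]^o) : continuous f -> continuous g ->
  continuous (fun p => f p + g p : R[i]^o).
Proof.
move=> /continuous_complexP[c1 c2] /continuous_complexP[c3 c4].
apply/continuous_complexP; split.
  under eq_fun do rewrite ReImE.
  exact: continuous_RD.
under eq_fun do rewrite ReImE.
exact: continuous_RD.
Qed.

Lemma continuous_complexM (f g : T -> R[i]^o) : continuous f -> continuous g ->
  continuous (fun p => f p * g p : R[i]^o).
Proof.
move=> /continuous_complexP[c1 c2] /continuous_complexP[c3 c4].
apply/continuous_complexP; split.
  under eq_fun do rewrite ReImE.
  apply: continuous_RD; first exact: continuous_RM.
  by apply: continuous_RN; exact: continuous_RM.
under eq_fun do rewrite ReImE.
by apply: continuous_RD; exact: continuous_RM.
Qed.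

Lemma continuous_complexJ (f : T -> R[i]^o) : continuous f ->
  continuous (fun p => (f p)^*%C : R[i]^o).
Proof.
move=> /continuous_complexP[c1 c2]; apply/continuous_complexP; split.
  by under eq_fun do rewrite ReImE.
under eq_fun do rewrite ReImE.
exact: continuous_RN.
Qed.

Lemma continuous_cexp (f : T -> R[i]^o) : continuous f ->
  continuous (fun p => cexp (f p) : R[i]^o).
Proof.
move=> /continuous_complexP[c1 c2]; apply: continuous_complexM;
  apply/continuous_complexP; split => /=.
- by apply: (continuous_comp_all c1); exact: continuous_expR.
- by move=> p; exact: cvg_cst.
- by apply: (continuous_comp_all c2); exact: continuous_cos.
- by apply: (continuous_comp_all c2); exact: continuous_sin.
Qed.

End Continuity.

Section HeisComplexCalculus.
Variable R : realType.
Implicit Types (p q : heis R) (v w : R[i] * R) (f g : heis R -> R[i]^o).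
Local Notation Re := (@complex.Re R).
Local Notation Im := (@complex.Im R).
Local Notation dirx := (dirx R).
Local Notation diry := (diry R).
Local Notation dirt := (dirt R).

Definition hdrv v f f' := forall p, cdrv (fun s => f (hline v p s)) 0 (f' p).

(* The two normed module structures of the real line agree. *)
Lemma is_deriveRo (g : R -> R) (x l : R) : is_derive x 1 g l <->
  derivable (g : R -> R^o) x 1 /\ derive1 (g : R -> R^o) x = l.
Proof.
rewrite derive1E; split=> [[h1 h2]|[h1 h2]]; first by split; [exact: h1|exact: h2].
by apply: DeriveDef; [exact: h1|exact: h2].
Qed.

(** The statement of differentiability in the calculus of the components and
    in the calculus of directional derivatives agree. *)
Lemma hdrvP v f f' : hdrv v f f' <-> hderivable v f /\ hderive v f = f'.
Proof.
split=> [H|[H E] p].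
  split=> [p|]; first by case: (H p) => /is_deriveRo[h1 _] /is_deriveRo[h2 _]; split; [exact: h1|exact: h2].
  apply/funext => p; case: (H p) => /is_deriveRo[_ h1] /is_deriveRo[_ h2].
  by apply: complexP; [exact: h1|exact: h2].
case: (H p) => h1 h2; split; apply/is_deriveRo; split.
- exact: h1.
- by rewrite -E.
- exact: h2.
- by rewrite -E.
Qed.

Lemma hdrvE v f f' : hdrv v f f' -> hderive v f = f'.
Proof. by case/hdrvP. Qed.

Lemma hdrv_hdr v f f' : hdrv v f f' <->
  hdr v (fun p => Re (f p)) (fun p => Re (f' p)) /\
  hdr v (fun p => Im (f p)) (fun p => Im (f' p)).
Proof. by split=> [H|[h1 h2] p]; split => //= p; case: (H p). Qed.

Lemma hdrv_at v f f' : hdrv v f f' -> forall p s,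
  cdrv (fun s => f (hline v p s)) s (f' (hline v p s)).
Proof. by move=> /hdrv_hdr[h1 h2] p s; split; [exact: (hdr_at h1)|exact: (hdr_at h2)]. Qed.

Lemma hdrv_cst v (c : R[i]) : hdrv v (fun=> c) (fun=> 0).
Proof. by move=> p; exact: cdrv_cst. Qed.

Lemma hdrvD v f g f' g' : hdrv v f f' -> hdrv v g g' ->
  hdrv v (fun p => f p + g p) (fun p => f' p + g' p).
Proof. by move=> hf hg p; exact: cdrvD. Qed.

Lemma hdrvM v f g f' g' : hdrv v f f' -> hdrv v g g' ->
  hdrv v (fun p => f p * g p) (fun p => f' p * g p + f p * g' p).
Proof. by move=> hf hg p; apply: cdrv_eq (cdrvM (hf p) (hg p)) _; rewrite hline0. Qed.

Lemma hdrvJ v f f' : hdrv v f f' -> hdrv v (fun p => (f p)^*%C) (fun p => (f' p)^*%C).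
Proof. by move=> hf p; exact: cdrvJ. Qed.

Lemma hdrv_cexp v f f' : hdrv v f f' ->
  hdrv v (fun p => cexp (f p)) (fun p => f' p * cexp (f p)).
Proof. by move=> hf p; apply: cdrv_eq (cdrv_cexp (hf p)) _; rewrite hline0. Qed.

Lemma hdrv_hz v : hdrv v (@hz R) (fun=> v.1).
Proof.
move=> p; apply: cdrv_eq (cdrvD (cdrv_cst (hz p) 0) (cdrvM (cdrv_id 0) (cdrv_cst v.1 0))) _.
by rewrite mul1r mulr0 addr0 add0r.
Qed.

Lemma hdrv_ht v : hdrv v (fun p => (ht p)%:C%C) (fun=> (v.2)%:C%C).
Proof.
move=> p; apply: cdrv_eq (cdrv_ext _ (cdrvD (cdrv_cst (ht p)%:C%C 0)
  (cdrvM (cdrv_id 0) (cdrv_cst (v.2)%:C%C 0)))) _.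
  by move=> s; rewrite ht_hline rmorphD rmorphM.
by rewrite mul1r mulr0 addr0 add0r.
Qed.

Lemma hdrv_chain f fx fy ft v :
  continuous fx -> continuous fy -> continuous ft ->
  hdrv dirx f fx -> hdrv diry f fy -> hdrv dirt f ft ->
  hdrv v f (fun p => (Re v.1)%:C%C * fx p + (Im v.1)%:C%C * fy p + (v.2)%:C%C * ft p).
Proof.
move=> /continuous_complexP[cx1 cx2] /continuous_complexP[cy1 cy2].
move=> /continuous_complexP[ct1 ct2] /hdrv_hdr[hx1 hx2] /hdrv_hdr[hy1 hy2] /hdrv_hdr[ht1 ht2].
apply/hdrv_hdr; split.
  have -> : (fun p => Re ((Re v.1)%:C%C * fx p + (Im v.1)%:C%C * fy p + (v.2)%:C%C * ft p))
     = (fun p => Re v.1 * Re (fx p) + Im v.1 * Re (fy p) + v.2 * Re (ft p)).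
    by apply/funext => p; rewrite !ReImE; ring.
  exact: hdr_chain.
have -> : (fun p => Im ((Re v.1)%:C%C * fx p + (Im v.1)%:C%C * fy p + (v.2)%:C%C * ft p))
     = (fun p => Re v.1 * Im (fx p) + Im v.1 * Im (fy p) + v.2 * Im (ft p)).
  by apply/funext => p; rewrite !ReImE; ring.
exact: hdr_chain.
Qed.

Lemma CnS n f : Cn n.+1 f <-> [/\ continuous f,
  exists2 fx, hdrv dirx f fx & Cn n fx,
  exists2 fy, hdrv diry f fy & Cn n fy &
  exists2 ft, hdrv dirt f ft & Cn n ft].
Proof.
split=> [[cf [[x1 x2] [y1 y2] [t1 t2]]]|[cf [fx /hdrvP[x1 <-] x2] [fy /hdrvP[y1 <-] y2]
   [ft /hdrvP[t1 <-] t2]]]; split => //.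
- by exists (hderive dirx f); [exact/hdrvP|exact: x2].
- by exists (hderive diry f); [exact/hdrvP|exact: y2].
- by exists (hderive dirt f); [exact/hdrvP|exact: t2].
Qed.

Lemma Cn_cont n f : Cn n f -> continuous f. Proof. by case: n => [|n] []. Qed.

Lemma CnW n f : Cn n.+1 f -> Cn n f.
Proof.
elim: n f => [|n IH] f /CnS[cf [fx hx cx] [fy hy cy] [ft ht ct]]; first by split.
by apply/CnS; split => //; [exists fx|exists fy|exists ft] => //; exact: IH.
Qed.

Lemma Cn_cst n (c : R[i]) : Cn n (fun=> c : R[i]^o).
Proof.
have cc (c' : R[i]) : continuous ((fun=> c') : heis R -> R[i]^o) by exact: cst_continuous.
elim: n c => [|n IH] c; first by split; [exact: cc|].
apply/CnS; split; first exact: cc; by exists (fun=> 0); [exact: hdrv_cst|exact: IH].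
Qed.

Lemma CnD n f g : Cn n f -> Cn n g -> Cn n (fun p => f p + g p).
Proof.
elim: n f g => [|n IH] f g.
  by move=> [cf _] [cg _]; split => [|//]; exact: (continuous_complexD cf cg).
move=> /CnS[cf [fx hx cx] [fy hy cy] [ft ht ct]].
move=> /CnS[cg [gx kx dx] [gy ky dy] [gt kt dt]].
apply/CnS; split.
- exact: (continuous_complexD cf cg).
- by exists (fun p => fx p + gx p); [exact: hdrvD|exact: IH].
- by exists (fun p => fy p + gy p); [exact: hdrvD|exact: IH].
- by exists (fun p => ft p + gt p); [exact: hdrvD|exact: IH].
Qed.

Lemma CnM n f g : Cn n f -> Cn n g -> Cn n (fun p => f p * g p).
Proof.
elim: n f g => [|n IH] f g.
  by move=> [cf _] [cg _]; split => [|//]; exact: (continuous_complexM cf cg).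
move=> Cf Cg; have [Df Dg] := (CnW Cf, CnW Cg).
move: Cf => /CnS[cf [fx hx cx] [fy hy cy] [ft ht ct]].
move: Cg => /CnS[cg [gx kx dx] [gy ky dy] [gt kt dt]].
apply/CnS; split.
- exact: (continuous_complexM cf cg).
- by exists (fun p => fx p * g p + f p * gx p); [exact: hdrvM|apply: CnD; exact: IH].
- by exists (fun p => fy p * g p + f p * gy p); [exact: hdrvM|apply: CnD; exact: IH].
- by exists (fun p => ft p * g p + f p * gt p); [exact: hdrvM|apply: CnD; exact: IH].
Qed.

Lemma CnJ n f : Cn n f -> Cn n (fun p => (f p)^*%C : R[i]^o).
Proof.
elim: n f => [|n IH] f; first by move=> [cf _]; split => [|//]; exact: continuous_complexJ.
move=> /CnS[cf [fx hx cx] [fy hy cy] [ft ht ct]]; apply/CnS; split; first exact: continuous_complexJ.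
- by exists (fun p => (fx p)^*%C); [exact: hdrvJ|exact: IH].
- by exists (fun p => (fy p)^*%C); [exact: hdrvJ|exact: IH].
- by exists (fun p => (ft p)^*%C); [exact: hdrvJ|exact: IH].
Qed.

Lemma Cn_cexp n f : Cn n f -> Cn n (fun p => cexp (f p) : R[i]^o).
Proof.
elim: n f => [|n IH] f; first by move=> [cf _]; split => [|//]; exact: continuous_cexp.
move=> Cf; have Df := CnW Cf.
move: Cf => /CnS[cf [fx hx cx] [fy hy cy] [ft ht ct]]; apply/CnS; split; first exact: continuous_cexp.
- by exists (fun p => fx p * cexp (f p)); [exact: hdrv_cexp|apply: CnM => //; exact: IH].
- by exists (fun p => fy p * cexp (f p)); [exact: hdrv_cexp|apply: CnM => //; exact: IH].
- by exists (fun p => ft p * cexp (f p)); [exact: hdrv_cexp|apply: CnM => //; exact: IH].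
Qed.

(** Group elements act by affine maps, so they carry a line in a fixed direction
    to a line in a fixed direction. *)
Definition sim_dir (x : sim R) v : R[i] * R :=
  ((siml x : R[i]) * v.1,
   cmod (siml x) ^+ 2 * v.2 + 2 * Im (hz (simg x) * ((siml x : R[i]) * v.1)^*%C)).

Lemma sim_act_hline x v p s : sim_act x (hline v p s) = hline (sim_dir x v) (sim_act x p) s.
Proof.
case: x => [[z0 t0] l]; rewrite /sim_act /sim_dir; apply: heisP => /=.
- by rewrite !ReImE; ring.
- by rewrite !ReImE; ring.
- by rewrite !ReImE; ring.
Qed.

Lemma continuous_sim_act (x : sim R) : continuous (sim_act x).
Proof.
have /continuous_complexP[cR cI] := @continuous_hz R.
have cC (a : R) : continuous (cst a : heis R -> R) by exact: cst_continuous.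
case: x => [[z0 t0] l]; apply: continuous_heisP => /=.
- have -> : (fun p => Re (z0 + cstar_val l * hz p)) =
     fun p => Re z0 + (Re l * Re (hz p) - Im l * Im (hz p)).
    by apply/funext => p; rewrite !ReImE.
  apply: continuous_RD; first exact: cC.
  apply: continuous_RD; first by apply: continuous_RM => //; exact: cC.
  by apply: continuous_RN; apply: continuous_RM => //; exact: cC.
- have -> : (fun p => Im (z0 + cstar_val l * hz p)) =
     fun p => Im z0 + (Re l * Im (hz p) + Im l * Re (hz p)).
    by apply/funext => p; rewrite !ReImE.
  apply: continuous_RD; first exact: cC.
  by apply: continuous_RD; apply: continuous_RM => //; exact: cC.
- have -> : (fun p => t0 + cmod l ^+ 2 * ht p + 2 * Im (z0 * (cstar_val l * hz p)^*%C)) =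
     fun p => t0 + cmod l ^+ 2 * ht p +
     (2 * (Im z0 * Re l - Re z0 * Im l) * Re (hz p) -
      2 * (Re z0 * Re l + Im z0 * Im l) * Im (hz p)).
    by apply/funext => p; rewrite !ReImE; ring.
  apply: continuous_RD.
    apply: continuous_RD; first exact: cC.
    by apply: continuous_RM; [exact: cC|exact: continuous_ht].
  apply: continuous_RD; first by apply: continuous_RM => //; exact: cC.
  by apply: continuous_RN; apply: continuous_RM => //; exact: cC.
Qed.

Lemma hdrv_act x v f f' : hdrv (sim_dir x v) f f' ->
  hdrv v (fun p => f (sim_act x p)) (fun p => f' (sim_act x p)).
Proof.
move=> H p; apply: cdrv_ext (H (sim_act x p)) => s /=.
by rewrite sim_act_hline.
Qed.

(** The action is affine along lines, so the derivatives of the composite are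
    combinations of composites of the derivatives of f with constant coefficients. *)
Lemma Cn_act n x f : Cn n f -> Cn n (fun p => f (sim_act x p)).
Proof.
have cA (g : heis R -> R[i]^o) : continuous g -> continuous (fun p => g (sim_act x p)).
  by move=> cg; apply: continuous_comp_all cg; exact: continuous_sim_act.
elim: n f => [|n IH] f; first by move=> [cf _]; split => [|//]; exact: (cA _ cf).
move=> /CnS[cf [fx hx cx] [fy hy cy] [ft ht ct]].
have D v : Cn n (fun p => (Re v.1)%:C%C * fx p + (Im v.1)%:C%C * fy p + (v.2)%:C%C * ft p).
  by apply: CnD; [apply: CnD|]; (apply: CnM; first exact: Cn_cst).
have E v : hdrv v (fun p => f (sim_act x p)) (fun p => (fun p =>
    (Re (sim_dir x v).1)%:C%C * fx p + (Im (sim_dir x v).1)%:C%C * fy p +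
    ((sim_dir x v).2)%:C%C * ft p) (sim_act x p)).
  apply: (@hdrv_act x v f (fun p =>
    (Re (sim_dir x v).1)%:C%C * fx p + (Im (sim_dir x v).1)%:C%C * fy p +
    ((sim_dir x v).2)%:C%C * ft p)).
  exact: (hdrv_chain _ (Cn_cont cx) (Cn_cont cy) (Cn_cont ct)).
apply/CnS; split; first exact: (cA _ cf).
by eexists; [exact: E|exact: (IH _ (D _))].
by eexists; [exact: E|exact: (IH _ (D _))].
by eexists; [exact: E|exact: (IH _ (D _))].
Qed.

Lemma smooth_cst (c : R[i]) : smooth (fun=> c : R[i]^o).
Proof. by move=> n; exact: Cn_cst. Qed.

Lemma smoothD f g : smooth f -> smooth g -> smooth (fun p => f p + g p).
Proof. by move=> hf hg n; exact: CnD. Qed.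

Lemma smoothM f g : smooth f -> smooth g -> smooth (fun p => f p * g p).
Proof. by move=> hf hg n; exact: CnM. Qed.

Lemma smoothZ (c : R[i]) f : smooth f -> smooth (fun p => c * f p).
Proof. by move=> hf; apply: smoothM => //; exact: smooth_cst. Qed.

Lemma smoothJ f : smooth f -> smooth (fun p => (f p)^*%C : R[i]^o).
Proof. by move=> hf n; exact: CnJ. Qed.

Lemma smooth_cexp f : smooth f -> smooth (fun p => cexp (f p) : R[i]^o).
Proof. by move=> hf n; exact: Cn_cexp. Qed.

Lemma smooth_act x f : smooth f -> smooth (fun p => f (sim_act x p)).
Proof. by move=> hf n; exact: Cn_act. Qed.

Lemma smooth_cont f : smooth f -> continuous f.
Proof. by move=> /(_ 0%N) []. Qed.

Lemma smooth_sum I (r : seq I) (P : pred I) (F : I -> heis R -> R[i]^o) :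
  (forall i, P i -> smooth (F i)) -> smooth (fun p => \sum_(i <- r | P i) F i p).
Proof.
move=> H; elim: r => [|i r IH].
  have -> : (fun p => \sum_(i <- [::] | P i) F i p) = fun=> 0.
    by apply/funext => p; rewrite big_nil.
  exact: smooth_cst.
case Pi : (P i).
  have -> : (fun p => \sum_(i <- i :: r | P i) F i p) =
     fun p => F i p + \sum_(i <- r | P i) F i p by apply/funext => p; rewrite big_cons Pi.
  by apply: smoothD => //; exact: H.
have -> : (fun p => \sum_(i <- i :: r | P i) F i p) = fun p => \sum_(i <- r | P i) F i p.
  by apply/funext => p; rewrite big_cons Pi.
exact: IH.
Qed.

Lemma smooth_coord (F : heis R -> R[i]^o) : continuous F ->
  (forall v, exists c, hdrv v F (fun=> c)) -> smooth F.
Proof.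
move=> cF H [|n]; first by split.
by apply/CnS; split => //; [case: (H dirx)|case: (H diry)|case: (H dirt)] => c hc;
  exists (fun=> c) => //; exact: Cn_cst.
Qed.

Lemma smooth_hz : smooth (@hz R : heis R -> R[i]^o).
Proof.
apply: smooth_coord; first exact: continuous_hz.
by move=> v; exists v.1; exact: hdrv_hz.
Qed.

Lemma smooth_ht : smooth (fun p : heis R => (ht p)%:C%C : R[i]^o).
Proof.
apply: smooth_coord; last by move=> v; exists (v.2)%:C%C; exact: hdrv_ht.
by apply/continuous_complexP; split; [exact: continuous_ht|exact: cst_continuous].
Qed.

Lemma smooth_Re f : smooth f -> smooth (fun p => (Re (f p))%:C%C : R[i]^o).
Proof.
move=> hf; have -> : (fun p => (Re (f p))%:C%C : R[i]^o) =
   fun p => (2^-1)%:C%C * (f p + (f p)^*%C).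
  by apply/funext => p; apply: complexP; rewrite !ReImE; field.
by apply: smoothZ; apply: smoothD => //; exact: smoothJ.
Qed.

Lemma smooth_Im f : smooth f -> smooth (fun p => (Im (f p))%:C%C : R[i]^o).
Proof.
move=> hf; have -> : (fun p => (Im (f p))%:C%C : R[i]^o) = fun p => (Re (- 'i%C * f p))%:C%C.
  by apply/funext => p; apply: complexP; rewrite !ReImE; ring.
by apply: (@smooth_Re (fun p => - 'i%C * f p)); exact: smoothZ.
Qed.

Definition coord_dir v := [\/ v = dirx, v = diry | v = dirt].

Lemma smooth_hdrv v f : coord_dir v -> smooth f -> hdrv v f (hderive v f).
Proof.
by move=> hv /(_ 1%N) [_ [[h1 _] [h2 _] [h3 _]]]; apply/hdrvP; case: hv => ->.
Qed.

Lemma smooth_hderive v f : coord_dir v -> smooth f -> smooth (hderive v f).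
Proof.
by move=> hv hf n; have [_ [[_ h1] [_ h2] [_ h3]]] := hf n.+1; case: hv => ->.
Qed.

Lemma smooth_chain v f : smooth f -> hdrv v f (fun p => (Re v.1)%:C%C * hderive dirx f p
  + (Im v.1)%:C%C * hderive diry f p + (v.2)%:C%C * hderive dirt f p).
Proof.
move=> hf; apply: hdrv_chain.
all: try (by apply: smooth_cont; apply: smooth_hderive => //; rewrite /coord_dir;
     by [constructor 1|constructor 2|constructor 3]).
all: by apply: smooth_hdrv => //; by [constructor 1|constructor 2|constructor 3].
Qed.

Lemma hdrv_symmetric v w f fv fw fvw fwv : continuous fvw -> continuous fwv ->
  hdrv v f fv -> hdrv w f fw -> hdrv w fv fvw -> hdrv v fw fwv -> fvw = fwv.
Proof.
move=> /continuous_complexP[e1 e2] /continuous_complexP[f1 f2] /hdrv_hdr[a1 a2].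
move=> /hdrv_hdr[b1 b2] /hdrv_hdr[c1 c2] /hdrv_hdr[d1 d2].
have H1 := hdr_symmetric e1 f1 a1 b1 c1 d1.
have H2 := hdr_symmetric e2 f2 a2 b2 c2 d2.
apply/funext => p; apply: complexP; first exact: (congr1 (fun u => u p) H1).
exact: (congr1 (fun u => u p) H2).
Qed.

Lemma hderiveC v w f : coord_dir v -> coord_dir w -> smooth f ->
  hderive v (hderive w f) = hderive w (hderive v f).
Proof.
move=> hv hw hf; have sv := smooth_hderive hv hf; have sw := smooth_hderive hw hf.
apply: (@hdrv_symmetric w v f (hderive w f) (hderive v f)).
- exact: (smooth_cont (smooth_hderive hv sw)).
- exact: (smooth_cont (smooth_hderive hw sv)).
- exact: (smooth_hdrv hw hf).
- exact: (smooth_hdrv hv hf).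
- exact: (smooth_hdrv hv sw).
- exact: (smooth_hdrv hw sv).
Qed.

End HeisComplexCalculus.

(** * The invariant vector fields *)

Section Operators.
Variable R : realType.
Implicit Types (p q : heis R) (v w : R[i] * R) (f g : heis R -> R[i]^o) (c : R[i]).
Local Notation Re := (@complex.Re R).
Local Notation Im := (@complex.Im R).
Local Notation dirx := (dirx R).
Local Notation diry := (diry R).
Local Notation dirt := (dirt R).

Lemma cdx : coord_dir dirx. Proof. by constructor 1. Qed.
Lemma cdy : coord_dir diry. Proof. by constructor 2. Qed.
Lemma cdt : coord_dir dirt. Proof. by constructor 3. Qed.

Definition Tfield f : heis R -> R[i]^o := hderive dirt f.
Definition Xfield f : heis R -> R[i]^o :=
  fun p => hderive dirx f p + (2 * Im (hz p))%:C%C * Tfield f p.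
Definition Yfield f : heis R -> R[i]^o :=
  fun p => hderive diry f p - (2 * Re (hz p))%:C%C * Tfield f p.

Lemma half2 : (2^-1 : R[i]) = (2^-1 : R)%:C%C.
Proof. by rewrite fmorphV /= rmorphMn. Qed.

Lemma ZfieldE f p : Zfield f p = 2^-1 * (Xfield f p - 'i%C * Yfield f p).
Proof.
rewrite /Zfield /d_z /Xfield /Yfield -/(Tfield f) half2.
move: (hderive _ f p) (hderive _ f p) (Tfield f p) => A B D.
by apply: complexP; rewrite !ReImE; field.
Qed.

Lemma ZbarfieldE f p : Zbarfield f p = 2^-1 * (Xfield f p + 'i%C * Yfield f p).
Proof.
rewrite /Zbarfield /d_zbar /Xfield /Yfield -/(Tfield f) half2.
move: (hderive _ f p) (hderive _ f p) (Tfield f p) => A B D.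
by apply: complexP; rewrite !ReImE; field.
Qed.

Lemma smooth_2Im : smooth (fun p : heis R => (2 * Im (hz p))%:C%C : R[i]^o).
Proof.
have -> : (fun p : heis R => (2 * Im (hz p))%:C%C : R[i]^o) =
   fun p => 2%:C%C * (Im (hz p))%:C%C by apply/funext => p; rewrite rmorphM.
by apply: smoothZ; exact: (smooth_Im (@smooth_hz R)).
Qed.

Lemma smooth_2Re : smooth (fun p : heis R => (2 * Re (hz p))%:C%C : R[i]^o).
Proof.
have -> : (fun p : heis R => (2 * Re (hz p))%:C%C : R[i]^o) =
   fun p => 2%:C%C * (Re (hz p))%:C%C by apply/funext => p; rewrite rmorphM.
by apply: smoothZ; exact: (smooth_Re (@smooth_hz R)).
Qed.

Lemma smooth_T f : smooth f -> smooth (Tfield f).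
Proof. by move=> sf; apply: smooth_hderive => //; exact: cdt. Qed.

Lemma smooth_X f : smooth f -> smooth (Xfield f).
Proof.
move=> sf; apply: smoothD; first by apply: smooth_hderive => //; exact: cdx.
apply: smoothM; [exact: smooth_2Im|exact: smooth_T].
Qed.

Lemma smoothN f : smooth f -> smooth (fun p => - f p).
Proof.
move=> sf; have -> : (fun p => - f p) = fun p => (-1) * f p.
  by apply/funext => p; rewrite mulN1r.
exact: smoothZ.
Qed.

Lemma smooth_Y f : smooth f -> smooth (Yfield f).
Proof.
move=> sf; apply: smoothD; first by apply: smooth_hderive => //; exact: cdy.
apply: smoothN; apply: smoothM; [exact: smooth_2Re|exact: smooth_T].
Qed.

Lemma smooth_Z f : smooth f -> smooth (Zfield f).
Proof.
move=> sf; have -> : Zfield f = fun p => 2^-1 * (Xfield f p + (- 'i%C) * Yfield f p).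
  by apply/funext => p; rewrite ZfieldE mulNr.
apply: smoothZ; apply: smoothD; first exact: smooth_X.
by apply: smoothZ; exact: smooth_Y.
Qed.

Lemma smooth_Zbar f : smooth f -> smooth (Zbarfield f).
Proof.
move=> sf; have -> : Zbarfield f = fun p => 2^-1 * (Xfield f p + 'i%C * Yfield f p).
  by apply/funext => p; rewrite ZbarfieldE.
apply: smoothZ; apply: smoothD; first exact: smooth_X.
by apply: smoothZ; exact: smooth_Y.
Qed.

Lemma hderiveM v f g : coord_dir v -> smooth f -> smooth g ->
  hderive v (fun p => f p * g p) = fun p => hderive v f p * g p + f p * hderive v g p.
Proof. by move=> hv sf sg; apply: hdrvE; apply: hdrvM; exact: smooth_hdrv. Qed.

Lemma hderiveD v f g : coord_dir v -> smooth f -> smooth g ->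
  hderive v (fun p => f p + g p) = fun p => hderive v f p + hderive v g p.
Proof. by move=> hv sf sg; apply: hdrvE; apply: hdrvD; exact: smooth_hdrv. Qed.

Lemma hderive_cst v c : hderive v (fun=> c) = fun=> 0.
Proof. exact: hdrvE (hdrv_cst _ _). Qed.

Lemma hderiveZ v c f : coord_dir v -> smooth f ->
  hderive v (fun p => c * f p) = fun p => c * hderive v f p.
Proof.
move=> hv sf; rewrite hderiveM //; last exact: smooth_cst.
by apply/funext => p; rewrite hderive_cst mul0r add0r.
Qed.

Lemma hderiveJ v f : coord_dir v -> smooth f ->
  hderive v (fun p => (f p)^*%C) = fun p => (hderive v f p)^*%C.
Proof. by move=> hv sf; apply: hdrvE; apply: hdrvJ; exact: smooth_hdrv. Qed.

Definition derivation (D : (heis R -> R[i]^o) -> heis R -> R[i]^o) :=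
  [/\ forall f g, smooth f -> smooth g ->
        D (fun p => f p + g p) = fun p => D f p + D g p,
      forall f g, smooth f -> smooth g ->
        D (fun p => f p * g p) = fun p => D f p * g p + f p * D g p &
      forall c f, smooth f -> D (fun p => c * f p) = fun p => c * D f p].

Lemma derivation_T : derivation Tfield.
Proof.
split=> [f g sf sg|f g sf sg|c f sf]; rewrite /Tfield.
- exact: (hderiveD cdt).
- exact: (hderiveM cdt).
- exact: (hderiveZ c cdt).
Qed.

Lemma derivation_X : derivation Xfield.
Proof.
have [TD TM TZ] := derivation_T.
split=> [f g sf sg|f g sf sg|c f sf]; apply/funext => p; rewrite /Xfield.
- rewrite TD // (hderiveD cdx) //; ring.
- rewrite TM // (hderiveM cdx) //; ring.
- rewrite TZ // (hderiveZ c cdx) //; ring.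
Qed.

Lemma derivation_Y : derivation Yfield.
Proof.
have [TD TM TZ] := derivation_T.
split=> [f g sf sg|f g sf sg|c f sf]; apply/funext => p; rewrite /Yfield.
- rewrite TD // (hderiveD cdy) //; ring.
- rewrite TM // (hderiveM cdy) //; ring.
- rewrite TZ // (hderiveZ c cdy) //; ring.
Qed.

Lemma derivation_Z : derivation (@Zfield R).
Proof.
have [XD XM XZ] := derivation_X; have [YD YM YZ] := derivation_Y.
split=> [f g sf sg|f g sf sg|c f sf]; apply/funext => p; rewrite !ZfieldE.
- rewrite XD // YD //.
  by move: (Xfield f p) (Xfield g p) (Yfield f p) (Yfield g p) => *; ring.
- rewrite XM // YM //.
  by move: (Xfield f p) (Xfield g p) (Yfield f p) (Yfield g p) => *; ring.
- rewrite XZ // YZ //.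
  by move: (Xfield f p) (Yfield f p) => *; ring.
Qed.

Lemma derivation_Zbar : derivation (@Zbarfield R).
Proof.
have [XD XM XZ] := derivation_X; have [YD YM YZ] := derivation_Y.
split=> [f g sf sg|f g sf sg|c f sf]; apply/funext => p; rewrite !ZbarfieldE.
- rewrite XD // YD //.
  by move: (Xfield f p) (Xfield g p) (Yfield f p) (Yfield g p) => *; ring.
- rewrite XM // YM //.
  by move: (Xfield f p) (Xfield g p) (Yfield f p) (Yfield g p) => *; ring.
- rewrite XZ // YZ //.
  by move: (Xfield f p) (Yfield f p) => *; ring.
Qed.

Lemma TfieldJ f : smooth f -> Tfield (fun p => (f p)^*%C) = fun p => (Tfield f p)^*%C.
Proof. by move=> sf; rewrite /Tfield (hderiveJ cdt). Qed.

Lemma ZfieldJ f : smooth f -> Zfield (fun p => (f p)^*%C) = fun p => (Zbarfield f p)^*%C.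
Proof.
move=> sf; apply/funext => p; rewrite ZfieldE ZbarfieldE /Xfield /Yfield TfieldJ //.
rewrite (hderiveJ cdx) // (hderiveJ cdy) // half2.
move: (hderive _ f p) (hderive _ f p) (Tfield f p) => A B D.
by apply: complexP; rewrite !ReImE; ring.
Qed.

Lemma ZbarfieldJ f : smooth f -> Zbarfield (fun p => (f p)^*%C) = fun p => (Zfield f p)^*%C.
Proof.
move=> sf; apply/funext => p; rewrite ZfieldE ZbarfieldE /Xfield /Yfield TfieldJ //.
rewrite (hderiveJ cdx) // (hderiveJ cdy) // half2.
move: (hderive _ f p) (hderive _ f p) (Tfield f p) => A B D.
by apply: complexP; rewrite !ReImE; ring.
Qed.

(** The chain rule for the affine action; applied to T, Z and the conjugate of Z it
    shows that these fields are invariant up to a scalar. *)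
Lemma hderive_act v x f p : smooth f -> hderive v (fun p => f (sim_act x p)) p =
  (Re (sim_dir x v).1)%:C%C * hderive dirx f (sim_act x p)
  + (Im (sim_dir x v).1)%:C%C * hderive diry f (sim_act x p)
  + ((sim_dir x v).2)%:C%C * hderive dirt f (sim_act x p).
Proof.
move=> sf; have := hdrv_act (smooth_chain (sim_dir x v) sf).
by move=> /hdrvE ->.
Qed.

Lemma Tfield_act x f : smooth f -> Tfield (fun p => f (sim_act x p)) =
  fun p => (cmod (siml x) ^+ 2)%:C%C * Tfield f (sim_act x p).
Proof.
move=> sf; apply/funext => p; rewrite /Tfield hderive_act //.
case: x => [[z0 t0] l]; rewrite /sim_dir /=.
by apply: complexP; rewrite !ReImE; ring.
Qed.

Lemma Zfield_act x f : smooth f -> Zfield (fun p => f (sim_act x p)) =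
  fun p => (siml x : R[i]) * Zfield f (sim_act x p).
Proof.
move=> sf; apply/funext => p.
rewrite !ZfieldE /Xfield /Yfield Tfield_act // !hderive_act // -/(Tfield f).
case: x => [[z0 t0] l]; rewrite /sim_dir cmod_sqr.
move: (hderive _ f _) (hderive _ f _) (Tfield f _) => A B D.
cbn [fst snd hz ht siml simg sim_act Defs.dirx Defs.diry heis_mul mu].
have -> : hz (sim_act (Sim (Heis z0 t0) l) p) = z0 + cstar_val l * hz p by [].
rewrite mulr1 !mulr0 !add0r; move: (cstar_val l) (hz p) => L z.
have i2 : 'i%C * 'i%C = -1 :> R[i] by rewrite -expr2 sqr_i.
rewrite !ReImE [in RHS](complexE L) !(rmorphD, rmorphM, rmorphN, rmorphXn) /=.
rewrite !rmorph0 !rmorph1.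
ring: i2.
Qed.

Lemma Zbarfield_act x f : smooth f -> Zbarfield (fun p => f (sim_act x p)) =
  fun p => (siml x : R[i])^*%C * Zbarfield f (sim_act x p).
Proof.
move=> sf.
have J g : smooth g -> Zbarfield g = fun p => (Zfield (fun p => (g p)^*%C) p)^*%C.
  by move=> sg; rewrite ZfieldJ //; apply/funext => p; rewrite conjcK.
rewrite (J _ (smooth_act x sf)) (J _ sf).
rewrite (Zfield_act x (smoothJ sf)); apply/funext => p; exact: rmorphM.
Qed.

End Operators.

(** * Commutation relations and the maximum principle *)

Section Ladder.
Variable R : realType.
Implicit Types (p q : heis R) (v w : R[i] * R) (f g : heis R -> R[i]^o) (c : R[i]).
Local Notation Re := (@complex.Re R).
Local Notation Im := (@complex.Im R).
Local Notation dirx := (dirx R).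
Local Notation diry := (diry R).
Local Notation dirt := (dirt R).

Lemma hderive_2Im v : hderive v (fun p : heis R => (2 * Im (hz p))%:C%C : R[i]^o) =
  fun=> (2 * Im v.1)%:C%C.
Proof.
apply: hdrvE => p.
have -> : (fun s => (2 * Im (hz (hline v p s)))%:C%C) =
   fun s => (2 * Im (hz p))%:C%C + s%:C%C * (2 * Im v.1)%:C%C.
  by apply/funext => s; rewrite -!rmorphM -rmorphD hz_hline !ReImE; congr (_%:C%C); ring.
apply: cdrv_eq (cdrvD (cdrv_cst _ _) (cdrvM (cdrv_id _) (cdrv_cst _ _))) _.
by rewrite mul1r mulr0 addr0 add0r.
Qed.

Lemma hderive_2Re v : hderive v (fun p : heis R => (2 * Re (hz p))%:C%C : R[i]^o) =
  fun=> (2 * Re v.1)%:C%C.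
Proof.
apply: hdrvE => p.
have -> : (fun s => (2 * Re (hz (hline v p s)))%:C%C) =
   fun s => (2 * Re (hz p))%:C%C + s%:C%C * (2 * Re v.1)%:C%C.
  by apply/funext => s; rewrite -!rmorphM -rmorphD hz_hline !ReImE; congr (_%:C%C); ring.
apply: cdrv_eq (cdrvD (cdrv_cst _ _) (cdrvM (cdrv_id _) (cdrv_cst _ _))) _.
by rewrite mul1r mulr0 addr0 add0r.
Qed.

Lemma hderive_X v f p : coord_dir v -> smooth f -> hderive v (Xfield f) p =
  hderive v (hderive dirx f) p + (2 * Im v.1)%:C%C * hderive dirt f p
    + (2 * Im (hz p))%:C%C * hderive v (hderive dirt f) p.
Proof.
move=> hv sf; rewrite /Xfield hderiveD //.
- rewrite hderiveM //; first by rewrite hderive_2Im -addrA.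
    exact: smooth_2Im.
  exact: smooth_T.
- exact: (smooth_hderive (@cdx R)).
- apply: smoothM; [exact: smooth_2Im|exact: smooth_T].
Qed.

Lemma hderive_Y v f p : coord_dir v -> smooth f -> hderive v (Yfield f) p =
  hderive v (hderive diry f) p - (2 * Re v.1)%:C%C * hderive dirt f p
    - (2 * Re (hz p))%:C%C * hderive v (hderive dirt f) p.
Proof.
move=> hv sf; rewrite /Yfield.
have -> : (fun p => hderive diry f p - (2 * Re (hz p))%:C%C * Tfield f p) =
  (fun p => hderive diry f p + (-1) * ((2 * Re (hz p))%:C%C * Tfield f p)).
  by apply/funext => q; rewrite mulN1r.
have sRT : smooth (fun p => (2 * Re (hz p))%:C%C * Tfield f p).
  apply: smoothM; [exact: smooth_2Re|exact: smooth_T].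
rewrite hderiveD //.
- rewrite hderiveZ // hderiveM //; first by rewrite hderive_2Re mulN1r opprD addrA.
    exact: smooth_2Re.
  exact: smooth_T.
- exact: (smooth_hderive (@cdy R)).
- exact: smoothZ.
Qed.

(** The second derivatives cancel by symmetry, and only the derivatives of the
    coefficients remain. *)
Lemma commutator_XY f p : smooth f ->
  Xfield (Yfield f) p - Yfield (Xfield f) p = - 4%:C%C * Tfield f p.
Proof.
move=> sf.
have -> : Xfield (Yfield f) p = hderive dirx (Yfield f) p +
  (2 * Im (hz p))%:C%C * hderive dirt (Yfield f) p by [].
have -> : Yfield (Xfield f) p = hderive diry (Xfield f) p -
  (2 * Re (hz p))%:C%C * hderive dirt (Xfield f) p by [].
rewrite /Tfield.
rewrite !(hderive_X _ (@cdy R)) // !(hderive_X _ (@cdt R)) //.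
rewrite !(hderive_Y _ (@cdx R)) // !(hderive_Y _ (@cdt R)) //.
rewrite (hderiveC (@cdx R) (@cdy R)) // (hderiveC (@cdx R) (@cdt R)) //.
rewrite (hderiveC (@cdy R) (@cdt R)) //.
move: (hderive diry (hderive dirx f) p) (hderive dirt (hderive dirx f) p)
 (hderive dirt (hderive diry f) p) (hderive dirt (hderive dirt f) p) (hderive dirt f p).
by move=> A B D E F; rewrite /Defs.dirx /Defs.diry /Defs.dirt; cbn [fst snd];
  apply: complexP; rewrite !ReImE; ring.
Qed.

Lemma ZZbarE f p : smooth f -> Zfield (Zbarfield f) p =
  4^-1 * (Xfield (Xfield f) p + Yfield (Yfield f) p
    + 'i%C * (Xfield (Yfield f) p - Yfield (Xfield f) p)).
Proof.
move=> sf; have [XD XM XZ] := derivation_X R; have [YD YM YZ] := derivation_Y R.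
have sX := smooth_X sf; have sY := smooth_Y sf.
have -> : Zbarfield f = fun p => 2^-1 * (Xfield f p + 'i%C * Yfield f p).
  by apply/funext => q; rewrite ZbarfieldE.
have siY : smooth (fun p => 'i%C * Yfield f p) by exact: smoothZ.
have sS : smooth (fun p => Xfield f p + 'i%C * Yfield f p) by exact: smoothD.
rewrite ZfieldE XZ // YZ // XD // YD // XZ // YZ //.
move: (Xfield _ p) (Xfield _ p) (Yfield _ p) (Yfield _ p) => B A E D.
have -> : (4^-1 : R[i]) = 2^-1 * 2^-1 by rewrite -invfM -natrM.
have := sqr_i R; rewrite expr2.
move: 'i%C => i i2.
have -> : 2^-1 * (2^-1 * (A + i * B) - i * (2^-1 * (D + i * E))) =
  2^-1 * 2^-1 * (A + i * B - i * D - (i * i) * E) by ring.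
rewrite i2; ring.
Qed.

Lemma ZbarZE f p : smooth f -> Zbarfield (Zfield f) p =
  4^-1 * (Xfield (Xfield f) p + Yfield (Yfield f) p
    - 'i%C * (Xfield (Yfield f) p - Yfield (Xfield f) p)).
Proof.
move=> sf; have [XD XM XZ] := derivation_X R; have [YD YM YZ] := derivation_Y R.
have sX := smooth_X sf; have sY := smooth_Y sf.
have -> : Zfield f = fun p => 2^-1 * (Xfield f p + (- 'i%C) * Yfield f p).
  by apply/funext => q; rewrite ZfieldE mulNr.
have siY : smooth (fun p => - 'i%C * Yfield f p) by exact: smoothZ.
have sS : smooth (fun p => Xfield f p + (- 'i%C) * Yfield f p) by exact: smoothD.
rewrite ZbarfieldE XZ // YZ // XD // YD // XZ // YZ //.
move: (Xfield _ p) (Xfield _ p) (Yfield _ p) (Yfield _ p) => B A E D.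
have -> : (4^-1 : R[i]) = 2^-1 * 2^-1 by rewrite -invfM -natrM.
have := sqr_i R; rewrite expr2.
move: 'i%C => i i2.
have -> : 2^-1 * (2^-1 * (A + - i * B) + i * (2^-1 * (D + - i * E))) =
  2^-1 * 2^-1 * (A - i * B + i * D - (i * i) * E) by ring.
rewrite i2; ring.
Qed.

(** On functions of a fixed central frequency the right side is a scalar multiple
    of f; this produces the ladder of eigenvalues. *)
Lemma commutator_ZZbar f p : smooth f ->
  Zfield (Zbarfield f) p - Zbarfield (Zfield f) p = - 2 * 'i%C * Tfield f p.
Proof.
move=> sf; rewrite ZZbarE // ZbarZE // commutator_XY //.
move: (_ + _) (Tfield f p) => A B.
have -> : 4%:C%C = 4 :> R[i] by rewrite rmorphMn.
by field.
Qed.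

Lemma commutator_ZT f : smooth f -> Zfield (Tfield f) = Tfield (Zfield f).
Proof.
move=> sf; apply/funext => p; have [TD TM TZ] := derivation_T R.
have -> : Zfield f = fun p => 2^-1 * (Xfield f p + (- 'i%C) * Yfield f p).
  by apply/funext => q; rewrite ZfieldE mulNr.
have sX := smooth_X sf; have sY := smooth_Y sf.
have siY : smooth (fun p => - 'i%C * Yfield f p) by exact: smoothZ.
rewrite TZ; last exact: smoothD.
rewrite TD // TZ // ZfieldE /Tfield (hderive_X _ (@cdt R)) // (hderive_Y _ (@cdt R)) //.
rewrite /Xfield /Yfield /Tfield (hderiveC (@cdx R) (@cdt R)) // (hderiveC (@cdy R) (@cdt R)) //.
rewrite /Defs.dirt; cbn [fst snd]; rewrite Re0 Im0 mulr0.
move: (hderive _ _ _) (hderive _ _ _) (hderive _ _ _) (hderive _ _ _) => *; ring.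
Qed.

Lemma commutator_ZbarT f : smooth f -> Zbarfield (Tfield f) = Tfield (Zbarfield f).
Proof.
move=> sf; apply/funext => p; have [TD TM TZ] := derivation_T R.
have -> : Zbarfield f = fun p => 2^-1 * (Xfield f p + 'i%C * Yfield f p).
  by apply/funext => q; rewrite ZbarfieldE.
have sX := smooth_X sf; have sY := smooth_Y sf.
have siY : smooth (fun p => 'i%C * Yfield f p) by exact: smoothZ.
rewrite TZ; last exact: smoothD.
rewrite TD // TZ // ZbarfieldE /Tfield (hderive_X _ (@cdt R)) // (hderive_Y _ (@cdt R)) //.
rewrite /Xfield /Yfield /Tfield (hderiveC (@cdx R) (@cdt R)) // (hderiveC (@cdy R) (@cdt R)) //.
rewrite /Defs.dirt; cbn [fst snd]; rewrite Re0 Im0 mulr0.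
move: (hderive _ _ _) (hderive _ _ _) (hderive _ _ _) (hderive _ _ _) => *; ring.
Qed.

(** Otherwise the even function u s + u (- s), whose derivative is close to
    2 d s, would increase to the right of 0. *)
Lemma second_derivative_max (u u' : R -> R) (d : R) :
  (forall s : R, is_derive s 1 u (u' s)) -> is_derive (0 : R) 1 u' d ->
  (forall s, u s <= u 0) -> d <= 0.
Proof.
move=> hu hd um; rewrite leNgt; apply/negP => d0.
have [c E] := hd.
have : h^-1 *: ((u' \o shift (0 : R)) (h *: (1 : R)) - u' 0) @[h --> 0^'] --> d.
  by rewrite -E.
have d2 : 0 < d / 2 by rewrite divr_gt0.
move=> /cvgrPdist_lt /(_ _ d2) [e /= e0 He].
have key t : t != 0 -> `|t| < e -> d / 2 < (u' t - u' 0) / t.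
  move=> t0 te; have := He t; rewrite /ball /= sub0r normrN => /(_ te t0).
  rewrite [t *: 1]mulr1 addr0 /GRing.scale /= mulrC => H.
  have := ler_norm (d - (u' t - u' 0) / t) => H1.
  have := le_lt_trans H1 H; lra.
pose s := e / 2.
have s0 : 0 < s by rewrite divr_gt0.
have se : s < e by rewrite /s; lra.
have hw (t : R) : is_derive t 1 (fun t => u t + u (- t)) (u' t - u' (- t)).
  have h2 : is_derive t 1 (fun t => u (- t)) (- u' (- t)).
    have hN : is_derive t 1 (fun t : R => - t) (-1) by apply: is_deriveNid.
    by apply: (@is_derive_compE R u (fun t => - t) t _ _ _ (hu (- t)) hN); rewrite mulrN1.
  exact: (is_deriveD (hu t) h2).
have [] := @MVT R (fun t => u t + u (- t)) (fun t => u' t - u' (- t)) 0 s s0 (fun t _ => hw t).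
  apply: continuous_subspaceT => x; apply: differentiable_continuous.
  by apply/derivable1_diffP; case: (hw x).
move=> t; rewrite in_itv /= => /andP[t0 ts] H.
have k1 := key t; rewrite gt_eqF // gtr0_norm // in k1.
have := k1 isT (lt_trans ts se); rewrite ltr_pdivlMr // => {}k1.
have k2 := key (- t); rewrite oppr_eq0 gt_eqF // normrN gtr0_norm // in k2.
have := k2 isT (lt_trans ts se); rewrite invrN mulrN -mulNr ltr_pdivlMr // => {}k2.
have := um s; have := um (- s); move: H; rewrite oppr0 addr0 => H h1 h2.
have : 0 < (u' t - u' (- t)) * s.
  rewrite mulr_gt0 //; have : 0 < d / 2 * t by rewrite mulr_gt0.
  lra.
by rewrite -H; lra.
Qed.

(** The squared modulus is maximal along the line; its second derivative there
    is twice the real part of conj(f) D(D f) plus twice the squared modulus of D f. *)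
Lemma max_modulus_field (D : (heis R -> R[i]^o) -> heis R -> R[i]^o) v p0 f :
  (forall g, smooth g -> forall s, cdrv (fun s => g (hline v p0 s)) s (D g (hline v p0 s))) ->
  smooth f -> smooth (D f) -> (forall p, cmod (f p) <= cmod (f p0)) ->
  Re ((f p0)^*%C * D (D f) p0) <= 0.
Proof.
move=> HD sf sDf fm.
pose phi s := f (hline v p0 s); pose phi' s := D f (hline v p0 s).
pose u s := cmod (phi s) ^+ 2.
have uE s : u s = Re ((phi s)^*%C * phi s) by rewrite /u mulrC -cmod_sqrE.
have h1 s : cdrv phi s (phi' s) by exact: HD.
have h2 s : cdrv phi' s (D (D f) (hline v p0 s)) by exact: (HD _ sDf).
have hu (s : R) : is_derive s 1 u (2 * Re ((phi s)^*%C * phi' s)).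
  have -> : u = fun s => Re ((phi s)^*%C * phi s) by apply/funext => t; rewrite uE.
  have [h _] := cdrvM (cdrvJ (h1 s)) (h1 s).
  apply: (@is_derive_eq _ _ _ _ _ _ _ _ h); rewrite !ReImE; ring.
have [hd _] := cdrvM (cdrvJ (h1 0)) (h2 0).
have hd2 : is_derive (0 : R) 1 (fun s => 2 * Re ((phi s)^*%C * phi' s))
   (2 * (Re ((phi' 0)^*%C * phi' 0) + Re ((phi 0)^*%C * D (D f) (hline v p0 0)))).
  apply: (@is_derive_eq _ _ _ _ _ _ _ _ (is_deriveZ 2 hd)).
  by rewrite /GRing.scale /= ReD.
have := second_derivative_max hu hd2.
have um s : u s <= u 0.
  by rewrite /u /phi hline0 lerXn2r // nnegrE cmod_ge0.
move=> /(_ um); rewrite pmulr_rle0 // /phi hline0.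
rewrite {1}mulrC -cmod_sqrE ReC.
have : 0 <= cmod (phi' 0) ^+ 2 by rewrite sqr_ge0.
lra.
Qed.

(** At the maximum conj(f) X(X f) and conj(f) Y(Y f) have nonpositive real part,
    whereas their sum is mu times the squared modulus of f. *)
Lemma max_principle f (mu : R) p0 : smooth f -> 0 < mu ->
  (forall p, cmod (f p) <= cmod (f p0)) ->
  (forall p, Xfield (Xfield f) p + Yfield (Yfield f) p = mu%:C%C * f p) ->
  f = fun=> 0.
Proof.
move=> sf mu0 fm E.
have hX g : smooth g -> forall s, cdrv (fun s => g (hline (1, 2 * Im (hz p0)) p0 s)) s
    (Xfield g (hline (1, 2 * Im (hz p0)) p0 s)).
  move=> sg s; apply: cdrv_eq (hdrv_at (smooth_chain _ sg) _ _) _.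
  rewrite /Xfield /Tfield hz_hline; cbn [fst snd]; rewrite !ReImE.
  move: (hderive _ _ _) (hderive _ _ _) (hderive _ _ _) => A B D.
  have -> : s * 0 + 0 * 1 = 0 by ring.
  rewrite addr0 rmorph1 mul1r rmorph0 mul0r addr0 //.
have hY g : smooth g -> forall s, cdrv (fun s => g (hline ('i%C, - (2 * Re (hz p0))) p0 s)) s
    (Yfield g (hline ('i%C, - (2 * Re (hz p0))) p0 s)).
  move=> sg s; apply: cdrv_eq (hdrv_at (smooth_chain _ sg) _ _) _.
  rewrite /Yfield /Tfield hz_hline; cbn [fst snd]; rewrite !ReImE.
  move: (hderive _ _ _) (hderive _ _ _) (hderive _ _ _) => A B D.
  have -> : s * 0 - 0 * 1 = 0 by ring.
  by rewrite addr0 rmorph1 mul1r rmorph0 mul0r add0r rmorphN mulNr.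
have m1 := max_modulus_field hX sf (smooth_X sf) fm.
have m2 := max_modulus_field hY sf (smooth_Y sf) fm.
have : Re ((f p0)^*%C * (mu%:C%C * f p0)) <= 0.
  by rewrite -E mulrDr ReD; lra.
rewrite mulrCA [_ * f p0]mulrC -cmod_sqrE -rmorphM ReC pmulr_rle0 //.
move=> h; have f0 : cmod (f p0) = 0.
  by apply/eqP; rewrite -sqrf_eq0; apply/eqP/le_anti; rewrite h sqr_ge0.
apply/funext => p; apply/eqP; rewrite -cmod_eq0.
by apply/eqP/le_anti; rewrite cmod_ge0 andbT -f0.
Qed.

End Ladder.

(** * Integrals and Fourier coefficients on the unit interval *)

Section Integral.
Variable R : realType.
Local Notation Re := (@complex.Re R).
Local Notation Im := (@complex.Im R).
Local Notation mu := (@lebesgue_measure R).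
Implicit Types (f g : R -> R) (F G : R -> R[i]^o) (a c : R[i]).

Definition J01 : set R := `[0, 1]%classic.
Definition intR f : R := \int[mu]_(x in J01) f x.

Lemma within_integrable f : {within J01, continuous f} -> mu.-integrable J01 (EFin \o f).
Proof.
by move=> cf; apply: continuous_compact_integrable => //; exact: segment_compact.
Qed.

Lemma measurable_J01 : measurable J01. Proof. exact: measurable_itv. Qed.

Lemma intRD f g : {within J01, continuous f} -> {within J01, continuous g} ->
  intR (fun x => f x + g x) = intR f + intR g.
Proof.
by move=> cf cg; apply: RintegralD; [exact: measurable_J01| |]; exact: within_integrable.
Qed.

Lemma intRZ (k : R) f : {within J01, continuous f} -> intR (fun x => k * f x) = k * intR f.
Proof.
by move=> cf; apply: RintegralZl; [exact: measurable_J01|exact: within_integrable].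
Qed.

Lemma intR_cst (k : R) : intR (fun=> k) = k.
Proof.
rewrite /intR Rintegral_cst; last exact: measurable_J01.
have H : mu `[0, 1]%classic = 1%:E.
  by rewrite (@lebesgue_measure_itv R `[0, 1]) /= lte_fin ltr01 oppr0 adde0.
by rewrite /J01 [X in fine X]H mulr1.
Qed.

Lemma eq_intR f g : (forall x, 0 <= x <= 1 -> f x = g x) -> intR f = intR g.
Proof. by move=> H; apply: eq_Rintegral => x /set_mem; rewrite /J01 /= in_itv /= => /H. Qed.

Lemma intR_ge0 f : (forall x, 0 <= f x) -> 0 <= intR f.
Proof. by move=> H; apply: Rintegral_ge0. Qed.

Lemma intR_FTC f (f' : R -> R) : (forall x : R, is_derive x 1 f (f' x)) ->
  continuous f' -> intR f' = f 1 - f 0.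
Proof.
move=> df cf'.
have cf x : {for x, continuous f}.
  apply: differentiable_continuous; apply/derivable1_diffP; case: (df x) => h _; exact: h.
rewrite /intR /Rintegral (@continuous_FTC2 _ f' f 0 1) ?ltr01 //.
- by apply: continuous_subspaceT; exact: cf'.
- split => [x _||]; first by case: (df x).
  + apply: cvg_at_right_filter; exact: cf.
  + apply: cvg_at_left_filter; exact: cf.
- by move=> x _; rewrite derive1E; case: (df x).
Qed.

Definition intC F : R[i] := Complex (intR (fun x => Re (F x))) (intR (fun x => Im (F x))).
Definition contI F := {within J01, continuous F}.

Lemma contIP F : contI F <->
  {within J01, continuous (fun x => Re (F x))} /\ {within J01, continuous (fun x => Im (F x))}.
Proof. exact: continuous_complexP. Qed.

Lemma contI_T F : continuous F -> contI F.
Proof. by move=> cF; apply: continuous_subspaceT. Qed.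

Lemma contID F G : contI F -> contI G -> contI (fun x => F x + G x).
Proof. exact: continuous_complexD. Qed.

Lemma contIM F G : contI F -> contI G -> contI (fun x => F x * G x).
Proof. exact: continuous_complexM. Qed.

Lemma contIJ F : contI F -> contI (fun x => (F x)^*%C).
Proof. exact: continuous_complexJ. Qed.

Lemma contI_cst c : contI (fun=> c).
Proof. by apply: contI_T; exact: cst_continuous. Qed.
Arguments contI_cst : clear implicits.

Lemma intCD F G : contI F -> contI G -> intC (fun x => F x + G x) = intC F + intC G.
Proof.
move=> /contIP[c1 c2] /contIP[c3 c4]; apply: complexP => /=.
  by rewrite -intRD //; apply: eq_intR => x _; rewrite ReImE.
by rewrite -intRD //; apply: eq_intR => x _; rewrite ReImE.
Qed.

Lemma eq_intC F G : (forall x, 0 <= x <= 1 -> F x = G x) -> intC F = intC G.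
Proof. by move=> H; apply: complexP => /=; apply: eq_intR => x /H ->. Qed.

Lemma intCZ c F : contI F -> intC (fun x => c * F x) = c * intC F.
Proof.
move=> /contIP[c1 c2].
have cZ (k : R) f : {within J01, continuous f} -> {within J01, continuous (fun x => k * f x)}.
  move=> cf; apply: (@continuous_RM R (subspace J01) (fun=> k) f) => //.
  exact: cst_continuous.
apply: complexP; rewrite ReImE /=.
  rewrite -intRZ // -mulNr -intRZ // -intRD; [|exact: cZ|exact: cZ].
  by apply: eq_intR => x _; rewrite ReImE mulNr.
rewrite -!intRZ // -intRD; [|exact: cZ|exact: cZ].
by apply: eq_intR => x _; rewrite ReImE.
Qed.

Lemma intC_cst c : intC (fun=> c) = c.
Proof. by apply: complexP; rewrite /= intR_cst. Qed.

Lemma intC_FTC F F' : (forall x, cdrv F x (F' x)) -> continuous F' ->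
  intC F' = F 1 - F 0.
Proof.
move=> dF /continuous_complexP[c1 c2]; apply: complexP; rewrite !ReImE /=.
  by apply: (@intR_FTC (fun x => Re (F x)) (fun x => Re (F' x))) => // x; case: (dF x).
by apply: (@intR_FTC (fun x => Im (F x)) (fun x => Im (F' x))) => // x; case: (dF x).
Qed.

Lemma intCJ F : contI F -> intC (fun x => (F x)^*%C) = (intC F)^*%C.
Proof.
move=> /contIP[c1 c2]; rewrite /intC /conjc; congr Complex.
  by apply: eq_intR => x _; exact: ReJ.
by rewrite -mulN1r -intRZ //; apply: eq_intR => x _; rewrite mulN1r; exact: ImJ.
Qed.

Lemma intC_sum I (r : seq I) (P : pred I) (F : I -> R -> R[i]^o) :
  (forall i, P i -> contI (F i)) ->
  contI (fun x => \sum_(i <- r | P i) F i x) /\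
  intC (fun x => \sum_(i <- r | P i) F i x) = \sum_(i <- r | P i) intC (F i).
Proof.
move=> H; elim: r => [|i r [IH1 IH2]].
  have -> : (fun x => \sum_(i <- [::] | P i) F i x) = fun=> 0.
    by apply/funext => x; rewrite big_nil.
  by rewrite big_nil intC_cst; split => //; exact: contI_cst.
rewrite big_cons; case Pi : (P i); last first.
  have -> // : (fun x => \sum_(j <- i :: r | P j) F j x) = fun x => \sum_(j <- r | P j) F j x.
  by apply/funext => x; rewrite big_cons Pi.
pose S : R -> R[i]^o := fun x => \sum_(j <- r | P j) F j x.
have cS : contI S by exact: IH1.
have -> : (fun x => \sum_(j <- i :: r | P j) F j x) = fun x => F i x + S x.
  by apply/funext => x; rewrite big_cons Pi.
by rewrite -IH2; split; [exact: (contID (H i Pi) cS)|exact: (intCD (H i Pi) cS)].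
Qed.

Definition tpi : R[i] := Complex 0 (2 * pi).

Lemma tpi_neq0 : tpi != 0.
Proof. by rewrite eq_complex /= negb_and orbC mulf_neq0 // gt_eqF // pi_gt0. Qed.

Lemma cexp_tpi : cexp tpi = 1.
Proof.
rewrite /cexp /expi /= expR0 mul1r mulr_natl cos2pi sin2pi //.
Qed.

Lemma cexp_tpi_int (m : int) : cexp (m%:~R * tpi) = 1.
Proof.
elim/int_ind: m => [|m IH|m IH]; first by rewrite mul0r cexp0.
  by rewrite intS intrD mulrDl cexpD IH mul1r cexp_tpi mul1r.
by rewrite intS opprD intrD mulrDl cexpD IH mulN1r cexpN cexp_tpi invr1 mul1r.
Qed.

Definition ee (m : int) (x : R) : R[i] := cexp (x%:C%C * (m%:~R * tpi)).

Lemma eeD m n x : ee (m + n) x = ee m x * ee n x.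
Proof. by rewrite /ee -cexpD intrD; congr cexp; ring. Qed.

Lemma ee0 x : ee 0 x = 1.
Proof. by rewrite /ee mul0r mulr0 cexp0. Qed.

Lemma ee_neq0 m x : ee m x != 0. Proof. exact: cexp_neq0. Qed.

Lemma ee_addx m x y : ee m (x + y) = ee m x * ee m y.
Proof. by rewrite /ee rmorphD mulrDl cexpD. Qed.

Lemma ee1 m : ee m 1 = 1.
Proof. by rewrite /ee mul1r cexp_tpi_int. Qed.

Lemma ee00 m : ee m 0 = 1.
Proof. by rewrite /ee mul0r cexp0. Qed.

Lemma eeJ m x : (ee m x)^*%C = ee (- m) x.
Proof.
have E n : (n%:~R : R[i]) = (n%:~R : R)%:C%C by rewrite rmorph_int.
rewrite /ee cexpJ !E intrN; congr cexp.
by apply: complexP; rewrite /tpi !ReImE /=; ring.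
Qed.

Lemma cdrv_ee m x : cdrv (ee m) x (m%:~R * tpi * ee m x).
Proof.
apply: cdrv_eq (cdrv_cexp (cdrvM (cdrv_id x) (cdrv_cst (m%:~R * tpi) x))) _.
by rewrite mul1r mulr0 addr0.
Qed.

Lemma continuous_ee m : continuous (ee m : R -> R[i]^o).
Proof. by move=> x; apply: cdrv_cont; exact: cdrv_ee. Qed.

Lemma intC_ee m : intC (ee m) = (m == 0)%:R.
Proof.
case: eqVneq => [->|m0].
  by rewrite (eq_intC (G := fun=> 1)) ?intC_cst // => x _; rewrite ee0.
have a0 : (m%:~R * tpi : R[i]) != 0 by rewrite mulf_neq0 ?tpi_neq0 // intr_eq0.
have := @intC_FTC (fun x => (m%:~R * tpi)^-1 * ee m x) (ee m).
rewrite ee1 ee00 subrr; apply.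
  by move=> x; apply: cdrv_eq (cdrvZ _ (cdrv_ee m x)) _; rewrite mulrA mulVf // mul1r.
exact: continuous_ee.
Qed.

Definition coef (F : R -> R[i]^o) m : R[i] := intC (fun x => F x * ee (- m) x).

Lemma contI_ee m : contI (ee m).
Proof. by apply: contI_T; exact: continuous_ee. Qed.
Arguments contI_ee : clear implicits.

Lemma contI_eeM F m : contI F -> contI (fun x => F x * ee m x).
Proof. by move=> cF; exact: (contIM cF (contI_ee m)). Qed.

Lemma coefD F G m : contI F -> contI G -> coef (fun x => F x + G x) m = coef F m + coef G m.
Proof.
move=> cF cG; rewrite /coef -intCD; [|exact: contI_eeM|exact: contI_eeM].
by apply: eq_intC => x _; rewrite mulrDl.
Qed.

Lemma coefZ c F m : contI F -> coef (fun x => c * F x) m = c * coef F m.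
Proof.
move=> cF; rewrite /coef -intCZ; last exact: contI_eeM.
by apply: eq_intC => x _; exact: (esym (@mulrA R[i] c (F x) _)).
Qed.

Lemma coef_ee m n : coef (ee m) n = (m == n)%:R.
Proof.
rewrite /coef -subr_eq0 -intC_ee; apply: eq_intC => x _.
by rewrite -eeD.
Qed.

Lemma coef_eeM F k m : coef (fun x => F x * ee k x) m = coef F (m - k).
Proof. by apply: eq_intC => x _; rewrite -mulrA -eeD opprB. Qed.

(** Induction on the list: subtracting from F its projection to one
    exponential lowers the mean square by exactly the square of that coefficient. *)
Lemma bessel (s : seq int) F : uniq s -> contI F ->
  \sum_(m <- s) cmod (coef F m) ^+ 2 <= Re (intC (fun x => F x * (F x)^*%C)).
Proof.
elim: s F => [|n s IH] F us cF.
  rewrite big_nil; apply: intR_ge0 => x; rewrite -cmod_sqrE ReC; exact: sqr_ge0.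
move: us => /= /andP[ns us].
set a := coef F n.
pose G x := F x + (- a) * ee n x.
have cE : contI (fun x => - a * ee n x) by apply: contIM; [exact: contI_cst|exact: contI_ee].
have cG : contI G by exact: contID.
have := IH G us cG.
have -> : \sum_(m <- s) cmod (coef G m) ^+ 2 = \sum_(m <- s) cmod (coef F m) ^+ 2.
  apply: eq_big_seq => m ms; rewrite /G coefD // coefZ; last exact: contI_ee.
  rewrite coef_ee; case: eqP => [nm|_]; last by rewrite mulr0 addr0.
  by move: ns; rewrite nm ms.
have cFJ := contIJ cF; have ce := contI_ee n; have ceN := contI_ee (- n).
have -> : intC (fun x => G x * (G x)^*%C) =
    intC (fun x => F x * (F x)^*%C) - (cmod a ^+ 2)%:C%C.
  have -> : intC (fun x => G x * (G x)^*%C) = intC (fun x => (F x * (F x)^*%C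
     + (- a^*%C) * (F x * ee (- n) x)) + ((- a) * (F x * ee (- n) x)^*%C + a * a^*%C)).
    have K (u e e' b : R[i]) : e' = e^*%C -> e * e^*%C = 1 ->
        (u + - b * e) * (u + - b * e)^*%C =
        (u * u^*%C + - b^*%C * (u * e')) + (- b * (u * e')^*%C + b * b^*%C).
      move=> -> H.
      have -> : (u + - b * e)^*%C = u^*%C - b^*%C * e^*%C.
        by apply: complexP; rewrite !ReImE; ring.
      have -> : (u * e^*%C)^*%C = u^*%C * e by apply: complexP; rewrite !ReImE; ring.
      by ring: H.
    apply: eq_intC => x _; apply: (K (F x) (ee n x)); first by rewrite eeJ.
    by rewrite eeJ -eeD subrr ee0.
  have c1 : contI (fun x => F x * ee (- n) x) by exact: contIM.
  have c2 : contI (fun x => (- a^*%C) * (F x * ee (- n) x)).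
    by apply: contIM c1; exact: contI_cst.
  have c3 : contI (fun x => (F x * ee (- n) x)^*%C) by exact: contIJ.
  have c4 : contI (fun x => (- a) * (F x * ee (- n) x)^*%C).
    by apply: contIM c3; exact: contI_cst.
  have c5 : contI (fun x => F x * (F x)^*%C) by exact: contIM.
  have J : intC (fun x => (F x * ee (- n) x)^*%C) = (intC (fun x => F x * ee (- n) x))^*%C.
    exact: intCJ.
  have c6 : contI (fun=> a * a^*%C) := contI_cst _.
  have -> : intC (fun x => (F x * (F x)^*%C + (- a^*%C) * (F x * ee (- n) x)) +
     ((- a) * (F x * ee (- n) x)^*%C + a * a^*%C)) =
     (intC (fun x => F x * (F x)^*%C) + intC (fun x => (- a^*%C) * (F x * ee (- n) x))) +
     (intC (fun x => (- a) * (F x * ee (- n) x)^*%C) + intC (fun=> a * a^*%C)).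
    apply: (etrans (intCD (contID c5 c2) (contID c4 c6))).
    by congr (_ + _); [exact: (intCD c5 c2)|exact: (intCD c4 c6)].
  have -> := intCZ (- a^*%C) c1; have -> := intCZ (- a) c3.
  rewrite intC_cst J cmod_sqrE.
  move: (intC (fun x => F x * (F x)^*%C)) => b.
  have -> : intC (fun x => F x * ee (- n) x) = a by [].
  by move: (a : R[i]) (a^*%C : R[i]) => u v; ring.
by rewrite big_cons ReD ReN ReC => H; rewrite addrC -lerBrDr.
Qed.

End Integral.
Arguments contI_ee {R}.
Arguments contI_cst {R}.

(** * Uniqueness of Fourier coefficients *)

Section Fourier.
Variable R : realType.
Local Notation Re := (@complex.Re R).
Local Notation Im := (@complex.Im R).
Local Notation mu := (@lebesgue_measure R).
Implicit Types (F G : R -> R[i]^o) (a c : R[i]) (x : R).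

(** The difference quotient at a point, completed by the derivative. *)
Definition slope F (x0 : R) (l : R[i]) (x : R) : R[i]^o :=
  if x == x0 then l else (x - x0)^-1%:C%C * (F x - F x0).

Lemma slopeE F x0 l x : F x - F x0 = (x - x0)%:C%C * slope F x0 l x.
Proof.
rewrite /slope; case: eqVneq => [->|xx0]; first by rewrite !subrr mul0r.
by rewrite mulrA -rmorphM mulfV ?subr_eq0 // mul1r.
Qed.

(** Continuity at x0 is differentiability of F there. *)
Lemma slope_continuous F x0 l : continuous F -> cdrv F x0 l ->
  continuous (slope F x0 l : R -> R[i]^o).
Proof.
move=> cF [[d1 e1] [d2 e2]] x.
have [->|xx0] := eqVneq x x0.
  apply/continuous_withinNx; rewrite {2}/slope eqxx.
  have H (u : R -> R) (d : R) : derivable u x0 1 -> 'D_1 u x0 = d ->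
    (x - x0)^-1 * (u x - u x0) @[x --> x0^'] --> d.
    move=> du <-; move: du; rewrite /derivable /derive => /cvgrPdist_lt H.
    apply/cvgrPdist_lt => e e0; have [/= dd dd0 Hd] := H _ e0.
    exists dd => //= y yd y0; have := Hd (y - x0).
    rewrite /ball_ /= sub0r normrN distrC => /(_ yd); rewrite subr_eq0 => /(_ y0).
    by rewrite [(y - x0) *: 1]mulr1 subrK.
  have : (((x - x0)^-1%:C%C * (F x - F x0)) : R[i]^o) @[x --> x0^'] --> (l : R[i]^o).
    apply/cvg_complexP; split.
      rewrite -e1; have := H _ _ d1 erefl; apply: cvg_trans; apply: near_eq_cvg.
      by near=> y; rewrite !ReImE; ring.
    rewrite -e2; have := H _ _ d2 erefl; apply: cvg_trans; apply: near_eq_cvg.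
    by near=> y; rewrite !ReImE; ring.
  apply: cvg_trans; apply: near_eq_cvg; near=> y; rewrite /slope ifN_eq //.
  by near: y; exact: nbhs_dnbhs_neq.
have : (((y - x0)^-1%:C%C * (F y - F x0)) : R[i]^o) @[y --> x] --> (((x - x0)^-1%:C%C * (F x - F x0)) : R[i]^o).
  apply: cvgM.
    apply/cvg_complexP; split => /=; last exact: cvg_cst.
    apply: cvgV; first by rewrite subr_eq0.
    by apply: cvgB; [exact: cvg_id|exact: cvg_cst].
  by apply: cvgB; [exact: cF|exact: cvg_cst].
rewrite /continuous_at {2}/slope ifN_eq //.
apply: cvg_trans; apply: near_eq_cvg; near=> y; rewrite /slope ifN_eq //.
near: y; exists `|x - x0|; first by rewrite /= normr_gt0 subr_eq0.
by move=> y /=; apply: contraTneq => ->; rewrite ltxx.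
Unshelve. all: end_near. Qed.

(** On the circle only the two end points of the interval are identified, so an
    interior point is determined by its exponential. *)
Lemma ee_inj1 x0 x : 0 < x0 < 1 -> 0 <= x <= 1 -> ee 1 x = ee 1 x0 -> x = x0.
Proof.
move=> /andP[x00 x01] /andP[xx0 xx1] E.
have : ee 1 (x - x0) = 1.
  by rewrite ee_addx E -ee_addx addrN ee00.
have -> : ee 1 (x - x0) = expi (2 * (pi * (x - x0))).
  rewrite /ee /cexp /tpi; have -> : Re ((x - x0)%:C%C * (1%:~R * Complex 0 (2 * pi))) = 0.
    by rewrite mul1r !ReImE /=; ring.
  have -> : Im ((x - x0)%:C%C * (1%:~R * Complex 0 (2 * pi))) = 2 * (pi * (x - x0)).
    by rewrite mul1r !ReImE /=; ring.
  by rewrite expR0 mul1r.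
move=> /(congr1 Re); rewrite [Re _]/= Re1 mulr_natl cos_mulr2n cos2sin2 => H.
have s0 : sin (pi * (x - x0)) = 0.
  by apply/eqP; rewrite -sqrf_eq0; apply/eqP; lra.
have pi0 : 0 < pi :> R := pi_gt0 R.
have [d0|d0|/eqP] := ltgtP 0 (x - x0); last by rewrite eq_sym subr_eq0 => /eqP.
  have : 0 < sin (pi * (x - x0)).
    by apply: sin_gt0_pi; rewrite mulr_gt0 //= gtr_pMr //; lra.
  by rewrite s0 ltxx.
have : 0 < sin (- (pi * (x - x0))).
  by apply: sin_gt0_pi; rewrite -mulrN mulr_gt0 //= ?gtr_pMr ?oppr_gt0 //; lra.
by rewrite sinN s0 oppr0 ltxx.
Qed.

(** By Bessel's inequality only finitely many coefficients can have a given
    positive modulus. *)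
Lemma coef_cst_modulus (A : R) (s : nat -> int) (G : R -> R[i]^o) :
  injective s -> contI G -> (forall n, cmod (coef G (s n)) = A) -> A = 0.
Proof.
move=> si cG sA.
have A0 : 0 <= A by rewrite -(sA 0%N) cmod_ge0.
apply/eqP; rewrite eq_le A0 andbT leNgt; apply/negP => Agt.
set C := Re (intC (fun x => G x * (G x)^*%C)).
have key n : n%:R * A ^+ 2 <= C.
  have := @bessel R (map s (iota 0 n)) G _ cG.
  rewrite map_inj_uniq ?iota_uniq // => /(_ isT).
  rewrite big_map (eq_bigr (fun=> A ^+ 2)) => [|i _]; last by rewrite sA.
  by rewrite big_const_seq count_predT size_iota iter_addr_0 mulr_natl => H; exact: H.
have A2 : 0 < A ^+ 2 by rewrite exprn_gt0.
have [n Hn] : exists n, C / A ^+ 2 < n%:R.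
  exists (Num.bound `|C / A ^+ 2|); apply: le_lt_trans (archi_boundP (normr_ge0 _)).
  exact: ler_norm.
by have := key n; rewrite leNgt -ltr_pdivrMr // Hn.
Qed.

(** The quotient G of F - F x0 by ee 1 - ee 1 x0 is continuous. If all coefficients
    of F vanish, those of G satisfy a two-term recursion, so that their moduli are
    constant on each side of 0; Bessel's inequality makes these constants zero, and
    the recursion at 0 then gives F x0 = 0. *)
Theorem fourier_unique F F' : (forall x, cdrv F x (F' x)) ->
  (forall m, coef F m = 0) -> forall x0, 0 < x0 < 1 -> F x0 = 0.
Proof.
move=> dF F0 x0 x01.
have cF : continuous F by move=> x; exact: cdrv_cont (dF x).
pose SF := slope F x0 (F' x0); pose SE := slope (ee 1) x0 (1%:~R * tpi R * ee 1 x0).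
pose G x : R[i]^o := SF x / SE x.
have SE0 x : 0 <= x <= 1 -> SE x != 0.
  move=> x1; rewrite /SE /slope; case: (eqVneq x x0) => [_|xx0].
    have H : (1%:~R * tpi R * ee 1 x0 : R[i]) != 0.
      by rewrite mulf_neq0 ?ee_neq0 // mulf_neq0 ?tpi_neq0.
    exact: H.
  have H : ((x - x0)^-1%:C%C * (ee 1 x - ee 1 x0) : R[i]) != 0.
    rewrite mulf_neq0 //; first by rewrite eq_complex /= eqxx andbT invr_eq0 subr_eq0.
    by rewrite subr_eq0; apply: contra_neq xx0; exact: ee_inj1.
  exact: H.
have cSF : continuous SF by apply: slope_continuous.
have cSE : continuous SE by apply: slope_continuous; [exact: continuous_ee|exact: cdrv_ee].
have cG : contI G.
  apply: continuous_in_subspaceT => x /set_mem; rewrite /J01 /= in_itv /= => x1.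
  apply: (@cvgM _ _ _ _ SF (fun x => (SE x)^-1)); first exact: cSF.
  by apply: (@cvgV _ _ _ _ SE); [exact: SE0|exact: cSE].
have GE x : 0 <= x <= 1 -> F x - F x0 = G x * (ee 1 x - ee 1 x0).
  move=> x1; rewrite (slopeE F x0 (F' x0)) (slopeE (ee 1) x0 (1%:~R * tpi R * ee 1 x0)).
  by rewrite -/(SF x) -/(SE x) mulrCA /G divfK // SE0.
set C := F x0; set e0 := ee 1 x0.
have rec m : coef G (m - 1) - e0 * coef G m = - C * (m == 0)%:R.
  have c1 : contI (fun x => G x * ee 1 x)  := contI_eeM cG.
  have c2 : contI (fun x => - e0 * G x) := contIM (contI_cst (- e0)) cG.
  have c3 : contI F := contI_T cF.
  have c4 : contI (fun x => - C * ee 0 x) := contIM (contI_cst (- C)) (contI_ee 0).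
  have E1 : coef (fun x => G x * ee 1 x + - e0 * G x) m = coef G (m - 1) - e0 * coef G m.
    rewrite (coefD m c1 c2) coef_eeM; have -> := coefZ (- e0) m cG.
    by rewrite mulNr.
  have E2 : coef (fun x => F x + - C * ee 0 x) m = - C * (m == 0)%:R.
    rewrite (coefD m c3 c4) F0 add0r; have -> := coefZ (- C) m (contI_ee 0).
    by rewrite coef_ee eq_sym.
  rewrite -E1 -E2; apply: eq_intC => x x1; congr (_ * _); rewrite ee0 mulr1.
  by have -> : F x + - C = G x * (ee 1 x - e0) by [exact: GE]; rewrite mulrBr mulNr [e0 * _]mulrC.
have me0 : cmod e0 = 1 by rewrite /e0 /ee cmod_cexp /tpi mul1r !ReImE /= !mul0r mulr0 subr0 expR0.
have stepm m : m != 0 -> cmod (coef G (m - 1)) = cmod (coef G m).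
  move=> m0; have := rec m; rewrite (negPf m0) mulr0 => /eqP; rewrite subr_eq0 => /eqP ->.
  by rewrite cmodM me0 mul1r.
have pos (n : nat) : cmod (coef G n%:Z) = cmod (coef G 0).
  by elim: n => // n <-; rewrite -stepm // intS addrC addKr.
have neg (n : nat) : cmod (coef G (- 1 - n%:Z)) = cmod (coef G (- 1)).
  elim: n => [|n <-]; first by rewrite subr0.
  by rewrite intS opprD addrCA addrC stepm // -opprD oppr_eq0.
have c0 : cmod (coef G 0) = 0.
  by apply: (@coef_cst_modulus _ Posz G _ cG pos) => i j [].
have c1 : cmod (coef G (- 1)) = 0.
  apply: (@coef_cst_modulus _ (fun n => - 1 - n%:Z) G _ cG neg) => i j.
  by move=> /addrI /oppr_inj [].
have := rec 0; rewrite eqxx mulr1 sub0r.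
move/eqP: c0; rewrite cmod_eq0 => /eqP ->; move/eqP: c1; rewrite cmod_eq0 => /eqP ->.
by rewrite mulr0 subr0 => /eqP; rewrite eq_sym oppr_eq0 => /eqP.
Qed.

(** The derivative in the parameter is bounded on a compact neighbourhood, which
    dominates the difference quotients. *)
Lemma intR_param (f f' : R -> R -> R) (y0 : R) :
  (forall x y : R, is_derive y 1 (fun y => f y x) (f' y x)) ->
  (forall y, continuous (f y)) ->
  continuous (fun p : R * R => f' p.1 p.2) ->
  is_derive y0 1 (fun y => intR (f y)) (intR (f' y0)).
Proof.
move=> df cf cf'.
have k1 : [set` `[y0 - 1, y0 + 1]%R] `*` @J01 R !=set0.
  exists (y0, 0); split; rewrite /J01 /= in_itv /=; lra.
have k2 : compact ([set` `[y0 - 1, y0 + 1]%R] `*` @J01 R).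
  by apply: compact_setX; exact: segment_compact.
have cabs : continuous (fun p : R * R => `|f' p.1 p.2|).
  by move=> p; apply: continuous_comp; [exact: cf'|exact: norm_continuous].
have [[y1 x1] _ Hmax] := compact_EVT_max k1 k2 (continuous_subspaceT cabs).
set B := `|f' y1 x1| in Hmax.
have Hb y x : y \in `]y0 - 1, y0 + 1[ -> @J01 R x -> `|f' y x| <= B.
  move=> yI xI; apply: (Hmax (y, x)); apply/mem_set; split => //=.
  by move: yI; rewrite !in_itv /= => /andP[]; lra.
have intf y : mu.-integrable (@J01 R) (EFin \o f y).
  by apply: within_integrable; apply: continuous_subspaceT; exact: cf.
have derf (x y : R) : (`]y0 - 1, y0 + 1[%classic : set R) y -> @J01 R x -> derivable (fun y => f y x) y 1.
  by move=> _ _; case: (df x y).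
have d1 y x : partial1of2 f y x = f' y x.
  by rewrite partial1of2E; case: (df x y).
have GB x y : (`]y0 - 1, y0 + 1[%classic : set R) y -> @J01 R x -> `|partial1of2 f y x| <= B.
  by move=> yI xI; rewrite d1 Hb.
have y0I : (`]y0 - 1, y0 + 1[%classic : set R) y0 by rewrite /= in_itv /=; lra.
have iB : mu.-integrable (@J01 R) (EFin \o (fun=> B)).
  by apply: within_integrable; apply: continuous_subspaceT; exact: cst_continuous.
have B0 (x : R) : 0 <= (fun=> B) x by rewrite /B normr_ge0.
have H1 := @derivable_under_integral R _ _ mu f _ (@measurable_J01 R) y0 _ _ y0I
  (fun y _ => intf y) (fun y x yI xI => derf x y yI xI) (fun=> B) B0 iB
  (fun y x yI xI => GB x y yI xI).
have H2 := @differentiation_under_integral R _ _ mu f _ (@measurable_J01 R) y0 _ _ y0I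
  (fun y _ => intf y) (fun y x yI xI => derf x y yI xI) (fun=> B) B0 iB
  (fun y x yI xI => GB x y yI xI).
apply: DeriveDef; first exact: H1.
rewrite -derive1E H2; apply: eq_intR => x _; exact: d1.
Qed.

Lemma intC_param (f f' : R -> R -> R[i]^o) (y0 : R) :
  (forall x y, cdrv (fun y => f y x) y (f' y x)) ->
  (forall y, continuous (f y)) ->
  continuous (fun p : R * R => f' p.1 p.2 : R[i]^o) ->
  cdrv (fun y => intC (f y)) y0 (intC (f' y0)).
Proof.
move=> df cf /continuous_complexP[c1 c2]; split => /=.
  apply: (@intR_param (fun y x => Re (f y x)) (fun y x => Re (f' y x))) => //.
    by move=> x y; case: (df x y).
  by move=> y; have /continuous_complexP[] := cf y.
apply: (@intR_param (fun y x => Im (f y x)) (fun y x => Im (f' y x))) => //.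
  by move=> x y; case: (df x y).
by move=> y; have /continuous_complexP[] := cf y.
Qed.

End Fourier.

(** * The cube root of unity, dimensions and quasi-periodic functions *)

Section Omega.
Variable R : realType.
Local Notation Re := (@complex.Re R).
Local Notation Im := (@complex.Im R).
Local Notation om := (cstar_val (omega R)).

Lemma expiD (a b : R) : expi (a + b) = expi a * expi b.
Proof. by apply: complexP; rewrite ?ReM ?ImM /= ?sinD ?cosD; ring. Qed.

Lemma omega3 : om * om * om = 1.
Proof.
rewrite /omega /= -!expiD; have -> : 2 * pi / 3 + 2 * pi / 3 + 2 * pi / 3 = pi *+ 2 :> R.
  by rewrite -mulr_natl; field.
by rewrite /expi cos2pi sin2pi.
Qed.

Lemma Im_omega_gt0 : 0 < Im om.
Proof.
rewrite /=; apply: sin_gt0_pi; have := pi_gt0 R => p0.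
by apply/andP; split; lra.
Qed.

Lemma omega_poly : 1 + om + om * om = 0.
Proof.
have H : (om - 1) * (1 + om + om * om) = 0.
  have -> : (om - 1) * (1 + om + om * om) = om * om * om - 1 by ring.
  by rewrite omega3 subrr.
move/eqP: H; rewrite mulf_eq0 => /orP[|/eqP //].
rewrite subr_eq0 => /eqP H; have := Im_omega_gt0.
by rewrite H ltxx.
Qed.

(** The coordinates of omega follow from its quadratic equation and the sign of
    its imaginary part. *)
Lemma cube_root_coords (w : R[i]) : 1 + w + w * w = 0 -> 0 < Im w ->
  Re w = - 2^-1 /\ Im w ^+ 2 = 3 / 4.
Proof.
move=> E w0; have H1 := congr1 Re E; have H2 := congr1 Im E.
rewrite !ReImE in H1 H2.
have H : Im w * (1 + 2 * Re w) = 0 by rewrite -[RHS]H2; ring.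
have r : Re w = - 2^-1.
  by move/eqP: H; rewrite mulf_eq0 gt_eqF //= => /eqP; lra.
by split=> //; rewrite r in H1; lra.
Qed.

Lemma Re_omega : Re om = - 2^-1.
Proof. by case: (cube_root_coords (omega_poly) Im_omega_gt0). Qed.

Lemma Im_omega_sqr : Im om ^+ 2 = 3 / 4.
Proof. by case: (cube_root_coords (omega_poly) Im_omega_gt0). Qed.

Lemma cmod_omega : cmod om = 1. Proof. exact: cmod_expi. Qed.

Lemma omega_sqr : om * om = - 1 - om.
Proof. by apply/eqP; rewrite -subr_eq0; apply/eqP; rewrite -[RHS]omega_poly; ring. Qed.

Lemma omegaJ : om^*%C = om * om.
Proof.
have := Im_omega_sqr; have := Re_omega; move: om => w r i2.
apply: complexP; rewrite !ReImE r; [lra|lra].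
Qed.

End Omega.

Section HasDim.
Variables (K : fieldType).

(** Additivity and s-semilinearity of T on V, in the form in which [has_dim] uses
    them; s is the identity or complex conjugation. *)
Definition combination_on (L1 L2 : lmodType K) (V : set L1) (s : K -> K) (T : L1 -> L2) :=
  forall m (a : 'I_m -> K) (b : 'I_m -> L1), (forall i, V (b i)) ->
    T (\sum_i a i *: b i) = \sum_i s (a i) *: T (b i).

Lemma has_dim_iso (L1 L2 : lmodType K) (V : set L1) (W : set L2) (s t : K -> K)
    (T : L1 -> L2) (S : L2 -> L1) m :
  s 0 = 0 -> cancel s t -> cancel t s -> 
  combination_on V s T -> combination_on W t S ->
  (forall f, V f -> W (T f)) -> (forall g, W g -> V (S g)) ->
  (forall f, V f -> S (T f) = f) -> (forall g, W g -> T (S g) = g) ->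
  has_dim W m -> has_dim V m.
Proof.
move=> s0 st ts cT cS TW SV ST TS [b [bW bi bs]].
have T0 : T 0 = 0.
  have := cT 0%N (fun=> 0) (fun=> 0); rewrite !big_ord0; apply.
  by case.
exists (fun i => S (b i)); split=> [i|a H i|f Vf]; first exact: SV.
  have := cT m a (fun i => S (b i)) (fun i => SV _ (bW i)); rewrite H T0.
  move=> /esym E; have : s (a i) = 0.
    apply: (bi (fun i => s (a i))); rewrite -[RHS]E; apply: eq_bigr => j _.
    by rewrite TS.
  by move=> e; apply: (can_inj st); rewrite e s0.
have [a Ha] := bs _ (TW _ Vf); exists (fun i => t (a i)).
by rewrite -(ST _ Vf) Ha cS.
Qed.

End HasDim.

Section Eigen.
Variable R : realType.
Implicit Types (p q : heis R) (x y : sim R) (f g : heis R -> R[i]^o) (c : R[i]).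
Local Notation Re := (@complex.Re R).
Local Notation Im := (@complex.Im R).
Local Notation om := (cstar_val (omega R)).
Local Notation fct := (heis R -> R[i]^o).

Lemma combinationE m (a : 'I_m -> R[i]) (b : 'I_m -> fct) p :
  (\sum_i a i *: b i) p = \sum_i a i * b i p.
Proof.
elim/big_ind2: _ => [//|f1 c1 f2 c2 <- <- //|i _ //].
Qed.

Definition inv_by x c f := forall p, f (sim_act x p) = c * f p.

(** A linear differential equation in t. *)
Lemma central_character f (nu : R) : smooth f ->
  (forall p, Tfield f p = ('i%C * nu%:C%C) * f p) ->
  forall p, f p = cexp ('i%C * (nu * ht p)%:C%C) * f (Heis (hz p) 0).
Proof.
move=> sf H p.
have D s : cdrv (fun s => f (hline (dirt R) (Heis (hz p) 0) s)) s
    (('i%C * nu%:C%C) * f (hline (dirt R) (Heis (hz p) 0) s)).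
  by rewrite -H; apply: hdrv_at; apply: smooth_hdrv => //; exact: cdt.
have := cdrv_ode D (ht p); rewrite hline0.
have -> : hline (dirt R) (Heis (hz p) 0) (ht p) = p.
  by apply: heisP; rewrite /= ?ReImE; ring.
by move=> ->; congr (cexp _ * _); rewrite rmorphM; ring.
Qed.

Lemma cmod_central f (nu : R) : smooth f ->
  (forall p, Tfield f p = ('i%C * nu%:C%C) * f p) ->
  forall p, cmod (f p) = cmod (f (Heis (hz p) 0)).
Proof.
move=> sf H p; rewrite (central_character sf H p) cmodM cmod_cexp !ReImE.
by rewrite mul0r mulr0 subr0 expR0 mul1r.
Qed.

Definition trans (z : R[i]) : sim R := heis_in_sim (Heis z 0).

Lemma trans_act z p : sim_act (trans z) p = Heis (z + hz p) (ht p + 2 * Im (z * (hz p)^*%C)).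
Proof. by rewrite /sim_act /trans /= mu1; apply: heisP; rewrite /= ?ReImE; ring. Qed.

Lemma cmod_inv_by z c f (nu : R) : smooth f ->
  (forall p, Tfield f p = ('i%C * nu%:C%C) * f p) -> cmod c = 1 ->
  inv_by (trans z) c f -> forall w, cmod (f (Heis (z + w) 0)) = cmod (f (Heis w 0)).
Proof.
move=> sf H c1 hz w; have := hz (Heis w 0); rewrite trans_act /= => /(congr1 (@cmod R)).
by rewrite cmodM c1 mul1r (cmod_central sf H).
Qed.

Lemma cmod_inv_int z c f (nu : R) (n : int) : smooth f ->
  (forall p, Tfield f p = ('i%C * nu%:C%C) * f p) -> cmod c = 1 ->
  inv_by (trans z) c f -> forall w, cmod (f (Heis (n%:~R * z + w) 0)) = cmod (f (Heis w 0)).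
Proof.
move=> sf H c1 hz; elim/int_ind: n => [w|n IH w|n IH w]; first by rewrite mul0r add0r.
  by rewrite intS intrD mulrDl mul1r -addrA (cmod_inv_by sf H c1 hz).
have e : z + ((- n.+1%:Z)%:~R * z + w) = (- n%:Z)%:~R * z + w.
  by rewrite intS opprD intrD; ring.
by rewrite -(cmod_inv_by sf H c1 hz) e IH.
Qed.

Lemma lattice_reduce (z : R[i]) : exists (a b : int) (u v : R),
  [/\ 0 <= u <= 1, 0 <= v <= 1 & z = a%:~R + (b%:~R * om + (u%:C%C + v%:C%C * om))].
Proof.
have := Im_omega_gt0 R; have := Re_omega R; move: om => w r h0.
pose V := Im z / Im w; pose U := Re z + V / 2.
exists (Num.floor U), (Num.floor V), (U - (Num.floor U)%:~R), (V - (Num.floor V)%:~R).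
have fl (t : R) : 0 <= t - (Num.floor t)%:~R <= 1.
  have /andP[h1 h2] := floor_itv t.
  by rewrite subr_ge0 h1 /= lerBlDl; move: h2; rewrite intrD => /ltW.
split; [exact: fl|exact: fl|].
have E n : (n%:~R : R[i]) = (n%:~R : R)%:C%C by rewrite rmorph_int.
rewrite !E; apply: complexP; rewrite !ReImE r /U /V; field; rewrite gt_eqF //.
Qed.

(** The modulus of f is periodic under the lattice and independent of t, hence
    attains its maximum on a compact fundamental parallelogram. *)
Lemma attains_max f (nu : R) a b : smooth f ->
  (forall p, Tfield f p = ('i%C * nu%:C%C) * f p) -> cmod a = 1 -> cmod b = 1 ->
  inv_by (trans 1) a f -> inv_by (trans om) b f ->
  exists p0, forall p, cmod (f p) <= cmod (f p0).
Proof.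
move=> sf H a1 b1 ha hb.
pose P (w : R * R) : heis R := Heis (w.1%:C%C + w.2%:C%C * om) 0.
have cP : continuous P.
  have c1 : continuous (fun w : R * R => w.1) by move=> w; exact: cvg_fst.
  have c2 : continuous (fun w : R * R => w.2) by move=> w; exact: cvg_snd.
  have cC (k : R) : continuous (fun w : R * R => k) by move=> w; exact: cvg_cst.
  apply: continuous_heisP; rewrite /P /=; last exact: cC.
    have -> : (fun w : R * R => Re (w.1%:C%C + w.2%:C%C * om)) = fun w => w.1 + w.2 * Re om.
      by apply/funext => w; move: om => o; rewrite !ReImE mul0r subr0.
    by apply: continuous_RD => //; apply: continuous_RM.
  have -> : (fun w : R * R => Im (w.1%:C%C + w.2%:C%C * om)) = fun w => w.2 * Im om.
    by apply/funext => w; move: om => o; rewrite !ReImE mul0r add0r addr0.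
  by apply: continuous_RM.
pose m (w : R * R) : R := cmod (f (P w)) ^+ 2.
have cm : continuous m.
  have := smooth_cont sf => /continuous_complexP[c1 c2].
  have -> : m = fun w => Re (f (P w)) * Re (f (P w)) + Im (f (P w)) * Im (f (P w)).
    by apply/funext => w; rewrite /m cmod_sqr !expr2.
  have d1 := continuous_comp_all cP c1; have d2 := continuous_comp_all cP c2.
  by apply: continuous_RD; apply: continuous_RM.
have k1 : ([set` `[0, 1 : R]%R] `*` [set` `[0, 1 : R]%R]) !=set0.
  by exists (0, 0); split; rewrite /= in_itv /= lexx ler01.
have k2 : compact ([set` `[0, 1 : R]%R] `*` [set` `[0, 1 : R]%R]).
  by apply: compact_setX; exact: segment_compact.
have [w0 _ Hmax] := compact_EVT_max k1 k2 (continuous_subspaceT cm).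
exists (P w0) => p.
have [i [j [u [v [u1 v1 E]]]]] := lattice_reduce (hz p).
rewrite (cmod_central sf H) E.
have -> : (i%:~R : R[i]) = i%:~R * 1 by rewrite mulr1.
rewrite (cmod_inv_int i sf H a1 ha) (cmod_inv_int j sf H b1 hb).
rewrite -(@ler_pXn2r _ 2) ?nnegrE ?cmod_ge0 //.
apply: (Hmax (u, v)); apply/mem_set; split; by rewrite /= in_itv.
Qed.

End Eigen.

(** * The ladder of eigenspaces *)

Section Levels.
Variable R : realType.
Implicit Types (p q : heis R) (x y : sim R) (f g : heis R -> R[i]^o) (c : R[i]).
Local Notation Re := (@complex.Re R).
Local Notation Im := (@complex.Im R).
Local Notation om := (cstar_val (omega R)).
Local Notation fct := (heis R -> R[i]^o).

Lemma combination_id (V : set fct) D : (forall f, V f -> smooth f) -> derivation D ->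
  @combination_on R[i] fct fct V id D.
Proof.
move=> Vs [DD _ DZ] m a b Vb; have sb i := Vs _ (Vb i).
have E (L : lmodType R[i]) (c : 'I_m -> L) : \sum_i a i *: c i = \sum_(i <- enum 'I_m) a i *: c i.
  by rewrite big_enum.
rewrite !E; suff [] : smooth (\sum_(i <- enum 'I_m) a i *: b i : fct) /\
   D (\sum_(i <- enum 'I_m) a i *: b i : fct) = \sum_(i <- enum 'I_m) a i *: (D (b i) : fct) by [].
elim: (enum 'I_m) => [|i s [IH1 IH2]].
  rewrite !big_nil; split; first exact: smooth_cst.
  have := DZ 0 (fun=> 0) (smooth_cst 0).
  have -> : (fun p : heis R => 0 * (fun=> 0) p) = (0 : fct).
    by apply/funext => p; exact: mul0r.
  by move=> ->; apply/funext => p; exact: mul0r.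
rewrite !big_cons; split; first exact: (smoothD (smoothZ (a i) (sb i)) IH1).
by etransitivity; [exact: (DD _ _ (smoothZ (a i) (sb i)) IH1)|rewrite IH2 (DZ _ _ (sb i))].
Qed.

Lemma combination_comp (V : set fct) (u : heis R -> heis R) (c : R[i]) :
  @combination_on R[i] fct fct V id (fun f p => c * f (u p)).
Proof.
move=> m a b _; apply/funext => p; rewrite !combinationE big_distrr /=.
by apply: eq_bigr => i _; rewrite mulrCA.
Qed.

Lemma combination_comp_op (V : set fct) (c : R[i]) (D : fct -> fct) :
  @combination_on R[i] fct fct V id D ->
  @combination_on R[i] fct fct V id (fun f p => c * D f p).
Proof.
move=> H m a b Vb; apply/funext => p; rewrite H // !combinationE big_distrr /=.
by apply: eq_bigr => i _; rewrite mulrCA.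
Qed.

Definition central (nu : R) f := forall p, Tfield f p = ('i%C * nu%:C%C) * f p.

Lemma commutator_central nu f p : smooth f -> central nu f ->
  Zfield (Zbarfield f) p - Zbarfield (Zfield f) p = (2 * nu)%:C%C * f p.
Proof.
move=> sf H; rewrite commutator_ZZbar // H rmorphM rmorphMn /=.
have i2 : 'i%C * 'i%C = -1 :> R[i] by rewrite -expr2 sqr_i.
move: (f p : R[i]) => w; ring: i2.
Qed.

Lemma central_Z nu f : smooth f -> central nu f -> central nu (Zfield f).
Proof.
move=> sf H p; have [_ _ ZZ] := derivation_Z R.
rewrite -commutator_ZT //.
have -> : Tfield f = fun p => ('i%C * nu%:C%C) * f p by apply/funext => q; exact: H.
by rewrite ZZ.
Qed.

Lemma central_Zbar nu f : smooth f -> central nu f -> central nu (Zbarfield f).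
Proof.
move=> sf H p; have [_ _ ZZ] := derivation_Zbar R.
rewrite -commutator_ZbarT //.
have -> : Tfield f = fun p => ('i%C * nu%:C%C) * f p by apply/funext => q; exact: H.
by rewrite ZZ.
Qed.

Lemma unit_conj (l : R[i]) : cmod l = 1 -> l * l^*%C = 1.
Proof. by move=> h; rewrite -cmod_sqrE h expr1n. Qed.

Lemma inv_by_Zbar x c f : smooth f -> cmod (siml x) = 1 -> inv_by x c f ->
  inv_by x ((siml x : R[i]) * c) (Zbarfield f).
Proof.
move=> sf l1 H p; have [_ _ ZZ] := derivation_Zbar R.
have E : (fun p => f (sim_act x p)) = (fun p => c * f p) by apply/funext => q; exact: H.
have := congr1 (fun u => Zbarfield u p) E; rewrite Zbarfield_act // ZZ // => K.
by rewrite -mulrA -K mulrA unit_conj // mul1r.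
Qed.

Lemma inv_by_Z x c f : smooth f -> cmod (siml x) = 1 -> inv_by x c f ->
  inv_by x ((siml x : R[i])^*%C * c) (Zfield f).
Proof.
move=> sf l1 H p; have [_ _ ZZ] := derivation_Z R.
have E : (fun p => f (sim_act x p)) = (fun p => c * f p) by apply/funext => q; exact: H.
have := congr1 (fun u => Zfield u p) E; rewrite Zfield_act // ZZ // => K.
by rewrite -mulrA -K mulrA [_^*%C * _]mulrC unit_conj // mul1r.
Qed.

Lemma cmod_trans z : cmod (siml (trans z : sim R)) = 1.
Proof. by rewrite cmod_real normr1. Qed.

Lemma inv_by_Zbar_trans z c f : smooth f -> inv_by (trans z) c f ->
  inv_by (trans z) c (Zbarfield f).
Proof.
by move=> sf H p; rewrite (inv_by_Zbar sf (cmod_trans z) H) /= mul1r.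
Qed.

Lemma inv_by_Z_trans z c f : smooth f -> inv_by (trans z) c f ->
  inv_by (trans z) c (Zfield f).
Proof.
move=> sf H p; rewrite (inv_by_Z sf (cmod_trans z) H).
by have -> : (cstar_val (siml (trans z)))^*%C = 1 :> R[i]; [exact: conjc1|rewrite mul1r].
Qed.

Definition rot : sim R := Sim 1%g (omega R).

(** Quasi-periodic functions with central frequency nu and multipliers a, b for
    the lattice translations. *)
Definition quasi nu a b f :=
  [/\ smooth f, central nu f, inv_by (trans 1) a f & inv_by (trans om) b f].

(** The k-th eigenspace of the sub-Laplacian at central frequency nu, written
    through Z and its conjugate, refined by the rotation eigenvalue e. *)
Definition level nu (k : nat) a b e : set fct := [set f |
  [/\ quasi nu a b f, inv_by rot e f &
      forall p, Zfield (Zbarfield f) p = - (2 * k%:R * nu)%:C%C * f p]].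

Lemma quasi_Z nu a b f : quasi nu a b f -> quasi nu a b (Zfield f).
Proof.
move=> [sf H ha hb]; split; [exact: smooth_Z|exact: central_Z| |]; exact: inv_by_Z_trans.
Qed.

Lemma quasi_Zbar nu a b f : quasi nu a b f -> quasi nu a b (Zbarfield f).
Proof.
move=> [sf H ha hb]; split; [exact: smooth_Zbar|exact: central_Zbar| |];
  exact: inv_by_Zbar_trans.
Qed.

Lemma inv_by_scale x e c f : inv_by x e f -> inv_by x e (fun p => c * f p).
Proof. by move=> H p; rewrite H mulrCA. Qed.

Lemma quasi_scale nu a b c f : quasi nu a b f -> quasi nu a b (fun p => c * f p).
Proof.
move=> [sf H ha hb]; split; [exact: smoothZ| |exact: inv_by_scale|exact: inv_by_scale].
by move=> p; have [_ _ TZ] := derivation_T R; rewrite TZ // H mulrCA.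
Qed.

(** The commutator of Z and its conjugate is the scalar 2 nu on functions of central
    frequency nu, so the conjugate field lowers the level by one; it is rotated
    by the inverse of omega, which changes the eigenvalue to omega e. *)
Lemma level_Zbar nu k a b e f : level nu k.+1 a b e f -> level nu k a b (om * e) (Zbarfield f).
Proof.
move=> [Q he E]; have [sf H ha hb] := Q; split; first exact: quasi_Zbar.
  by apply: (inv_by_Zbar (x := rot) sf _ he); exact: cmod_omega.
move=> p; have [_ _ ZZ] := derivation_Zbar R.
have := commutator_central p (smooth_Zbar sf) (central_Zbar sf H).
have -> : Zfield (Zbarfield f) = fun q => - (2 * k.+1%:R * nu)%:C%C * f q.
  by apply/funext => q; exact: E.
rewrite ZZ // => K.
have -> : Zfield (Zbarfield (Zbarfield f)) p = (2 * nu)%:C%C * Zbarfield f p +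
   - (2 * k.+1%:R * nu)%:C%C * Zbarfield f p by rewrite -K subrK.
rewrite -mulrDl; congr (_ * _); rewrite -rmorphN -rmorphD -rmorphN; congr (_%:C%C).
by rewrite -natr1; ring.
Qed.

(** The inverse of the conjugate field from level k + 1 to level k. *)
Definition raise nu (k : nat) g : fct :=
  fun p => - ((2 * k.+1%:R * nu)^-1)%:C%C * Zfield g p.

Lemma ZbarZ_level nu k a b e g p : level nu k a b e g ->
  Zbarfield (Zfield g) p = - (2 * k.+1%:R * nu)%:C%C * g p.
Proof.
move=> [[sg H ha hb] he E].
have -> : Zbarfield (Zfield g) p = Zfield (Zbarfield g) p - (2 * nu)%:C%C * g p.
  by rewrite -(commutator_central p sg H) subKr.
rewrite E -mulrBl; congr (_ * _); rewrite -!rmorphN -rmorphD; congr (_%:C%C).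
by rewrite -natr1; ring.
Qed.

Lemma level_raise nu k a b e g : level nu k a b (om * e) g -> level nu k.+1 a b e (raise nu k g).
Proof.
move=> Lg; have [Q he E] := Lg; have [sg H ha hb] := Q.
split; first by apply: quasi_scale; exact: quasi_Z.
  apply: inv_by_scale => p.
  rewrite (inv_by_Z (x := rot) sg _ he); last exact: cmod_omega.
  rewrite mulrA [_^*%C * om]mulrC unit_conj ?mul1r //; exact: cmod_omega.
move=> p; have [_ _ BZ] := derivation_Zbar R; have [_ _ ZZ] := derivation_Z R.
rewrite /raise BZ; last exact: smooth_Z.
rewrite ZZ; last by apply: smooth_Zbar; exact: smooth_Z.
have -> : Zbarfield (Zfield g) = fun q => - (2 * k.+1%:R * nu)%:C%C * g q.
  by apply/funext => q; exact: (ZbarZ_level _ Lg).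
by rewrite ZZ // mulrCA.
Qed.

(** The two fields are inverse to each other up to the nonzero constant
    - 2 (k + 1) nu. *)
Lemma has_dim_level nu k a b e m : 0 < nu ->
  has_dim (level nu k a b (om * e)) m -> has_dim (level nu k.+1 a b e) m.
Proof.
move=> nu0.
have kn : 2 * k.+1%:R * nu != 0 by rewrite !mulf_neq0 ?pnatr_eq0 ?gt_eqF.
have kC : (2 * k.+1%:R * nu)%:C%C * ((2 * k.+1%:R * nu)^-1)%:C%C = 1 :> R[i].
  by rewrite -rmorphM mulfV.
have cancel_neg (u v w : R[i]) : u * v = 1 -> - v * (- u * w) = w.
  by move=> uv; rewrite !mulNr mulrN opprK mulrA [v * u]mulrC uv mul1r.
have [_ _ BZ] := derivation_Zbar R.
apply: (@has_dim_iso R[i] fct fct _ _ id id (@Zbarfield R) (raise nu k)) => //.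
- apply: combination_id; last exact: derivation_Zbar.
  by move=> f [[]].
- apply: combination_comp_op; apply: combination_id; last exact: derivation_Z.
  by move=> f [[]].
- by move=> f; exact: level_Zbar.
- by move=> g; exact: level_raise.
- move=> f [_ _ E]; apply/funext => p; rewrite /raise E.
  exact: (cancel_neg _ _ (f p) kC).
- move=> g Lg; have [[sg _ _ _] _ _] := Lg; apply/funext => p.
  rewrite /raise BZ; last exact: smooth_Z.
  rewrite (ZbarZ_level p Lg).
  exact: (cancel_neg _ _ (g p) kC).
Qed.

(** In the lowest level the function is annihilated by the antiholomorphic
    field: otherwise that field would produce an eigenfunction of negative
    energy. *)
Lemma level0_Zbar nu a b e f : 0 < nu -> cmod a = 1 -> cmod b = 1 ->
  level nu 0 a b e f -> Zbarfield f = fun=> 0.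
Proof.
move=> nu0 a1 b1 [Q he E]; have [sg H ha hb] := quasi_Zbar Q.
have [sf Hf _ _] := Q.
have [p0 Hmax] := attains_max sg H a1 b1 ha hb.
have nu4 : 0 < 4 * nu by rewrite mulr_gt0.
apply: (max_principle sg nu4 Hmax) => p.
have Z0 : Zfield (Zbarfield f) = fun q => 0 * f q.
  by apply/funext => q; rewrite E mulr0 mul0r rmorph0 oppr0 mul0r.
have [_ _ BZ] := derivation_Zbar R.
have K1 : Zbarfield (Zfield (Zbarfield f)) p = 0 by rewrite Z0 BZ // mul0r.
have := commutator_central p sg H; rewrite K1 subr0.
rewrite ZZbarE // commutator_XY // H.
have i2 : 'i%C * 'i%C = -1 :> R[i] by rewrite -expr2 sqr_i.
have -> : (4%:C%C : R[i]) = 4 by rewrite rmorphMn.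
have -> : ((2 * nu)%:C%C : R[i]) = 2 * nu%:C%C by rewrite rmorphM rmorphMn.
have -> : ((4 * nu)%:C%C : R[i]) = 4 * nu%:C%C by rewrite rmorphM rmorphMn.
move: (Xfield _ _ + Yfield _ _ : R[i]) (Zbarfield f p : R[i]) (nu%:C%C : R[i]) => A B n K.
have n4 : (4 : R[i]) != 0 by rewrite pnatr_eq0.
have -> : A = 4 * (4^-1 * (A + 'i%C * (- 4 * ('i%C * n * B)))) - 4 * n * B.
  by field: i2.
rewrite K; ring.
Qed.

Lemma level0P nu a b e f : 0 < nu -> cmod a = 1 -> cmod b = 1 ->
  level nu 0 a b e f <-> [/\ quasi nu a b f, Zbarfield f = (fun=> 0) & inv_by rot e f].
Proof.
move=> nu0 a1 b1; split=> [L|[Q E he]]; first by have [Q he _] := L; split => //;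
  exact: level0_Zbar L.
split => // p; rewrite E mulr0 mul0r rmorph0 oppr0 mul0r ZfieldE /Xfield /Yfield /Tfield.
by rewrite !hderive_cst !mulr0 subr0 mulr0 addr0 subr0 mulr0.
Qed.

End Levels.

(** * An upper bound for the number of theta functions *)

Section ThetaBound.
Variable R : realType.
Implicit Types (p q : heis R) (f g u : heis R -> R[i]^o) (c w z : R[i]) (m : int).
Local Notation Re := (@complex.Re R).
Local Notation Im := (@complex.Im R).
Local Notation om := (cstar_val (omega R)).
Local Notation fct := (heis R -> R[i]^o).

Lemma continuous_line w : continuous (fun p : R * R => Heis (p.2%:C%C + p.1%:C%C * w) 0 : heis R).
Proof.
have c1 : continuous (fun p : R * R => p.1) by move=> p; exact: cvg_fst.
have c2 : continuous (fun p : R * R => p.2) by move=> p; exact: cvg_snd.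
have cC (k : R) : continuous (fun p : R * R => k) by move=> p; exact: cvg_cst.
apply: continuous_heisP => /=; last exact: cC.
  have -> : (fun p : R * R => Re (p.2%:C%C + p.1%:C%C * w)) = fun p : R * R => p.2 + p.1 * Re w.
    by apply/funext => p; rewrite !ReImE mul0r subr0.
  by apply: continuous_RD => //; apply: continuous_RM.
have -> : (fun p : R * R => Im (p.2%:C%C + p.1%:C%C * w)) = fun p : R * R => p.1 * Im w.
  by apply/funext => p; rewrite !ReImE mul0r add0r addr0.
by apply: continuous_RM.
Qed.

Lemma continuous_plane_path w u : continuous u ->
  continuous (fun x : R => u (Heis (x%:C%C + w) 0) : R[i]^o).
Proof.
move=> cu; have H := continuous_comp_all (@continuous_line w) cu.
have cp : continuous (fun x : R => (1, x) : R * R).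
  have k1 : continuous (fun x : R => 1 : R) by move=> x; exact: cvg_cst.
  have k2 : continuous (fun x : R => x) by move=> x; exact: cvg_id.
  by move=> x; exact: (cvg_pair (k1 x) (k2 x)).
have := continuous_comp_all cp H; congr (continuous _).
by apply/funext => x; rewrite /= mul1r.
Qed.

(** Cauchy's theorem for a periodic function holomorphic along t = 0: its
    integral over a horizontal period does not depend on the base point. *)
Lemma intC_holomorphic u w : smooth u ->
  (forall p, hderive (diry R) u p = 'i%C * hderive (dirx R) u p) ->
  (forall z, u (Heis (z + 1) 0) = u (Heis z 0)) ->
  intC (fun x => u (Heis (x%:C%C + w) 0)) = intC (fun x => u (Heis x%:C%C 0)).
Proof.
move=> su hol per.
pose H (t x : R) : R[i]^o := u (Heis (x%:C%C + t%:C%C * w) 0).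
pose H1 (t x : R) : R[i]^o := hderive (dirx R) u (Heis (x%:C%C + t%:C%C * w) 0).
have sux := smooth_hderive (@cdx R) su.
have lineE (z v : R[i]) s : Heis (z + s%:C%C * v) 0 = hline (v, 0) (Heis z 0) s.
  by apply: heisP; rewrite ?hz_hline ?ht_hline //= mulr0 addr0.
have chain v : hdrv (v, 0) u (fun p => v * hderive (dirx R) u p).
  move=> p; apply: cdrv_eq (smooth_chain (v, 0) su p) _; rewrite hol [(v, 0).1]/= [(v, 0).2]/=.
  rewrite rmorph0 mul0r addr0 [in RHS](complexE v) mulrDl mulrA.
  by congr (_ + _ * _); rewrite mulrC.
have dH t x : cdrv (fun t => H t x) t (w * H1 t x).
  apply: cdrv_ext (cdrv_eq (hdrv_at (chain w) (Heis x%:C%C 0) t) _) => [s|].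
    by rewrite /H lineE.
  by rewrite /H1 lineE.
have dHx t x : cdrv (H t) x (H1 t x).
  have h := hdrv_at (chain 1) (Heis (t%:C%C * w) 0) x.
  apply: cdrv_ext (cdrv_eq h _) => [s|]; rewrite -lineE mulr1 addrC //.
  by rewrite mul1r.
have cH1 : continuous (fun p : R * R => w * H1 p.1 p.2 : R[i]^o).
  apply: continuous_complexM; first exact: cst_continuous.
  exact: (continuous_comp_all (@continuous_line w) (smooth_cont sux)).
have cHt t : continuous (H t) by exact: (@continuous_plane_path _ _ (smooth_cont su)).
have cH1t t : continuous (H1 t) by exact: (@continuous_plane_path _ _ (smooth_cont sux)).
have D t : cdrv (fun t => intC (H t)) t 0.
  have := @intC_param R H (fun t x => w * H1 t x) t (fun x y => dH y x) cHt cH1.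
  move=> h; apply: (cdrv_eq h).
  have -> := intCZ w (contI_T (cH1t t)).
  rewrite (@intC_FTC R (H t) (H1 t)) //.
  have -> : H t 1 = H t 0 by rewrite /H rmorph1 rmorph0 add0r addrC per.
  by rewrite subrr mulr0.
have := cdrv0_cst D 1 0.
rewrite /H; under eq_fun do rewrite mul1r; move=> ->.
by apply: eq_intC => x _; rewrite mul0r addr0.
Qed.

Variables (M : nat) (nu : R) (b : R[i]) (delta : R).
Hypothesis M0 : (0 < M)%N.
Hypothesis nuE : 2 * nu * Im om = pi * M%:R.
Hypothesis b0 : b != 0.

Let a : R[i] := cexp (delta%:C%C * tpi R).

Definition theta f := quasi nu a b f /\ Zbarfield f = fun=> 0.

(* The exponent turning f into the m-th Fourier mode of a holomorphic function. *)
Definition mode_exponent m p : R[i] :=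
  - ('i%C * (2 * nu)%:C%C * (Im (hz p))%:C%C * hz p) - (m%:~R + delta%:C%C) * tpi R * hz p.

Definition mode m f : fct := fun p => f p * cexp (mode_exponent m p).

Lemma hdrv_Im v : hdrv v (fun p : heis R => (Im (hz p))%:C%C : R[i]^o) (fun=> (Im v.1)%:C%C).
Proof.
move=> p.
have -> : (fun s => (Im (hz (hline v p s)))%:C%C) =
   fun s => (Im (hz p))%:C%C + s%:C%C * (Im v.1)%:C%C.
  by apply/funext => s; rewrite -!rmorphM -rmorphD hz_hline !ReImE; congr (_%:C%C); ring.
apply: cdrv_eq (cdrvD (cdrv_cst _ _) (cdrvM (cdrv_id _) (cdrv_cst _ _))) _.
by rewrite mul1r mulr0 addr0 add0r.
Qed.

Lemma hdrv_mode_exponent m v : hdrv v (mode_exponent m : fct) (fun p =>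
  - ('i%C * (2 * nu)%:C%C * ((Im v.1)%:C%C * hz p + (Im (hz p))%:C%C * v.1))
  - (m%:~R + delta%:C%C) * tpi R * v.1).
Proof.
move=> p; have h1 := hdrv_Im v p; have h2 := hdrv_hz v p.
have h3 := cdrvZ ('i%C * (2 * nu)%:C%C) (cdrvM h1 h2).
have h4 := cdrvZ ((m%:~R + delta%:C%C) * tpi R) h2.
rewrite hline0 in h3.
apply: cdrv_ext (cdrvB (cdrvN h3) h4) => s.
by rewrite /mode_exponent !mulrA.
Qed.

Lemma smooth_mode_exponent m : smooth (mode_exponent m : fct).
Proof.
have -> : (mode_exponent m : fct) = fun p =>
   (- ('i%C * (2 * nu)%:C%C)) * ((Im (hz p))%:C%C * hz p) +
   (- ((m%:~R + delta%:C%C) * tpi R)) * hz p.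
  by apply/funext => p; rewrite /mode_exponent !mulNr !mulrA.
have sz := @smooth_hz R.
exact: (smoothD (smoothZ _ (smoothM (smooth_Im sz) sz)) (smoothZ _ sz)).
Qed.

Lemma smooth_mode m f : smooth f -> smooth (mode m f).
Proof. by move=> sf; exact: (smoothM sf (smooth_cexp (smooth_mode_exponent m))). Qed.

(** The factor exp(- 2 i nu y z) turns the equation of the conjugate field on the plane
    t = 0 into the Cauchy-Riemann equation. *)
Lemma mode_holomorphic m f p : theta f ->
  hderive (diry R) (mode m f) p = 'i%C * hderive (dirx R) (mode m f) p.
Proof.
move=> [[sf H _ _] Zf].
have E v : coord_dir v -> hderive v (mode m f) p = hderive v f p * cexp (mode_exponent m p) +
   f p * ((- ('i%C * (2 * nu)%:C%C * ((Im v.1)%:C%C * hz p + (Im (hz p))%:C%C * v.1))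
     - (m%:~R + delta%:C%C) * tpi R * v.1) * cexp (mode_exponent m p)).
  move=> hv; have h := hdrvM (smooth_hdrv hv sf) (hdrv_cexp (hdrv_mode_exponent m v)).
  by rewrite (hdrvE h).
rewrite (E _ (@cdx R)) (E _ (@cdy R)).
have K : hderive (dirx R) f p + 'i%C * hderive (diry R) f p +
    ((2 * Im (hz p))%:C%C - 'i%C * (2 * Re (hz p))%:C%C) * (('i%C * nu%:C%C) * f p) = 0.
  have := congr1 (fun u => u p) Zf; rewrite ZbarfieldE /Xfield /Yfield H => K.
  move: K; move: (hderive (dirx R) f p : R[i]) (hderive (diry R) f p : R[i]) (f p : R[i]) => A B D K.
  have n2 : (2^-1 : R[i]) != 0 by rewrite invr_eq0 pnatr_eq0.
  by apply: (mulfI n2); rewrite mulr0 -[RHS]K; ring.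
move: K; move: (hderive (dirx R) f p : R[i]) (hderive (diry R) f p : R[i]) (f p : R[i]) => A B D K.
have i2 : 'i%C * 'i%C = -1 :> R[i] by rewrite -expr2 sqr_i.
have -> : A = - ('i%C * B) - ((2 * Im (hz p))%:C%C - 'i%C * (2 * Re (hz p))%:C%C) * (('i%C * nu%:C%C) * D).
  by apply/eqP; rewrite -subr_eq0 -[X in _ == X]K; apply/eqP; ring.
rewrite /diry /dirx; cbn [fst snd]; rewrite Im1 Imi ?rmorph1 ?rmorph0.
have z := complexE (hz p); move: z; move: (hz p) (cexp _) (m%:~R + _) (tpi R) => Z X Y W z.
have e2 k : ((2 * k)%:C%C : R[i]) = 2 * k%:C%C by rewrite rmorphM rmorphMn.
rewrite !e2; move: (Re Z) (Im Z) z => x y ->; ring: i2.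
Qed.

Lemma mode_periodic m f z : theta f -> mode m f (Heis (z + 1) 0) = mode m f (Heis z 0).
Proof.
move=> [[sf H ha _] _].
have := ha (Heis z 0); rewrite trans_act /= => E.
have F := central_character sf H (Heis (1 + z) (0 + 2 * Im (1 * z^*%C))).
rewrite /= in F.
have G : f (Heis (z + 1) 0) = a * cexp ('i%C * (nu * (2 * Im z))%:C%C) * f (Heis z 0).
  have e : f (Heis (1 + z) 0) = cexp ('i%C * (nu * (2 * Im z))%:C%C) *
     f (Heis (1 + z) (0 + 2 * Im (1 * z^*%C))).
    rewrite F mulrA -cexpD -mulrDr -rmorphD.
    have -> : nu * (2 * Im z) + nu * (0 + 2 * Im (1 * z^*%C)) = 0.
      by rewrite !ReImE; ring.
    by rewrite rmorph0 mulr0 cexp0 mul1r.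
  by rewrite addrC e E mulrCA mulrA.
have comm (u v s t : R[i]) : u * v * s * t = s * (u * v * t) by ring.
rewrite /mode G; apply: (etrans (comm _ _ _ _)); congr (_ * _).
rewrite /a -!cexpD.
have e2 k : ((2 * k)%:C%C : R[i]) = 2 * k%:C%C by rewrite rmorphM rmorphMn.
have e3 : ((nu * (2 * Im z))%:C%C : R[i]) = nu%:C%C * (2 * (Im z)%:C%C).
  by rewrite -e2 -rmorphM.
rewrite /mode_exponent [hz _]/= [hz _]/= ReImE addr0 e2 e3.
set A := cexp _; have -> : A = cexp (m%:~R * tpi R) * A by rewrite cexp_tpi_int mul1r.
rewrite /A -cexpD; congr cexp; ring.
Qed.

Definition shift_factor m : R[i] :=
  b * cexp (- (('i%C * (2 * nu)%:C%C * (Im om)%:C%C + (m%:~R + delta%:C%C) * tpi R) * om)).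

Lemma shift_factor_neq0 m : shift_factor m != 0.
Proof. by rewrite mulf_neq0 ?cexp_neq0. Qed.

(** The multiplier under the translation by omega moves the index by M: this is
    where the degree of the theta functions enters. *)
Lemma mode_shift m f z : theta f ->
  mode m f (Heis (z + om) 0) = shift_factor m * mode (m + M%:Z) f (Heis z 0).
Proof.
move=> [[sf H _ hb] _].
rewrite /shift_factor; move: hb nuE; move: om => o hb nuE'.
have := hb (Heis z 0); rewrite trans_act /= => E.
have F := central_character sf H (Heis (o + z) (0 + 2 * Im (o * z^*%C))).
rewrite /= in F.
have e : f (Heis (o + z) 0) = cexp (- ('i%C * (nu * (2 * Im (o * z^*%C)))%:C%C)) *
     f (Heis (o + z) (0 + 2 * Im (o * z^*%C))).
  by rewrite F mulrA -cexpD add0r addNr cexp0 mul1r.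
have comm (u v s t : R[i]) : u * (v * s) * t = v * (u * t) * s by ring.
have comm2 (u v s t : R[i]) : u * v * (s * t) = u * (v * t) * s by ring.
rewrite /mode addrC e E; apply: (etrans (comm _ _ _ _)).
apply: (etrans _ (esym (comm2 _ _ _ _))).
congr (_ * _ * _); rewrite -!cexpD; congr cexp.
have MT : (M%:R * tpi R : R[i]) = 2 * ('i%C * (2 * nu)%:C%C * (Im o)%:C%C).
  have -> : (M%:R : R[i]) = (M%:R)%:C%C by rewrite rmorph_nat.
  have -> : (2 : R[i]) = (2 : R)%:C%C by rewrite rmorphMn.
  apply: complexP; rewrite !ReImE /tpi /=; first by ring.
  have -> : M%:R * (2 * pi) = 2 * (pi * M%:R) :> R by ring.
  by rewrite -nuE'; ring.
have e2 k : ((2 * k)%:C%C : R[i]) = 2 * k%:C%C by rewrite rmorphM rmorphMn.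
have e3 : ((nu * (2 * Im (o * z^*%C)))%:C%C : R[i]) =
   nu%:C%C * (2 * ((Im o)%:C%C * (Re z)%:C%C - (Re o)%:C%C * (Im z)%:C%C)).
  rewrite -!rmorphM -rmorphN -rmorphD -e2 -rmorphM; congr (_%:C%C).
  by rewrite !ReImE; ring.
have e4 : ((Im (o + z))%:C%C : R[i]) = (Im o)%:C%C + (Im z)%:C%C.
  by rewrite -rmorphD; congr (_%:C%C); rewrite ImD.
have hzE (w : R[i]) : hz (Heis w 0) = w by [].
rewrite /mode_exponent !hzE e3 e4 intrD [_ + M%:~R]addrC -[(M%:Z)%:~R]/(M%:R).
have -> : (M%:R + m%:~R + delta%:C%C) * tpi R * z =
  M%:R * tpi R * z + (m%:~R + delta%:C%C) * tpi R * z by ring.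
rewrite MT !e2.
have zE := complexE z; have oE := complexE o.
move: zE oE; move: (Re z) (Im z) (Re o) (Im o) => x y p h zE oE.
have i2 : 'i%C * 'i%C = -1 :> R[i] by rewrite -expr2 sqr_i.
rewrite zE oE; ring: i2.
Qed.

Definition mode_coef m f : R[i] := intC (fun x => mode m f (Heis x%:C%C 0)).

Lemma continuous_mode_line m f w : smooth f ->
  continuous (fun x : R => mode m f (Heis (x%:C%C + w) 0) : R[i]^o).
Proof. by move=> sf; exact: (@continuous_plane_path _ _ (smooth_cont (smooth_mode m sf))). Qed.

Lemma continuous_mode_line0 m f : smooth f ->
  continuous (fun x : R => mode m f (Heis x%:C%C 0) : R[i]^o).
Proof.
move=> sf.
have -> : (fun x : R => mode m f (Heis x%:C%C 0) : R[i]^o) =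
   fun x => mode m f (Heis (x%:C%C + 0) 0) by apply/funext => x; rewrite addr0.
exact: continuous_mode_line.
Qed.

Lemma intC_mode m f w : theta f ->
  intC (fun x => mode m f (Heis (x%:C%C + w) 0)) = mode_coef m f.
Proof.
move=> tf; have [[sf _ _ _] _] := tf.
apply: (@intC_holomorphic (mode m f) w) => [|p|z]; first exact: smooth_mode.
  exact: mode_holomorphic.
exact: mode_periodic.
Qed.

Lemma mode_coef_shift m f : theta f ->
  mode_coef m f = shift_factor m * mode_coef (m + M%:Z) f.
Proof.
move=> tf; have [[sf _ _ _] _] := tf.
rewrite -(intC_mode m om tf) /mode_coef.
rewrite -(intCZ (shift_factor m) (contI_T (@continuous_mode_line0 (m + M%:Z) f sf))).
by apply: eq_intC => x _; rewrite mode_shift.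
Qed.

(** The coefficients of f along every horizontal line are multiples of the same
    numbers, by Cauchy's theorem; hence f vanishes on all these lines. *)
Lemma mode_coef_eq0 f : theta f -> (forall m, mode_coef m f = 0) -> f = fun=> 0.
Proof.
move=> tf H; have [[sf Hc _ _] _] := tf.
suff f0 z : f (Heis z 0) = 0.
  by apply/funext => p; rewrite (central_character sf Hc p) f0 mulr0.
pose w : R[i] := z - (2^-1)%:C%C.
pose F (x : R) : R[i]^o := mode 0 f (Heis (x%:C%C + w) 0).
have dF x : cdrv F x (hderive (dirx R) (mode 0 f) (Heis (x%:C%C + w) 0)).
  have h := hdrv_at (smooth_hdrv (@cdx R) (smooth_mode 0 sf)) (Heis w 0) x.
  have E s : hline (dirx R) (Heis w 0) s = Heis (s%:C%C + w) 0.
    by apply: heisP; rewrite ?hz_hline ?ht_hline /dirx; cbn [fst snd hz ht];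
      rewrite ?mulr1 ?mulr0 ?addr0 // addrC.
  by apply: cdrv_ext (cdrv_eq h _) => [s|]; rewrite E.
have cF m : coef F m = 0.
  have -> : coef F m = intC (fun x => cexp (m%:~R * tpi R * w) * mode m f (Heis (x%:C%C + w) 0)).
    apply: eq_intC => x _; rewrite /F /mode /ee -mulrA -cexpD.
    have comm (u v t : R[i]) : v * (u * t) = u * (v * t) by ring.
    apply: (etrans _ (comm _ _ _)); congr (_ * _); rewrite -cexpD; congr cexp.
    rewrite /mode_exponent [hz _]/= intrN; ring.
  have -> := intCZ (cexp (m%:~R * tpi R * w)) (contI_T (@continuous_mode_line m f w sf)).
  by rewrite intC_mode // H mulr0.
have half : (0 : R) < (2^-1 : R) < 1 by rewrite invr_gt0 ltr0n invf_lt1 ?ltr1n ?ltr0n.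
have := fourier_unique dF cF half; rewrite /F /w addrC subrK /mode.
move=> K; apply: (mulIf (cexp_neq0 (mode_exponent 0 (Heis z 0)))).
by rewrite mul0r; exact: K.
Qed.

Lemma mode_coef_all f : theta f -> (forall j, (j < M)%N -> mode_coef j%:Z f = 0) ->
  forall m, mode_coef m f = 0.
Proof.
move=> tf H.
have up m : mode_coef m f = 0 -> mode_coef (m + M%:Z) f = 0.
  move=> m0; have := mode_coef_shift m tf; rewrite m0 => /esym/eqP.
  by rewrite mulf_eq0 (negPf (shift_factor_neq0 m)) => /eqP.
have down m : mode_coef (m + M%:Z) f = 0 -> mode_coef m f = 0.
  by move=> m0; rewrite (mode_coef_shift m tf) m0 mulr0.
move=> m; have M1 : M%:Z != 0 by rewrite -lt0n.
have mod0 : mode_coef (m %% M)%Z f = 0.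
  have mg := modz_ge0 m M1; rewrite -(gez0_abs mg); apply: H.
  by rewrite -ltz_nat gez0_abs // ltz_pmod.
rewrite (divz_eq m M) addrC; elim/int_ind: (m %/ M)%Z => [|n IH|n IH].
- by rewrite mul0r addr0.
- by rewrite intS mulrDl mul1r [_ + (_ * _)]addrC addrA; exact: up.
- apply: down.
  have -> // : (m %% M)%Z + - n.+1%:Z * M%:Z + M%:Z = (m %% M)%Z + - n%:Z * M%:Z.
  by rewrite intS; ring.
Qed.

Lemma theta_0 : theta (0 : fct).
Proof.
have s0 : smooth (0 : fct) by exact: smooth_cst.
have [_ _ ZZ] := derivation_Zbar R; have [_ _ TZ] := derivation_T R.
have E : (0 : fct) = fun p => 0 * (0 : fct) p by apply/funext => p; rewrite mul0r.
split; last by rewrite E ZZ //; apply/funext => p; rewrite mul0r.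
have I0 x c : inv_by x c (0 : fct) by move=> p; exact: esym (mulr0 c).
split; [exact: s0| |exact: I0|exact: I0].
by move=> p; rewrite {1}E TZ // mul0r; exact: esym (mulr0 _).
Qed.

Lemma theta_D f g : theta f -> theta g -> theta (f + g : fct).
Proof.
move=> [[sf Hf fa fb] Zf] [[sg Hg ga gb] Zg].
have [ZD _ _] := derivation_Zbar R; have [TD _ _] := derivation_T R.
split; last by apply: (etrans (ZD _ _ sf sg)); rewrite Zf Zg; apply/funext => p; rewrite addr0.
split; first exact: smoothD.
- move=> p; have /(congr1 (fun u => u p)) E := TD _ _ sf sg.
  by apply: (etrans E); rewrite Hf Hg -mulrDr.
- move=> p; apply: (etrans (congr2 (fun u v : R[i] => u + v) (fa p) (ga p))).
  exact: esym (mulrDr _ _ _).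
- move=> p; apply: (etrans (congr2 (fun u v : R[i] => u + v) (fb p) (gb p))).
  exact: esym (mulrDr _ _ _).
Qed.

Lemma theta_scale c f : theta f -> theta (c *: f : fct).
Proof.
move=> [Q Zf]; have [sf _ _ _] := Q; split; first exact: (quasi_scale c Q).
have [_ _ ZZ] := derivation_Zbar R.
by apply: (etrans (ZZ c f sf)); rewrite Zf; apply/funext => p; rewrite mulr0.
Qed.

Lemma theta_sum (I : finType) (c : I -> R[i]) (F : I -> fct) :
  (forall i, theta (F i)) -> theta (\sum_i c i *: F i : fct).
Proof.
move=> H; elim/big_ind: _ => [|f g|i _]; [exact: theta_0|exact: theta_D|].
exact: theta_scale.
Qed.

Lemma mode_coef_sum m (I : finType) (c : I -> R[i]) (F : I -> fct) :
  (forall i, theta (F i)) ->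
  mode_coef m (\sum_i c i *: F i : fct) = \sum_i c i * mode_coef m (F i).
Proof.
move=> H.
have cF i : contI (fun x => c i * mode m (F i) (Heis x%:C%C 0)).
  have [[sf _ _ _] _] := H i.
  exact: (contIM (contI_cst (c i)) (contI_T (@continuous_mode_line0 m _ sf))).
have [_ E] := intC_sum (index_enum I) (P := xpredT) (fun i _ => cF i).
rewrite /mode_coef; apply: etrans (etrans E _).
  apply: eq_intC => x _; rewrite /mode.
  have -> : (\sum_i c i *: F i : fct) (Heis x%:C%C 0) = \sum_i c i * F i (Heis x%:C%C 0).
    by elim/big_ind2: _ => // f1 c1 f2 c2 <- <-.
  by rewrite mulr_suml; apply: eq_bigr => i _; exact: (esym (@mulrA R[i] (c i) (F i _) _)).
apply: eq_bigr => i _; have [[sf _ _ _] _] := H i.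
exact: (intCZ (c i) (contI_T (@continuous_mode_line0 m _ sf))).
Qed.

(** The matrix of M consecutive coefficients of more than M theta functions has a
    nontrivial left kernel, and those coefficients determine all the others. *)
Theorem theta_dependent (I : finType) (F : I -> fct) : (M < #|I|)%N ->
  (forall i, theta (F i)) ->
  exists c : I -> R[i], (exists i, c i != 0) /\ \sum_i c i *: F i = 0.
Proof.
move=> MI tF.
pose A : 'M[R[i]]_(#|I|, M) := \matrix_(i, j) mode_coef (j : nat)%:Z (F (enum_val i)).
have kn : kermx A != 0.
  by rewrite -mxrank_eq0 mxrank_ker -lt0n subn_gt0 (leq_ltn_trans (rank_leq_col A)).
have [v vA v0] : exists2 v : 'rV_#|I|, v *m A = 0 & v != 0.
  have /rowV0Pn[v /sub_kermxP vA v0] := kn; by exists v.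
exists (fun i => v 0 (enum_rank i)); split.
  have /rV0Pn[j vj] := v0; by exists (enum_val j); rewrite enum_valK.
apply: (mode_coef_eq0 (theta_sum _ tF)); apply: mode_coef_all; first exact: theta_sum.
move=> j jM; rewrite mode_coef_sum //.
have := congr1 (fun B : 'rV_M => B 0 (Ordinal jM)) vA; rewrite !mxE => K; apply: etrans K.
rewrite (reindex (fun k : 'I_#|I| => enum_val k)) /=; last first.
  by apply: onW_bij; exact: enum_val_bij.
by apply: eq_bigr => i _; rewrite enum_valK !mxE.
Qed.

End ThetaBound.

(** * Series with geometric bounds *)

Section Series.
Variable R : realType.
Local Notation Re := (@complex.Re R).
Local Notation Im := (@complex.Im R).
Implicit Types (u v : nat -> R) (t : nat -> R[i]) (A B q : R).

Definition rsum u : R := limn (series u).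

Lemma geo_cvg u A q : 0 <= q < 1 -> (forall k, `|u k| <= A * q ^+ k) ->
  cvgn (series u) /\ `|rsum u| <= A / (1 - q).
Proof.
move=> /andP[q0 q1] H.
have nq : `|q| < 1 by rewrite ger0_norm.
have cg := @is_cvg_geometric_series R A q nq.
have A0 : 0 <= A by have := H 0%N; rewrite expr0 mulr1; exact: le_trans.
have cn : cvgn [normed series u].
  apply: (@series_le_cvg R (fun k => `|u k|) (geometric A q)) => // k.
  by rewrite /= mulr_ge0 // exprn_ge0.
have cu := normed_cvg cn; split => //.
apply: (le_trans (lim_series_norm cn)).
have <- : limn (series (geometric A q)) = A / (1 - q).
  by apply/cvg_lim => //; exact: cvg_geometric_series.
exact: lim_series_le.
Qed.

Lemma rsumD u v : cvgn (series u) -> cvgn (series v) ->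
  rsum (fun k => u k + v k) = rsum u + rsum v.
Proof. by move=> cu cv; exact: (lim_seriesD cu cv). Qed.

Lemma rsumZ (c : R) u : cvgn (series u) -> rsum (fun k => c * u k) = c * rsum u.
Proof. by move=> cu; exact: (lim_seriesZ c cu). Qed.

Definition geo t A q := forall k, cmod (t k) <= A * q ^+ k.
Definition csum t : R[i] := Complex (rsum (fun k => Re (t k))) (rsum (fun k => Im (t k))).

Lemma geo_Re t A q : geo t A q -> forall k, `|Re (t k)| <= A * q ^+ k.
Proof. by move=> H k; exact: le_trans (Re_le_cmod _) (H k). Qed.

Lemma geo_Im t A q : geo t A q -> forall k, `|Im (t k)| <= A * q ^+ k.
Proof. by move=> H k; exact: le_trans (Im_le_cmod _) (H k). Qed.

Lemma csumD t t' A q B q' : 0 <= q < 1 -> 0 <= q' < 1 -> geo t A q -> geo t' B q' ->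
  csum (fun k => t k + t' k) = csum t + csum t'.
Proof.
move=> q1 q1' h h'.
have [c1 _] := geo_cvg q1 (geo_Re h); have [c2 _] := geo_cvg q1 (geo_Im h).
have [d1 _] := geo_cvg q1' (geo_Re h'); have [d2 _] := geo_cvg q1' (geo_Im h').
apply: complexP; rewrite !ReImE /csum /=.
  by rewrite -rsumD //; congr rsum; apply/funext => k; exact: ReD.
by rewrite -rsumD //; congr rsum; apply/funext => k; exact: ImD.
Qed.

Lemma csumZ (c : R[i]) t A q : 0 <= q < 1 -> geo t A q ->
  csum (fun k => c * t k) = c * csum t.
Proof.
move=> q1 h.
have [c1 _] := geo_cvg q1 (geo_Re h); have [c2 _] := geo_cvg q1 (geo_Im h).
have cZ (a : R) u : cvgn (series u) -> cvgn (series (fun k => a * u k)).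
  by move=> cu; exact: (@is_cvg_seriesZ R _ a cu).
apply: complexP; rewrite !ReImE /csum /=.
  rewrite -mulNr -!rsumZ // -rsumD //; [|exact: cZ|exact: cZ].
  by congr rsum; apply/funext => k; rewrite ReM mulNr.
rewrite -!rsumZ // -rsumD //; [|exact: cZ|exact: cZ].
by congr rsum; apply/funext => k; rewrite ImM.
Qed.

(** The triangle inequality for an infinite sum. *)
Lemma cmod_csum t A q : 0 <= q < 1 -> geo t A q -> cmod (csum t) <= A / (1 - q).
Proof.
move=> q1 h.
have A0 : 0 <= A / (1 - q).
  have := le_trans (cmod_ge0 _) (h 0%N); rewrite expr0 mulr1 => A0.
  by rewrite divr_ge0 // subr_ge0; case/andP: q1 => _ /ltW.
have [z0|z0] := eqVneq (cmod (csum t)) 0; first by rewrite z0.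
(* Rotating the sum onto the positive half-line reduces to real parts. *)
pose c := (csum t)^*%C * ((cmod (csum t))^-1)%:C%C.
have c1 : cmod c = 1.
  have J : cmod (csum t)^*%C = cmod (csum t) by rewrite /cmod; case: (csum t) => x y /=; rewrite sqrrN.
  by rewrite /c cmodM J cmod_real ger0_norm ?invr_ge0 ?cmod_ge0 // mulfV.
have hc : geo (fun k => c * t k) A q by move=> k; rewrite cmodM c1 mul1r.
have E : (cmod (csum t))%:C%C = csum (fun k => c * t k).
  rewrite (csumZ _ q1 h) /c mulrAC [_^*%C * _]mulrC -cmod_sqrE -rmorphM expr2 mulfK //.
have -> : cmod (csum t) = Re (csum (fun k => c * t k)) by rewrite -E.
by apply: le_trans (ler_norm _) _; have [_] := geo_cvg q1 (geo_Re hc).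
Qed.

Lemma series_shift u : cvgn (series u) -> cvgn (series (fun k => u k.+1)) ->
  rsum u = u 0%N + rsum (fun k => u k.+1).
Proof.
move=> cu cv; rewrite /rsum.
have : series u n.+1 @[n --> \oo] --> u 0%N + limn (series (fun k => u k.+1)).
  have -> : (fun n => series u n.+1) = (fun n => u 0%N + series (fun k => u k.+1) n).
    apply/funext => n; rewrite /series /= !big_mkord big_ord_recl; congr (_ + _).
  by apply: cvgD; [exact: cvg_cst|exact: cv].
have : series u n.+1 @[n --> \oo] --> limn (series u).
  by have := cu; rewrite -(cvg_shiftS (series u)).
by move=> h1 h2; exact: (cvg_unique _ h1 h2).
Qed.

Lemma csum_head t A q : 0 <= q < 1 -> geo t A q ->
  csum t = t 0%N + csum (fun k => t k.+1).
Proof.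
move=> q1 h.
have h1 : geo (fun k => t k.+1) (A * q) q by move=> k; rewrite -mulrA -exprS.
have [c1 _] := geo_cvg q1 (geo_Re h); have [c2 _] := geo_cvg q1 (geo_Im h).
have [d1 _] := geo_cvg q1 (geo_Re h1); have [d2 _] := geo_cvg q1 (geo_Im h1).
apply: complexP; rewrite !ReImE /csum /=.
  exact: (series_shift (u := fun k => Re (t k))).
exact: (series_shift (u := fun k => Im (t k))).
Qed.

(** The remainder of the first-order expansion of each term is bounded by the
    second derivative, and these bounds are summable. *)
Lemma rsum_deriv (u u' u'' : nat -> R -> R) A q : 0 <= q < 1 ->
  (forall k (s : R), is_derive s 1 (u k) (u' k s)) ->
  (forall k (s : R), is_derive s 1 (u' k) (u'' k s)) ->
  (forall k s, `|s| <= 1 -> `|u k s| <= A * q ^+ k) ->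
  (forall k s, `|s| <= 1 -> `|u' k s| <= A * q ^+ k) ->
  (forall k s, `|s| <= 1 -> `|u'' k s| <= A * q ^+ k) ->
  is_derive (0 : R) 1 (fun s => rsum (u^~ s)) (rsum (u'^~ 0)).
Proof.
move=> q1 d1 d2 b0 b1 b2; apply: is_derive_eps => e e0.
have z1 : `|0 : R| <= 1 by rewrite normr0.
have A0 : 0 <= A.
  by have := b0 0%N 0 z1; rewrite expr0 mulr1; exact: le_trans.
have q2 : 0 < 1 - q by case/andP: q1 => _; rewrite subr_gt0.
set K := A / (1 - q) + 1.
have K0 : 0 < K by rewrite ltr_wpDl // divr_ge0 // ltW.
exists (Num.min 1 (e / K)); first by rewrite lt_min ltr01 divr_gt0.
move=> s; rewrite lt_min => /andP[s1 sK]; rewrite add0r.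
have s1' := ltW s1.
have [c0 _] := geo_cvg q1 (fun k => b0 k 0 z1).
have [cs _] := geo_cvg q1 (fun k => b0 k s s1').
have [c1 _] := geo_cvg q1 (fun k => b1 k 0 z1).
have cN (a : R) v : cvgn (series v) -> cvgn (series (fun k => a * v k)).
  by move=> cu; exact: (@is_cvg_seriesZ R _ a cu).
have cD v w : cvgn (series v) -> cvgn (series w) -> cvgn (series (fun k => v k + w k)).
  by move=> cu cv; exact: (is_cvg_seriesD cu cv).
have E : rsum (u^~ s) - rsum (u^~ 0) - rsum (u'^~ 0) * s =
   rsum (fun k => (u k s + (-1) * u k 0) + (- s) * u' k 0).
  rewrite rsumD; [|exact: cD _ _ cs (cN _ _ c0)|exact: cN].
  rewrite rsumD //; last exact: cN.
  by rewrite !rsumZ //; ring.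
rewrite E.
have bd k : `|(u k s + (-1) * u k 0) + (- s) * u' k 0| <= (A * s ^+ 2) * q ^+ k.
  have [x xs E1] := MVT_abs (d1 k) s; have [y ys E2] := MVT_abs (d2 k) x.
  have -> : u k s + (-1) * u k 0 + (- s) * u' k 0 = u'' k y * x * s.
    by rewrite -E2 mulrBl -E1; ring.
  have -> : s ^+ 2 = `|s| * `|s| by rewrite -normrM -expr2 ger0_norm // sqr_ge0.
  rewrite !normrM -mulrA.
  have -> : A * (`|s| * `|s|) * q ^+ k = (A * q ^+ k) * (`|s| * `|s|) by ring.
  apply: ler_pM; rewrite ?mulr_ge0 //.
    exact: (b2 k y (le_trans ys (le_trans xs s1'))).
  by rewrite ler_wpM2r.
have [_ /le_trans] := geo_cvg q1 bd; apply.
rewrite mulrAC -(ger0_norm (sqr_ge0 s)) normrX expr2 mulrA ler_wpM2r //.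
have : `|s| * K <= e by rewrite -ler_pdivlMr // ltW.
apply: le_trans; rewrite mulrC ler_wpM2l // /K lerDl //.
Qed.

Lemma csum_deriv (t t' t'' : nat -> R -> R[i]) A q : 0 <= q < 1 ->
  (forall k s, cdrv (t k) s (t' k s)) -> (forall k s, cdrv (t' k) s (t'' k s)) ->
  (forall s, `|s| <= 1 -> geo (t^~ s) A q) ->
  (forall s, `|s| <= 1 -> geo (t'^~ s) A q) ->
  (forall s, `|s| <= 1 -> geo (t''^~ s) A q) ->
  cdrv (fun s => csum (t^~ s)) 0 (csum (t'^~ 0)).
Proof.
move=> q1 d1 d2 b0 b1 b2; split => /=.
  apply: (@rsum_deriv (fun k s => Re (t k s)) (fun k s => Re (t' k s)) (fun k s => Re (t'' k s)) A q q1).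
  - by move=> k s; case: (d1 k s).
  - by move=> k s; case: (d2 k s).
  - by move=> k s /b0 /geo_Re.
  - by move=> k s /b1 /geo_Re.
  - by move=> k s /b2 /geo_Re.
apply: (@rsum_deriv (fun k s => Im (t k s)) (fun k s => Im (t' k s)) (fun k s => Im (t'' k s)) A q q1).
- by move=> k s; case: (d1 k s).
- by move=> k s; case: (d2 k s).
- by move=> k s /b0 /geo_Im.
- by move=> k s /b1 /geo_Im.
- by move=> k s /b2 /geo_Im.
Qed.

(** Two-sided sums over the integers, summed by pairing k with - k - 1. *)
Definition fold_int (t : int -> R[i]) (k : nat) : R[i] := t k%:Z + t (- k%:Z - 1).
Definition zsum (t : int -> R[i]) : R[i] := csum (fold_int t).

Definition zgeo (t : int -> R[i]) A q := forall m, cmod (t m) <= A * q ^+ absz m.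

Lemma zgeo_fold (t : int -> R[i]) A q : 0 <= q < 1 -> zgeo t A q -> geo (fold_int t) (A + A) q.
Proof.
move=> /andP[q0 q1] H k; apply: (le_trans (ler_cmodD _ _)); rewrite mulrDl; apply: lerD.
  exact: H.
have A0 : 0 <= A by have := le_trans (cmod_ge0 _) (H 0); rewrite expr0 mulr1.
apply: (le_trans (H _)); rewrite -opprD abszN -(addrC 1) absz_nat exprS.
rewrite mulrCA; apply: ler_piMl; last exact: ltW.
by rewrite mulr_ge0 // exprn_ge0.
Qed.

Lemma zsumZ (c : R[i]) (t : int -> R[i]) A q : 0 <= q < 1 -> zgeo t A q ->
  zsum (fun m => c * t m) = c * zsum t.
Proof.
move=> q1 h; rewrite /zsum -(csumZ c q1 (zgeo_fold q1 h)).
by congr csum; apply/funext => k; rewrite /fold_int mulrDr.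
Qed.

Lemma cmod_zsum (t : int -> R[i]) A q : 0 <= q < 1 -> zgeo t A q -> cmod (zsum t) <= (A + A) / (1 - q).
Proof. by move=> q1 h; exact: cmod_csum (zgeo_fold q1 h). Qed.

Lemma zsum_head (t : int -> R[i]) A q : 0 <= q < 1 -> zgeo t A q ->
  zsum t = t 0 + csum (fun k => t k.+1%:Z + t (- k.+1%:Z)).
Proof.
move=> q1 h.
have h1 : geo (fun k => t k%:Z) A q by move=> k; exact: h.
have h2 : geo (fun k => t (- k%:Z - 1)) (A * q) q.
  by move=> k; rewrite -mulrA -exprS; have := h (- k%:Z - 1); rewrite -opprD abszN -(addrC 1) absz_nat.
have h3 : geo (fun k => t k.+1%:Z) (A * q) q by move=> k; rewrite -mulrA -exprS; exact: (h1 k.+1).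
rewrite /zsum (csumD q1 q1 h1 h2) (csum_head q1 h1) -addrA; congr (_ + _).
rewrite -(csumD q1 q1 h3 h2); congr csum; apply/funext => k; congr (_ + t _).
by rewrite intS opprD addrC.
Qed.

(** Both halves of the sum converge, and the shift moves one term from one half
    to the other. *)
Lemma zsum_shift (t : int -> R[i]) A q : 0 <= q < 1 -> zgeo t A q ->
  zsum (fun m => t (m + 1)) = zsum t.
Proof.
move=> q1 h.
have h1 : geo (fun k => t k.+1%:Z) (A * q) q.
  by move=> k; rewrite -mulrA -exprS; exact: (h k.+1%:Z).
have h2 : geo (fun k => t (- k%:Z)) A q by move=> k; have := h (- k%:Z); rewrite abszN.
have h3 : geo (fun k => t (- k.+1%:Z)) (A * q) q.
  by move=> k; rewrite -mulrA -exprS; exact: (h2 k.+1).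
rewrite (zsum_head q1 h) /zsum.
have -> : fold_int (fun m => t (m + 1)) = fun k => t k.+1%:Z + t (- k%:Z).
  apply/funext => k; rewrite /fold_int; congr (t _ + t _); first by rewrite intS addrC.
  by rewrite subrK.
rewrite (csumD q1 q1 h1 h2) (csumD q1 q1 h1 h3) (csum_head q1 h2).
by rewrite addrCA oppr0.
Qed.

End Series.

(** * Entire Fourier series *)

Section FourierSeries.
Variable R : realType.
Local Notation Re := (@complex.Re R).
Local Notation Im := (@complex.Im R).
Local Notation om := (cstar_val (omega R)).
Local Notation fct := (heis R -> R[i]^o).
Implicit Types (p q : heis R) (z w : R[i]) (c : int -> R[i]) (m : int).

Local Notation absr m := ((absz m)%:R : R).

(* Coefficients decaying faster than any exponential. *)
Definition fast c := forall K : R, 0 <= K ->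
  exists B : R, forall m, cmod (c m) <= B * expR (- K * absr m).

Definition dcoef c m : R[i] := m%:~R * tpi R * c m.

Lemma cmod_tpi : cmod (tpi R) = 2 * pi.
Proof.
rewrite /cmod /tpi /= expr0n add0r sqrtr_sqr; apply: ger0_norm.
by apply: mulr_ge0 => //; exact: pi_ge0.
Qed.

Lemma cmod_int m : cmod (m%:~R : R[i]) = absr m.
Proof.
have -> : (m%:~R : R[i]) = (m%:~R : R)%:C%C by rewrite rmorph_int.
by rewrite cmod_real -intr_norm -abszE.
Qed.

Lemma fast_dcoef c : fast c -> fast (dcoef c).
Proof.
move=> fc K K0; have [B HB] := fc (K + 1) (addr_ge0 K0 ler01).
have pi0 := pi_ge0 R.
exists (2 * pi * B) => m; rewrite /dcoef !cmodM cmod_int cmod_tpi.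
have B0 : 0 <= B.
  by have := le_trans (cmod_ge0 _) (HB 0); rewrite pmulr_lge0 // expR_gt0.
apply: (@le_trans _ _ (absr m * (2 * pi) * (B * expR (- (K + 1) * absr m)))).
  by rewrite ler_wpM2l // !mulr_ge0.
have -> : - (K + 1) * absr m = - K * absr m + - absr m by ring.
rewrite expRD.
have -> : absr m * (2 * pi) * (B * (expR (- K * absr m) * expR (- absr m))) =
  (absr m * expR (- absr m)) * (2 * pi * B * expR (- K * absr m)) by ring.
rewrite ler_piMl ?mulr_ge0 ?expR_ge0 //.
rewrite expRN ler_pdivrMr ?expR_gt0 // mul1r.
by apply: le_trans (expR_ge1Dx _); rewrite lerDr.
Qed.

Definition fterm c z m : R[i] := c m * cexp (m%:~R * tpi R * z).

Lemma half_itv : (0 : R) <= (2^-1 : R) < 1.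
Proof. by rewrite invr_ge0 ler0n invf_lt1 ?ltr1n ?ltr0n. Qed.

(** The terms grow at most exponentially in the index for bounded z, and the
    decay of the coefficients beats any exponential; 1/2 stands for any rate below 1. *)
Lemma fterm_geo c (Y : R) : fast c -> 0 <= Y ->
  exists A, forall z, cmod z <= Y -> zgeo (fterm c z) A 2^-1.
Proof.
move=> fc Y0; have pi0 := pi_ge0 R.
have K0 : 0 <= 2 * pi * Y + 1 by rewrite addr_ge0 // !mulr_ge0.
have [B HB] := fc _ K0; exists B => z zY m.
have B0 : 0 <= B.
  by have := le_trans (cmod_ge0 _) (HB 0); rewrite pmulr_lge0 // expR_gt0.
rewrite /fterm cmodM cmod_cexp.
apply: (@le_trans _ _ ((B * expR (- (2 * pi * Y + 1) * absr m)) * expR (2 * pi * Y * absr m))).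
  apply: ler_pM; rewrite ?cmod_ge0 ?expR_ge0 // ler_expR.
  apply: (le_trans (ler_norm _)); apply: (le_trans (Re_le_cmod _)).
  rewrite !cmodM cmod_int cmod_tpi.
  have -> : 2 * pi * Y * absr m = absr m * (2 * pi) * Y by ring.
  by rewrite ler_wpM2l // !mulr_ge0.
rewrite -mulrA -expRD.
have -> : - (2 * pi * Y + 1) * absr m + 2 * pi * Y * absr m = (absz m)%:R * (-1) by ring.
rewrite ler_wpM2l // expRM_natl lerXn2r ?nnegrE ?expR_ge0 ?invr_ge0 //.
rewrite expRN lef_pV2 ?posrE ?expR_gt0 //.
by have := expR_ge1Dx (1 : R); rewrite -[2]/(1 + 1).
Qed.

Definition Fser c : fct := fun p => zsum (fterm c (hz p)).

Lemma cdrv_fterm c z v m s : cdrv (fun s => fterm c (z + s%:C%C * v) m) s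
  (v * fterm (dcoef c) (z + s%:C%C * v) m).
Proof.
have h1 := cdrvD (cdrv_cst z s) (cdrvM (cdrv_id s) (cdrv_cst v s)).
have h2 := cdrvZ (c m) (cdrv_cexp (cdrvZ (m%:~R * tpi R) h1)).
by apply: cdrv_eq h2 _; rewrite /fterm /dcoef; ring.
Qed.

Lemma zgeo_le (t : int -> R[i]) (A B q : R) : 0 <= q -> A <= B -> zgeo t A q -> zgeo t B q.
Proof. by move=> q0 AB H m; apply: (le_trans (H m)); rewrite ler_wpM2r // exprn_ge0. Qed.

Lemma zgeoZ w (t : int -> R[i]) (A q : R) : zgeo t A q -> zgeo (fun m => w * t m) (cmod w * A) q.
Proof. by move=> H m; rewrite cmodM -mulrA ler_wpM2l // cmod_ge0. Qed.

Lemma zgeo_ge0 (t : int -> R[i]) (A q : R) : zgeo t A q -> 0 <= A.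
Proof. by move=> /(_ 0); rewrite expr0 mulr1; apply: le_trans; exact: cmod_ge0. Qed.

Lemma hdrv_Fser c v : fast c -> hdrv v (Fser c) (fun p => v.1 * Fser (dcoef c) p).
Proof.
move=> fc p; have fd := fast_dcoef fc; have fdd := fast_dcoef fd.
set w := v.1; set z := hz p; pose Y := cmod z + cmod w.
have Y0 : 0 <= Y by rewrite addr_ge0 // cmod_ge0.
have [A0 H0] := fterm_geo fc Y0; have [A1 H1] := fterm_geo fd Y0.
have [A2 H2] := fterm_geo fdd Y0.
have small (s : R) : `|s| <= 1 -> cmod (z + s%:C%C * w) <= Y.
  move=> s1; apply: (le_trans (ler_cmodD _ _)); rewrite lerD2l cmodM cmod_real.
  by rewrite ler_piMl // cmod_ge0.
have z1 : `|0 : R| <= 1 by rewrite normr0.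
have g0 s (s1 : `|s| <= 1) := H0 _ (small s s1).
have g1 s (s1 : `|s| <= 1) := zgeoZ w (H1 _ (small s s1)).
have g2 s (s1 : `|s| <= 1) := zgeoZ w (zgeoZ w (H2 _ (small s s1))).
have p0 := zgeo_ge0 (g0 0 z1); have p1 := zgeo_ge0 (g1 0 z1); have p2 := zgeo_ge0 (g2 0 z1).
pose A := A0 + cmod w * A1 + cmod w * (cmod w * A2).
have a0 : A0 <= A by rewrite /A -addrA lerDl addr_ge0.
have a1 : cmod w * A1 <= A by rewrite /A addrAC lerDr addr_ge0.
have a2 : cmod w * (cmod w * A2) <= A by rewrite /A lerDr addr_ge0.
have h0 : (0 : R) <= 2^-1 by rewrite invr_ge0.
pose t k s := fold_int (fterm c (z + s%:C%C * w)) k.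
pose t' k s := fold_int (fun m => w * fterm (dcoef c) (z + s%:C%C * w) m) k.
pose t'' k s := fold_int (fun m => w * (w * fterm (dcoef (dcoef c)) (z + s%:C%C * w) m)) k.
have d1 k s : cdrv (t k) s (t' k s) by apply: cdrvD; exact: cdrv_fterm.
have d2 k s : cdrv (t' k) s (t'' k s) by apply: cdrvD; apply: cdrvZ; exact: cdrv_fterm.
have b0 s : `|s| <= 1 -> geo (t^~ s) (A + A) 2^-1.
  by move=> s1; apply: (zgeo_fold half_itv); exact: zgeo_le h0 a0 (g0 s s1).
have b1 s : `|s| <= 1 -> geo (t'^~ s) (A + A) 2^-1.
  by move=> s1; apply: (zgeo_fold half_itv); exact: zgeo_le h0 a1 (g1 s s1).
have b2 s : `|s| <= 1 -> geo (t''^~ s) (A + A) 2^-1.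
  by move=> s1; apply: (zgeo_fold half_itv); exact: zgeo_le h0 a2 (g2 s s1).
have := csum_deriv half_itv d1 d2 b0 b1 b2.
move=> h; apply: (cdrv_eq h).
rewrite /Fser -/z -(zsumZ w half_itv (H1 _ _)); last by rewrite /Y lerDl cmod_ge0.
rewrite /zsum; congr csum; apply/funext => k.
by rewrite /t' rmorph0 mul0r addr0.
Qed.

(** F is controlled by the continuous map g, not by its own argument; for the series this
    avoids a metric on the group. *)
Lemma locally_lipschitz_continuous (T : topologicalType) (g F : T -> R[i]^o) :
  continuous g ->
  (forall p : T, exists2 B : R, 0 < B & forall q : T, cmod (g q - g p) <= 1 ->
     cmod (F q - F p) <= B * cmod (g q - g p)) -> continuous F.
Proof.
move=> cg K p; have [B B0 HB] := K p; apply/cvgrPdist_le => e e0.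
have ee : e = (Re e)%:C%C by rewrite RRe_real // ger0_real // ltW.
have e1 : 0 < Re e by rewrite -ltcR -ee.
pose d := Num.min 1 (Re e / B).
have d0 : 0 < d by rewrite lt_min ltr01 divr_gt0.
have dC : 0 < d%:C%C :> R[i] by rewrite ltcR.
have := cg p => /cvgrPdist_lt /(_ _ dC).
apply: filterS => q; rewrite !normCE ltcR ee lecR.
rewrite -[g p - g q]opprB cmodN lt_min => /andP[h1 h2].
rewrite -[F p - F q]opprB cmodN; apply: (le_trans (HB q (ltW h1))).
by rewrite mulrC -ler_pdivlMr // ltW.
Qed.

Lemma continuous_Fser c : fast c -> continuous (Fser c).
Proof.
move=> fc; have fd := fast_dcoef fc.
apply: (locally_lipschitz_continuous (@continuous_hz R)) => p.
have Y0 : 0 <= cmod (hz p) + 1 by rewrite addr_ge0 // cmod_ge0.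
have [A HA] := fterm_geo fd Y0.
pose B0 := (A + A) / (1 - 2^-1).
have FB q : cmod (hz q) <= cmod (hz p) + 1 -> cmod (Fser (dcoef c) q) <= B0.
  by move=> h; exact: cmod_zsum half_itv (HA _ h).
have B00 : 0 <= B0 by apply: le_trans (cmod_ge0 _) (FB p _); rewrite lerDl.
exists (2 * B0 + 1); first by rewrite ltr_wpDl // mulr_ge0.
move=> q h; pose v := (hz q - hz p, ht q - ht p).
have qE : q = hline v p 1.
  by apply: heisP; rewrite ?hz_hline ?ht_hline /v; cbn [fst snd];
    rewrite ?rmorph1 ?mul1r ?(addrC _ (_ - _)) ?subrK.
have /hdrv_hdr[hR hI] := hdrv_Fser v fc.
have bound t : `|t| <= 1 -> cmod (v.1 * Fser (dcoef c) (hline v p t)) <= cmod (hz q - hz p) * B0.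
  move=> t1; rewrite cmodM ler_wpM2l ?cmod_ge0 // FB // hz_hline.
  apply: (le_trans (ler_cmodD _ _)); rewrite lerD2l cmodM cmod_real.
  by rewrite mulr_ile1 // cmod_ge0.
have [t1 ht1 E1] := hdr_MVT hR p 1; have [t2 ht2 E2] := hdr_MVT hI p 1.
rewrite normr1 in ht1 ht2.
apply: (le_trans (cmod_le_ReIm _)); rewrite !ReD !ReN !ImD !ImN {1 2}qE.
have -> : Re (Fser c (hline v p 1)) - Re (Fser c p) =
  Re (v.1 * Fser (dcoef c) (hline v p t1)) by rewrite E1 mulr1.
have -> : Im (Fser c (hline v p 1)) - Im (Fser c p) =
  Im (v.1 * Fser (dcoef c) (hline v p t2)) by rewrite E2 mulr1.
apply: (le_trans (lerD (Re_le_cmod _) (Im_le_cmod _))).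
apply: (le_trans (lerD (bound _ ht1) (bound _ ht2))).
have := cmod_ge0 (hz q - hz p); nra.
Qed.

(** The directional derivatives of such a series are again such series, up to a constant. *)
Lemma smooth_Fser c : fast c -> smooth (Fser c).
Proof.
move=> fc n; elim: n c fc => [|n IH] c fc; first by split; [exact: continuous_Fser|].
have fd := fast_dcoef fc.
have C v : Cn n (fun p => v * Fser (dcoef c) p).
  by apply: CnM; [exact: Cn_cst|exact: IH].
apply/CnS; split; first exact: continuous_Fser.
- by eexists; [exact: (hdrv_Fser _ fc)|exact: C].
- by eexists; [exact: (hdrv_Fser _ fc)|exact: C].
- by eexists; [exact: (hdrv_Fser _ fc)|exact: C].
Qed.

Lemma Fser_period c z : Fser c (Heis (z + 1) 0) = Fser c (Heis z 0).
Proof.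
rewrite /Fser /zsum; congr csum; apply/funext => k.
have H m : fterm c (z + 1) m = fterm c z m.
  rewrite /fterm mulrDr mulr1 cexpD cexp_tpi_int mulr1 //.
by rewrite /fold_int !H.
Qed.

End FourierSeries.

(** * Theta functions of degree one *)

Section Theta.
Variable R : realType.
Local Notation Re := (@complex.Re R).
Local Notation Im := (@complex.Im R).
Local Notation om := (cstar_val (omega R)).
Local Notation h := (Im om).
Local Notation fct := (heis R -> R[i]^o).
Local Notation absr m := ((absz m)%:R : R).
Implicit Types (p : heis R) (z w : R[i]) (m : int).

(** The frequency for which the theta functions have degree one. *)
Definition nu1 : R := pi / (2 * h).

Lemma nu1_gt0 : 0 < nu1.
Proof. by rewrite divr_gt0 ?pi_gt0 // mulr_gt0 // Im_omega_gt0. Qed.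

Lemma nu1E : 2 * nu1 * h = pi * 1%:R.
Proof. by rewrite /nu1; have := Im_omega_gt0 R; move: h => x x0; field; rewrite gt_eqF. Qed.

(* The summation index m is shifted by delta; the Gaussian factor is that of a
   theta series with period omega. *)
Definition theta_exponent (delta : R) m : R[i] :=
  tpi R * (om * ((m%:~R + delta) ^+ 2 / 2)%:C%C - ((m%:~R + delta) * delta)%:C%C).
Definition thc delta m : R[i] := cexp (theta_exponent delta m).

Lemma cmod_thc delta m : cmod (thc delta m) = expR (- (pi * h * (m%:~R + delta) ^+ 2)).
Proof.
rewrite /thc cmod_cexp; congr expR; rewrite /theta_exponent.
move: (m%:~R + delta) om => x o.
have E z : Re (tpi R * z) = - (2 * pi * Im z) by rewrite ReM /tpi /= mul0r sub0r.
by rewrite E !ReImE; field.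
Qed.

Lemma fast_thc delta : fast (thc delta).
Proof.
move=> K K0; have h0 := Im_omega_gt0 R; have p0 := pi_gt0 R.
pose P := pi * h; have P0 : 0 < P by rewrite mulr_gt0.
exists (expR (K * `|delta| + K ^+ 2 / (4 * P))) => m.
rewrite cmod_thc -expRD ler_expR -/P.
have hm : absr m <= `|m%:~R + delta| + `|delta|.
  have -> : absr m = `|(m%:~R + delta) - delta| by rewrite addrK natr_absz intr_norm.
  exact: ler_normB.
have -> : (m%:~R + delta) ^+ 2 = `|m%:~R + delta| ^+ 2.
  by rewrite -normrX ger0_norm // sqr_ge0.
move: (`|m%:~R + delta|) (`|delta|) hm => x d hm.
have H1 : K * absr m <= K * x + K * d by rewrite -mulrDr ler_wpM2l.
suff : K * x <= P * x ^+ 2 + K ^+ 2 / (4 * P) by lra.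
have -> : P * x ^+ 2 + K ^+ 2 / (4 * P) = K * x + (P * x - K / 2) ^+ 2 / P.
  by field; rewrite gt_eqF.
by rewrite lerDl divr_ge0 ?sqr_ge0 // ltW.
Qed.

Lemma thc_shift delta m : thc delta (m + 1) =
  thc delta m * cexp (m%:~R * tpi R * om) *
  cexp (tpi R * (om * delta%:C%C + om / 2 - delta%:C%C)).
Proof.
rewrite /thc -!cexpD; congr cexp; rewrite /theta_exponent intrD.
have E n : (n%:~R : R[i]) = (n%:~R : R)%:C%C by rewrite rmorph_int.
have E2 : (2^-1 : R[i]) = (2^-1 : R)%:C%C by exact: half2.
rewrite E E2 -[1%:~R]/(1 : R); move: (m%:~R : R) om (tpi R) => x o t.
have -> : (((x + 1 + delta) ^+ 2 / 2)%:C%C : R[i]) =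
   ((x + delta) ^+ 2 / 2)%:C%C + (x%:C%C + delta%:C%C + (2^-1)%:C%C).
  by rewrite -!rmorphD; congr (_%:C%C); field.
have -> : (((x + 1 + delta) * delta)%:C%C : R[i]) = ((x + delta) * delta)%:C%C + delta%:C%C.
  by rewrite -rmorphD; congr (_%:C%C); ring.
ring.
Qed.

Definition sfun_exponent delta p : R[i] :=
  ('i%C * nu1%:C%C) * (ht p)%:C%C - mode_exponent nu1 delta 0 p.

(** A Gaussian factor times a theta series with characteristic delta: its
    multipliers under the translations by 1 and by omega are the same number. *)
Definition sfun delta : fct := fun p => cexp (sfun_exponent delta p) * Fser (thc delta) p.

Lemma smooth_sfun_exponent delta : smooth (sfun_exponent delta : fct).
Proof.
have -> : (sfun_exponent delta : fct) = fun p => ('i%C * nu1%:C%C) * (ht p)%:C%C +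
   (-1) * mode_exponent nu1 delta 0 p by apply/funext => p; rewrite mulN1r.
exact: (smoothD (smoothZ _ (@smooth_ht R)) (smoothZ _ (smooth_mode_exponent nu1 delta 0))).
Qed.

Lemma smooth_sfun delta : smooth (sfun delta).
Proof.
apply: smoothM; first by apply: smooth_cexp; exact: smooth_sfun_exponent.
by apply: smooth_Fser; exact: fast_thc.
Qed.

Definition sfun_drv delta v p : R[i] :=
  (('i%C * nu1%:C%C) * (v.2)%:C%C +
   ('i%C * (2 * nu1)%:C%C * ((Im v.1)%:C%C * hz p + (Im (hz p))%:C%C * v.1)
     + delta%:C%C * tpi R * v.1)) * sfun delta p +
   cexp (sfun_exponent delta p) * (v.1 * Fser (dcoef (thc delta)) p).

Lemma hderive_sfun delta v p : hderive v (sfun delta) p = sfun_drv delta v p.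
Proof.
have h1 : hdrv v (sfun_exponent delta : fct) (fun p => ('i%C * nu1%:C%C) * (v.2)%:C%C -
  (- ('i%C * (2 * nu1)%:C%C * ((Im v.1)%:C%C * hz p + (Im (hz p))%:C%C * v.1))
  - (0%:~R + delta%:C%C) * tpi R * v.1)).
  move=> q; apply: cdrvB; last exact: hdrv_mode_exponent.
  by apply: cdrvZ; exact: hdrv_ht.
have h2 := hdrvM (hdrv_cexp h1) (hdrv_Fser v (@fast_thc delta)).
rewrite (hdrvE h2) /sfun_drv /sfun.
move: (cexp _) (Fser (thc delta) p) (Fser (dcoef _) p) => A B D.
by rewrite [0%:~R]/(0 : R[i]); ring.
Qed.

Lemma central_sfun delta : central nu1 (sfun delta).
Proof.
move=> p; rewrite /Tfield hderive_sfun /sfun_drv /dirt; cbn [fst snd].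
rewrite Im0 rmorph0 rmorph1.
move: (sfun delta p : R[i]) (cexp _) (Fser _ p : R[i]) => A B D; ring.
Qed.

Lemma Zbar_sfun delta : Zbarfield (sfun delta) = fun=> 0.
Proof.
apply/funext => p; rewrite ZbarfieldE /Xfield /Yfield central_sfun !hderive_sfun.
rewrite /sfun_drv /dirx /diry; cbn [fst snd]; rewrite Im1 Imi !rmorph0 !rmorph1.
move: (sfun delta p : R[i]) (cexp _) (Fser _ p : R[i]) (tpi R) => A B D T.
have i2 : 'i%C * 'i%C = -1 :> R[i] by rewrite -expr2 sqr_i.
have e2 k : ((2 * k)%:C%C : R[i]) = 2 * k%:C%C by rewrite rmorphM rmorphMn.
rewrite !e2; have z := complexE (hz p); move: (Re (hz p)) (Im (hz p)) z => x y ->.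
ring: i2.
Qed.

Lemma sfun_trans1 delta : inv_by (trans 1) (cexp (delta%:C%C * tpi R)) (sfun delta).
Proof.
move=> p; rewrite trans_act /sfun.
have -> : Fser (thc delta) (Heis (1 + hz p) (ht p + 2 * Im (1 * (hz p)^*%C))) =
   Fser (thc delta) p by have := Fser_period (thc delta) (hz p); rewrite addrC.
rewrite mulrA -cexpD; congr (cexp _ * _); rewrite /sfun_exponent /mode_exponent.
have hzE (w : R[i]) t : hz (Heis w t) = w by [].
have htE (w : R[i]) t : ht (Heis w t) = t by [].
have e : ((ht p + 2 * Im (1 * (hz p)^*%C))%:C%C : R[i]) = (ht p)%:C%C - 2 * (Im (hz p))%:C%C.
  have -> : ht p + 2 * Im (1 * (hz p)^*%C) = ht p + (- 2) * Im (hz p).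
    by rewrite mul1r ImJ; ring.
  by rewrite rmorphD rmorphM rmorphN rmorphMn mulNr.
have e2 k : ((2 * k)%:C%C : R[i]) = 2 * k%:C%C by rewrite rmorphM rmorphMn.
have e3 : Im (1 + hz p) = Im (hz p) by rewrite ImD Im1 add0r.
rewrite htE !hzE e3 e e2 [0%:~R]/(0 : R[i]); move: (hz p) => z.
move: (tpi R) => T; ring.
Qed.

Lemma Fser_om delta z t t' : Fser (thc delta) (Heis (z + om) t) =
  cexp (- (tpi R * z)) * cexp (- (tpi R * (om * delta%:C%C + om / 2 - delta%:C%C))) *
  Fser (thc delta) (Heis z t').
Proof.
have [A HA] := fterm_geo (@fast_thc delta) (cmod_ge0 z).
have g := HA z (lexx _).
set u := cexp (- _) * cexp _.
rewrite /Fser -(zsumZ u (half_itv R) g) -(zsum_shift (half_itv R) (zgeoZ u g)).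
congr zsum; apply/funext => m; rewrite /fterm thc_shift intrD.
have comm (a b T x y w : R[i]) : a * b * (T * x * y * w) = T * (a * b * x * y * w) by ring.
rewrite /u comm; congr (_ * _); rewrite -!cexpD; congr cexp.
have hzE (w : R[i]) s : hz (Heis w s) = w by [].
rewrite !hzE; move: om => o.
by rewrite -[1%:~R]/(1 : R[i]); ring.
Qed.

(** Shifting the summation index by one compensates the translation by omega. *)
Lemma sfun_transom delta : inv_by (trans om) (cexp (delta%:C%C * tpi R)) (sfun delta).
Proof.
move=> p; rewrite trans_act /sfun [om + hz p]addrC (Fser_om delta (hz p) _ (ht p)).
have -> : Heis (hz p) (ht p) = p by case: p.
have comm (a b c F : R[i]) : a * (b * c * F) = (a * b * c) * F by rewrite !mulrA.
apply: (etrans (comm _ _ _ _)); apply: (etrans _ (esym (@mulrA R[i] _ _ _))).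
congr (_ * _); rewrite -!cexpD; congr cexp; rewrite /sfun_exponent /mode_exponent.
have hzE (w : R[i]) t : hz (Heis w t) = w by [].
have htE (w : R[i]) t : ht (Heis w t) = t by [].
rewrite htE !hzE.
have T4 : tpi R = 2 * ('i%C * (2 * nu1)%:C%C * h%:C%C).
  have -> : (2 : R[i]) = (2 : R)%:C%C by rewrite rmorphMn.
  have := nu1E; move: om => o E.
  apply: complexP; rewrite !ReImE /tpi /=; first by ring.
  have -> : 2 * pi = 2 * (pi * 1%:R) :> R by rewrite mulr1.
  by rewrite -E; ring.
have e2 k : ((2 * k)%:C%C : R[i]) = 2 * k%:C%C by rewrite rmorphM rmorphMn.
rewrite T4 !e2 [0%:~R]/(0 : R[i]).
have zE := complexE (hz p); have oE := complexE om.
have e : ((ht p + 2 * Im (om * (hz p)^*%C))%:C%C : R[i]) = (ht p)%:C%C +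
   2 * (h%:C%C * (Re (hz p))%:C%C - (Re om)%:C%C * (Im (hz p))%:C%C).
  rewrite -!rmorphM -rmorphN -rmorphD -e2 -rmorphD; congr (_%:C%C).
  by move: om => o; rewrite !ReImE; ring.
have e4 : ((Im (hz p + om))%:C%C : R[i]) = (Im (hz p))%:C%C + h%:C%C.
  by rewrite -rmorphD; congr (_%:C%C); rewrite ImD.
rewrite e e4; move: zE oE.
move: (Re (hz p)) (Im (hz p)) (Re om) (Im om) => x y a b zE oE.
have i2 : 'i%C * 'i%C = -1 :> R[i] by rewrite -expr2 sqr_i.
rewrite zE oE.
have n2 : (2 : R[i]) != 0 by rewrite pnatr_eq0.
by field: i2.
Qed.

Lemma theta_sfun delta : theta nu1 (cexp (delta%:C%C * tpi R)) delta (sfun delta).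
Proof.
split; last exact: Zbar_sfun.
by split; [exact: smooth_sfun|exact: central_sfun|exact: sfun_trans1|exact: sfun_transom].
Qed.

End Theta.

(** * Values at the origin and the action of the rotation *)

Section ThetaValues.
Variable R : realType.
Local Notation Re := (@complex.Re R).
Local Notation Im := (@complex.Im R).
Local Notation om := (cstar_val (omega R)).
Local Notation h := (Im om).
Local Notation fct := (heis R -> R[i]^o).
Local Notation absr m := ((absz m)%:R : R).
Implicit Types (p : heis R) (z w : R[i]) (m : int).

Definition nome : R := expR (- (2 / 3 * (pi * h))).

(** The bound 3 nome < 1 lets the first term dominate in the theta series below; it
    follows from pi >= 2 and h^2 = 3/4 by squaring 1 + x <= exp x four times at
    x = 1.154 / 16. *)
Lemma nome_lt : 3 * nome < 1.
Proof.
have p2 := pi_ge2 R.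
have ph : 1154 / 1000 <= 2 / 3 * (pi * h).
  have := Im_omega_gt0 R; have := Im_omega_sqr R; move: h => x x2 x0.
  (* 866 / 1000 is a lower approximation of sqrt 3 / 2. *)
  have hh : 866 / 1000 <= x by nra.
  by move: (pi : R) p2 => P P2; nra.
rewrite /nome; move: (2 / 3 * (pi * h)) ph => P ph.
rewrite expRN ltr_pdivrMr ?expR_gt0 // mul1r.
apply: (@lt_le_trans _ _ (expR (1154 / 1000))); last by rewrite ler_expR.
have -> : (1154 / 1000 : R) = 16%:R * (1154 / 16000) by field.
rewrite expRM_natl.
have := expR_ge1Dx (1154 / 16000 : R).
move: (expR (1154 / 16000)) => x e1.
have x2 : 1149 / 1000 <= x ^+ 2 by rewrite expr2; nra.
have x4 : 1320 / 1000 <= x ^+ 4 by rewrite (exprD x 2 2); nra.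
have x8 : 1742 / 1000 <= x ^+ 8 by rewrite (exprD x 4 4); nra.
by rewrite (exprD x 8 8); nra.
Qed.

Lemma nome_itv : 0 <= nome < 1.
Proof. by have := nome_lt; have := expR_gt0 (- (2 / 3 * (pi * h))); rewrite -/nome => a b; apply/andP; split; lra. Qed.

(** The first term dominates the sum of all others. *)
Lemma csum_neq0 (t : nat -> R[i]) (B q : R) : 0 <= q < 1 -> t 0%N != 0 ->
  (forall k, cmod (t k) <= cmod (t 0%N) * q ^+ k * B) -> 1 <= B ->
  B * q < 1 - q -> csum t != 0.
Proof.
move=> q1 t0 H B1 Bq.
have q2 : 0 < 1 - q by case/andP: q1 => _; rewrite subr_gt0.
have g : geo t (cmod (t 0%N) * B) q by move=> k; rewrite mulrAC.
have g1 : geo (fun k => t k.+1) (cmod (t 0%N) * (B * q)) q.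
  by move=> k; have := H k.+1; rewrite exprS => /le_trans; apply; rewrite le_eqVlt; apply/orP; left; apply/eqP; ring.
have c0 : 0 < cmod (t 0%N) by rewrite lt_def cmod_ge0 cmod_eq0 t0.
rewrite (csum_head q1 g) addrC; apply/eqP => E.
have := cmod_csum q1 g1.
have -> : csum (fun k => t k.+1) = - t 0%N by apply/eqP; rewrite -addr_eq0 E.
rewrite cmodN leNgt; apply/negP; rewrite negbK.
by rewrite ltr_pdivrMr // ltr_pM2l.
Qed.

Lemma thc_le delta m : `|delta| <= 1 / 6 -> cmod (thc delta m) <= cmod (thc delta 0) * nome ^+ absz m.
Proof.
move=> d6; rewrite !cmod_thc add0r /nome -expRM_natl -expRD ler_expR.
have P0 : 0 < pi * h by rewrite mulr_gt0 ?pi_gt0 ?Im_omega_gt0.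
move: (pi * h) P0 => P P0.
have hm : (m%:~R : R) ^+ 2 = absr m ^+ 2.
  by rewrite natr_absz intr_norm -normrX ger0_norm // sqr_ge0.
have n2 : absr m <= absr m ^+ 2.
  by rewrite -natrX ler_nat; case: (absz m) => // n; rewrite expnS leq_pmulr // expn_gt0.
have md : - (absr m * (1 / 6)) <= m%:~R * delta.
  rewrite lerNl; apply: (le_trans (ler_norm _)); rewrite normrN normrM natr_absz intr_norm.
  by rewrite ler_wpM2l.
have hs : (m%:~R + delta) ^+ 2 = absr m ^+ 2 + 2 * (m%:~R * delta) + delta ^+ 2.
  by rewrite sqrrD hm; ring.
rewrite hs -subr_ge0; move: (absr m) (m%:~R * delta) n2 md => n d n2 md.
have -> : - (P * delta ^+ 2) + n * - (2 / 3 * P) - - (P * (n ^+ 2 + 2 * d + delta ^+ 2)) =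
  P * (n ^+ 2 + 2 * d - 2 / 3 * n) by field.
by apply: mulr_ge0; [exact: ltW|lra].
Qed.

Lemma fterm0 (c : int -> R[i]) m : fterm c 0 m = c m.
Proof. by rewrite /fterm mulr0 cexp0 mulr1. Qed.

(** The terms m and - m together are at most 2 nome^|m| times the term m = 0, and
    2 nome < 1 - nome. *)
Lemma origin_neq0 delta : `|delta| <= 1 / 6 -> Fser (thc delta) (Heis 0 0 : heis R) != 0.
Proof.
move=> d6; have q1 := nome_itv; have nl := nome_lt.
have g : zgeo (fterm (thc delta) 0) (cmod (thc delta 0)) nome.
  by move=> m; rewrite fterm0; exact: thc_le.
rewrite /Fser [hz _]/= (zsum_head q1 g) fterm0; apply/eqP => E.
set t0 := thc delta 0 in g E.
have c0 : 0 < cmod t0 by rewrite lt_def cmod_ge0 cmod_eq0 cexp_neq0.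
have g1 : geo (fun k => fterm (thc delta) 0 k.+1%:Z + fterm (thc delta) 0 (- k.+1%:Z))
   (cmod t0 * (2 * nome)) nome.
  move=> k; apply: (le_trans (ler_cmodD _ _)).
  have := lerD (g k.+1%:Z) (g (- k.+1%:Z)); rewrite abszN absz_nat exprS; move/le_trans; apply.
  by rewrite le_eqVlt; apply/orP; left; apply/eqP; ring.
have := cmod_csum q1 g1.
have -> : csum (fun k => fterm (thc delta) 0 k.+1%:Z + fterm (thc delta) 0 (- k.+1%:Z)) = - t0.
  by apply/eqP; rewrite -addr_eq0 addrC E.
rewrite cmodN leNgt; apply/negP; rewrite negbK.
have q2 : 0 < 1 - nome by case/andP: q1 => _; rewrite subr_gt0.
by rewrite ltr_pdivrMr // ltr_pM2l //; lra.
Qed.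

Lemma cexp_half : cexp (tpi R / 2) = -1.
Proof.
have -> : tpi R / 2 = Complex 0 pi.
  by rewrite half2; apply: complexP; rewrite /tpi !ReImE /=; field.
by rewrite /cexp /expi /= expR0 cospi sinpi mul1r; apply: complexP; rewrite /= ?oppr0.
Qed.

Lemma thc_odd (k : nat) : thc (2^-1) (- k%:Z - 1) = - thc (2^-1 : R) k%:Z.
Proof.
have -> : - thc (2^-1 : R) k%:Z = thc (2^-1) k%:Z * cexp (tpi R / 2) * cexp (k%:~R * tpi R).
  by rewrite cexp_half cexp_tpi_int mulr1 mulrN1.
rewrite /thc -!cexpD; congr cexp; rewrite /theta_exponent half2.
have E n : (n%:~R : R[i]) = (n%:~R : R)%:C%C by rewrite rmorph_int.
rewrite !E intrD !intrN -[1%:~R]/(1 : R); move: (k%:~R : R) (tpi R) om => x t o.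
have -> : (((- x - 1 + 2^-1) ^+ 2 / 2)%:C%C : R[i]) = ((x + 2^-1) ^+ 2 / 2)%:C%C.
  by congr (_%:C%C); field.
have -> : (((- x - 1 + 2^-1) * 2^-1)%:C%C : R[i]) =
   ((x + 2^-1) * 2^-1)%:C%C - x%:C%C - (2^-1)%:C%C.
  by rewrite -!rmorphN -!rmorphD; congr (_%:C%C); field.
ring.
Qed.

(** For delta = 1/2 the terms m and - m - 1 cancel. *)
Lemma origin_odd : Fser (thc (2^-1 : R)) (Heis 0 0 : heis R) = 0.
Proof.
rewrite /Fser /zsum.
have -> : fold_int (fterm (thc (2^-1 : R)) (hz (Heis 0 0 : heis R))) = fun k => 0 * 0.
  by apply/funext => k; rewrite /fold_int [hz _]/= !fterm0 thc_odd subrr mul0r.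
have g0 : geo (fun k : nat => 0 : R[i]) 0 (2^-1 : R).
  by move=> k; rewrite cmod_real normr0 mul0r.
by rewrite (csumZ 0 (half_itv R) g0) mul0r.
Qed.

(** In the derivative the same pairs add up to (2 m + 1) times a Gaussian factor, and
    the weights 2 m + 1 <= 3^m are absorbed by nome^3. *)
Lemma origin_derivative : Fser (dcoef (thc (2^-1 : R))) (Heis 0 0 : heis R) != 0.
Proof.
have q1 := nome_itv; have nl := nome_lt.
have h0 := Im_omega_gt0 R; have p0 := pi_gt0 R.
pose c := thc (2^-1 : R).
pose r := 3 * nome ^+ 3.
have n0 : 0 <= nome by case/andP: q1.
have r9 : r < 1 / 9 by rewrite /r exprS expr2; nra.
have r0 : 0 <= r by rewrite mulr_ge0 // exprn_ge0.
have r1 : 0 <= r < 1 by rewrite r0 /=; lra.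
have bound k : cmod (((k.*2.+1)%:R : R[i]) * c k%:Z) <= cmod (c 0) * r ^+ k.
  rewrite cmodM.
  have -> : cmod ((k.*2.+1)%:R : R[i]) = (k.*2.+1)%:R.
    have -> : ((k.*2.+1)%:R : R[i]) = ((k.*2.+1)%:R)%:C%C by rewrite rmorph_nat.
    by rewrite cmod_real ger0_norm.
  have k3 : ((k.*2.+1)%:R : R) <= 3 ^+ k.
    rewrite -natrX ler_nat; elim: (k) => // j; rewrite expnS doubleS.
    by move: (3 ^ j)%N => X; lia.
  have ck : cmod (c k%:Z) <= cmod (c 0) * (nome ^+ 3) ^+ k.
    rewrite !cmod_thc add0r -exprM /nome -expRM_natl -expRD ler_expR.
    have P0 : 0 < pi * h by rewrite mulr_gt0.
    move: (pi * h) P0 => P P0.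
    rewrite natrM -[k%:~R]/(k%:R : R).
    have kk : (k%:R : R) <= k%:R ^+ 2.
      by rewrite -natrX ler_nat; case: (k) => // n; rewrite expnS leq_pmulr // expn_gt0.
    have : P * (2 * k%:R) <= P * (k%:R ^+ 2 + k%:R) by rewrite ler_wpM2l ?(ltW P0) //; lra.
    have -> : (k%:R + 2^-1) ^+ 2 = k%:R ^+ 2 + k%:R + (2^-1) ^+ 2 :> R by field.
    rewrite mulrDr; lra.
  rewrite mulrC /r exprMn.
  have -> : cmod (c 0) * (3 ^+ k * nome ^+ 3 ^+ k) = (cmod (c 0) * (nome ^+ 3) ^+ k) * 3 ^+ k.
    by ring.
  by apply: ler_pM => //; exact: cmod_ge0.
have E : Fser (dcoef c) (Heis 0 0 : heis R) = tpi R * csum (fun k => ((k.*2.+1)%:R : R[i]) * c k%:Z).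
  rewrite /Fser /zsum -(csumZ (tpi R) r1 bound); congr csum; apply/funext => k.
  rewrite /fold_int [hz _]/= !fterm0 /dcoef {2}/c thc_odd -/c.
  rewrite intrD !intrN -[k%:~R]/(k%:R : R[i]) -[1%:~R]/(1 : R[i]) -addn1 natrD -muln2 natrM.
  ring.
rewrite E mulf_neq0 ?tpi_neq0 //.
have b0 k : cmod (((k.*2.+1)%:R : R[i]) * c k%:Z) <=
    cmod (((0.*2.+1)%:R : R[i]) * c 0%:Z) * r ^+ k * 1.
  by rewrite mulr1 [(0.*2.+1)%:R]/(1 : R[i]) mul1r.
apply: (csum_neq0 r1 _ b0) => //; last by rewrite mul1r; lra.
by rewrite [(0.*2.+1)%:R]/(1 : R[i]) mul1r cexp_neq0.
Qed.

Lemma sfun_origin delta : sfun delta (Heis 0 0 : heis R) = Fser (thc delta) (Heis 0 0 : heis R).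
Proof.
rewrite /sfun; have -> : sfun_exponent delta (Heis 0 0) = 0; last by rewrite cexp0 mul1r.
by rewrite /sfun_exponent /mode_exponent [hz _]/= [ht _]/= Im0 !(rmorph0, mulr0, oppr0, subr0, addr0).
Qed.

Lemma rot_act p : sim_act (rot R) p = Heis (om * hz p) (ht p).
Proof.
have -> : sim_act (rot R) p = mu (omega R) p by rewrite /sim_act /rot mul1g.
rewrite /mu; congr Heis.
by rewrite (cmod_omega R) expr1n mul1r.
Qed.

Lemma central_shift (f : fct) nu w t s : smooth f -> central nu f ->
  f (Heis w (t + s)) = cexp ('i%C * (nu * s)%:C%C) * f (Heis w t).
Proof.
move=> sf H; rewrite (central_character sf H) [in RHS](central_character sf H) [hz _]/= [ht _]/=.
rewrite mulrA -cexpD; congr (cexp _ * _).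
by rewrite mulrDr rmorphD mulrDr addrC.
Qed.

(** The rotation permutes the translations by 1, omega and omega^2 cyclically.
    These compose to a central element which acts by - 1, so the multiplier of
    the third is a as well, because a^3 = - 1. *)
Lemma theta_rot delta f : cexp (3 * delta%:C%C * tpi R) = -1 ->
  theta (nu1 R) (cexp (delta%:C%C * tpi R)) delta f ->
  theta (nu1 R) (cexp (delta%:C%C * tpi R)) delta (fun p => f (sim_act (rot R) p)).
Proof.
set a := cexp (delta%:C%C * tpi R) => a3' [[sf H ha hb] Zf].
have a3 : a * a * a = -1 by rewrite /a -!cexpD -a3'; congr cexp; ring.
have hzE w t : hz (Heis w t : heis R) = w by [].
have htE w t : ht (Heis w t : heis R) = t by [].
have a0 : a != 0 by exact: cexp_neq0.
split; last first.
  rewrite Zbarfield_act // Zf; apply/funext => p; exact: mulr0.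
split; first exact: smooth_act.
- move=> p; rewrite Tfield_act // H [siml _]/(omega R) (cmod_omega R) expr1n rmorph1; exact: mul1r.
- move=> p; rewrite !rot_act trans_act !hzE !htE.
  have := hb (Heis (om * hz p) (ht p)); rewrite trans_act !hzE !htE => <-.
  rewrite mulrDr mulr1; congr (f (Heis _ (_ + 2 * Im _))).
  have o1 := unit_conj (cmod_omega R); move: om o1 => o o1.
  have -> : o * (o * hz p)^*%C = (o * o^*%C) * (hz p)^*%C.
    by apply: complexP; rewrite !ReImE; ring.
  by rewrite o1.
- move=> p; rewrite !rot_act trans_act !hzE !htE.
  set Q := Heis _ _.
  have E1 := ha Q; have E2 := hb (sim_act (trans 1) Q).
  rewrite E1 !trans_act !hzE !htE in E2.
  have : f (Heis (om * hz p) (ht p + 2 * h)) = a * (a * f Q).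
    rewrite -E2; congr f.
    have o1 := unit_conj (cmod_omega R); have o2 := omega_poly R.
    have o3 := Re_omega R; move: om o1 o2 o3 => o o1 o2 o3.
    have e1 : 1 + o * (o + hz p) = o * (hz p - 1).
      rewrite mulrBr mulr1; apply/eqP; rewrite -subr_eq0 -o2; apply/eqP; ring.
    have e2 : o * (o * (hz p - 1))^*%C = (hz p - 1)^*%C.
      rewrite -[RHS]mul1r -o1.
      by apply: complexP; move: (hz p - 1) => w; rewrite !ReImE; ring.
    rewrite e1 e2; congr Heis.
      by rewrite mulrBr mulr1 addrC subrK.
    by rewrite mul1r !ReImE o3; field.
  rewrite (central_shift _ _ _ sf H) => K.
  have e : cexp ('i%C * (nu1 R * (2 * h))%:C%C) = -1.
    rewrite -cexp_half; congr cexp; rewrite half2.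
    have -> : nu1 R * (2 * h) = pi by have := nu1E R; rewrite mulr1 => <-; ring.
    by apply: complexP; rewrite /tpi !ReImE /=; field.
  rewrite e in K.
  have aa : a * a != 0 by rewrite mulf_neq0.
  apply: (mulfI aa); rewrite -mulrA -K mulrA.

  by rewrite a3.
Qed.

End ThetaValues.

(** * Monomials in the theta functions of degree one *)

Section Monomials.
Variable R : realType.
Local Notation Re := (@complex.Re R).
Local Notation Im := (@complex.Im R).
Local Notation om := (cstar_val (omega R)).
Local Notation h := (Im om).
Local Notation fct := (heis R -> R[i]^o).
Implicit Types (p : heis R) (z w : R[i]) (m : int) (f g : fct).

(** The degree one case of the upper bound. *)
Lemma theta_line delta f g q : theta (nu1 R) (cexp (delta%:C%C * tpi R)) delta f ->
  theta (nu1 R) (cexp (delta%:C%C * tpi R)) delta g -> f q != 0 ->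
  exists e : R[i], forall p, g p = e * f p.
Proof.
move=> tf tg fq.
have card2 : (1 < #|{: bool}|)%N by rewrite card_bool.
have tF i : theta (nu1 R) (cexp (delta%:C%C * tpi R)) delta (if i then f else g) by case: i.
have [c [c0 E]] := @theta_dependent R 1%N (nu1 R) _ delta isT (@nu1E R) (cexp_neq0 _) bool
  (fun i => if i then f else g) card2 tF.
have E2 p : c true * f p + c false * g p = 0.
  by have := congr1 (fun F : fct => F p) E; rewrite big_bool.
have [cf|cf] := eqVneq (c false) 0.
  have := E2 q; rewrite cf mul0r addr0 => /eqP.
  rewrite mulf_eq0 (negbTE fq) orbF => /eqP ct.
  by case: c0 => -[]; rewrite ?ct ?cf eqxx.
exists (- (c false)^-1 * c true) => p; apply: (mulfI cf).
rewrite -mulrA mulNr mulrN mulrA divff // mul1r.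
by apply/eqP; rewrite -addr_eq0 addrC; apply/eqP; exact: E2.
Qed.

Lemma sfun_rot delta q : cexp (3 * delta%:C%C * tpi R) = -1 -> sfun delta q != 0 ->
  exists e, inv_by (rot R) e (sfun delta).
Proof.
move=> d3 sq; have t := theta_sfun delta.
exact: (theta_line t (theta_rot d3 t) sq).
Qed.

Lemma cexp_half_odd (n : int) : cexp (2^-1 * tpi R + n%:~R * tpi R) = -1.
Proof. by rewrite cexpD cexp_tpi_int mulr1 mulrC cexp_half. Qed.

(** The rotation fixes the origin, where the function does not vanish. *)
Lemma sfun_rot1 delta : cexp (3 * delta%:C%C * tpi R) = -1 -> `|delta| <= 1 / 6 ->
  inv_by (rot R) 1 (sfun delta).
Proof.
move=> d3 d6; have := origin_neq0 d6; rewrite -sfun_origin => s0.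
have [e He] := sfun_rot d3 s0; have := He (Heis 0 0).
have -> : sim_act (rot R) (Heis 0 0) = Heis 0 0 :> heis R.
  by rewrite rot_act; congr Heis; exact: mulr0.
move=> E; have -> : 1 = e; last exact: He.
by apply: (mulIf s0); rewrite -E mul1r.
Qed.

Lemma hderive_sfun_origin v : hderive v (sfun (2^-1 : R)) (Heis 0 0) =
  v.1 * Fser (dcoef (thc (2^-1 : R))) (Heis 0 0).
Proof.
rewrite hderive_sfun /sfun_drv sfun_origin origin_odd mulr0 add0r.
have -> : sfun_exponent (2^-1 : R) (Heis 0 0) = 0.
  by rewrite /sfun_exponent /mode_exponent [hz _]/= [ht _]/= Im0 !(rmorph0, mulr0, oppr0, subr0, addr0).
by rewrite cexp0 mul1r.
Qed.

Lemma Z_sfun_origin : Zfield (sfun (2^-1 : R)) (Heis 0 0) != 0.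
Proof.
rewrite ZfieldE /Xfield /Yfield !hderive_sfun_origin; cbn [fst snd dirx diry].
have := origin_derivative R; move: (Fser _ _ : R[i]) (Tfield _ _ : R[i]) => D T D0.
rewrite [hz _]/= Im0 Re0 !mulr0 rmorph0 !mul0r addr0 subr0.
have i2 : 'i%C * 'i%C = -1 :> R[i] by rewrite -expr2 sqr_i.
have -> : 2^-1 * (1 * D - 'i%C * ('i%C * D)) = D.
  by field: i2.
exact: D0.
Qed.

(** The function vanishes at the origin, but its derivative by Z does not, and Z is
    multiplied by omega under the rotation. *)
Lemma sfun_rot_om : inv_by (rot R) om (sfun (2^-1 : R)).
Proof.
have d3 : cexp (3 * (2^-1 : R)%:C%C * tpi R) = -1.
  rewrite -(cexp_half_odd 1); congr cexp; rewrite half2.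
  by rewrite -half2 -[1%:~R]/(1 : R[i]); move: (tpi R) => T; field.
have Z0 := Z_sfun_origin; set s := sfun (2^-1 : R) in Z0 *.
have ss : smooth s := smooth_sfun _.
have [q sq] : exists q, s q != 0.
  apply: contrapT => N; move/negP: Z0; apply.
  have -> : s = fun=> 0.
    by apply/funext => p; apply: contrapT => /eqP K; apply: N; exists p.
  rewrite ZfieldE /Xfield /Yfield /Tfield !hderive_cst !mulr0 subr0 mulr0 addr0 subr0.
  by rewrite mulr0.
have [e He] := sfun_rot d3 sq.
have [_ _ ZZ] := derivation_Z R.
have := congr1 (fun F => F (Heis 0 0)) (Zfield_act (rot R) ss).
have -> : (fun p => s (sim_act (rot R) p)) = (fun p => e * s p).
  by apply/funext => p; exact: He.
rewrite (ZZ _ _ ss) /=.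
have -> : sim_act (rot R) (Heis 0 0) = Heis 0 0 :> heis R.
  by rewrite rot_act; congr Heis; exact: mulr0.
by move=> E p; apply: (etrans (He p)); congr (_ * _); exact: (mulIf Z0 E).
Qed.

Definition hol nu a b e f :=
  [/\ quasi nu a b f, Zbarfield f = (fun=> 0) & inv_by (rot R) e f].

Lemma hol1 : hol 0 1 1 1 (fun=> 1).
Proof.
split; last by move=> p; rewrite mul1r.
  split; [exact: smooth_cst| |by move=> p; rewrite mul1r|by move=> p; rewrite mul1r].
  by move=> p; rewrite /Tfield hderive_cst rmorph0 mulr0 mul0r.
apply/funext => p; rewrite ZbarfieldE /Xfield /Yfield /Tfield.
by rewrite !(hderive_cst, mulr0, subr0, addr0, add0r, oppr0).
Qed.

Lemma hol_mul nu nu' a b e f a' b' e' g : hol nu a b e f -> hol nu' a' b' e' g ->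
  hol (nu + nu') (a * a') (b * b') (e * e') (fun p => f p * g p).
Proof.
move=> [[sf Tf af bf] Zf ef] [[sg Tg ag bg] Zg eg].
have M x y z w u v : x = y * u :> R[i] -> z = w * v -> x * z = y * w * (u * v).
  by move=> -> ->; ring.
have [_ MT _] := derivation_T R; have [_ MZ _] := derivation_Zbar R.
split; last by move=> p; exact: M.
  split; [exact: smoothM| |by move=> p; exact: M|by move=> p; exact: M].
  move=> p; rewrite MT // Tf Tg rmorphD.
  by move: (f p : R[i]) (g p : R[i]) => u v; ring.
rewrite MZ // Zf Zg; apply/funext => p; rewrite mul0r add0r; exact: mulr0.
Qed.

Lemma holX nu a b e f n : hol nu a b e f ->
  hol (n%:R * nu) (a ^+ n) (b ^+ n) (e ^+ n) (fun p => f p ^+ n).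
Proof.
move=> H; elim: n => [|n IH]; first by rewrite mul0r; exact: hol1.
have := hol_mul H IH; rewrite -!exprS.
have -> : nu + n%:R * nu = n.+1%:R * nu by rewrite -nat1r mulrDl mul1r.
have -> // : (fun p => f p * f p ^+ n) = (fun p => f p ^+ n.+1).
by apply/funext => p; rewrite exprS.
Qed.

(** The sixth root of unity exp(pi i / 3). *)
Definition zeta6 : R[i] := cexp ((6^-1)%:C%C * tpi R).

Lemma cexpX z n : cexp z ^+ n = cexp (n%:R * z).
Proof.
elim: n => [|n IH]; first by rewrite mul0r cexp0.
by rewrite exprS IH -cexpD -nat1r mulrDl mul1r.
Qed.

Lemma zeta6X n : zeta6 ^+ n = cexp ((n%:R / 6)%:C%C * tpi R).
Proof. by rewrite /zeta6 cexpX rmorphM rmorph_nat mulrA. Qed.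

Lemma zeta6_6 : zeta6 ^+ 6 = 1.
Proof. by rewrite zeta6X divff // rmorph1 mul1r cexp_tpi. Qed.

Definition s0 : fct := sfun (2^-1).
Definition s1 : fct := sfun (- 6^-1).
Definition s2 : fct := sfun (6^-1).

Lemma hol_s0 : hol (nu1 R) (zeta6 ^+ 3) (zeta6 ^+ 3) om s0.
Proof.
have [Q Z] := theta_sfun (2^-1 : R).
split; [|exact: Z|exact: sfun_rot_om].
have -> : zeta6 ^+ 3 = cexp ((2^-1 : R)%:C%C * tpi R).
  by rewrite zeta6X; have -> : (3 / 6 : R) = 2^-1 by field.
exact: Q.
Qed.

Lemma hol_s1 : hol (nu1 R) (zeta6 ^+ 5) (zeta6 ^+ 5) 1 s1.
Proof.
have [Q Z] := theta_sfun (- 6^-1 : R).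
have e3 : cexp (3 * (- 6^-1 : R)%:C%C * tpi R) = -1.
  rewrite -(cexp_half_odd (-1)); congr cexp.
  have -> : (3 * (- 6^-1 : R)%:C%C : R[i]) = (3 * - 6^-1)%:C%C by rewrite rmorphM rmorphMn.
  have -> : (3 * - 6^-1 : R) = - 2^-1 by field.
  have -> : ((- 2^-1 : R)%:C%C : R[i]) = - 2^-1 by rewrite rmorphN half2.
  by rewrite -[(-1)%:~R]/(-1 : R[i]); move: (tpi R) => T; field.
split; [|exact: Z|apply: (sfun_rot1 e3); rewrite normrN gtr0_norm ?invr_gt0 //; lra].
have -> : zeta6 ^+ 5 = cexp ((- 6^-1 : R)%:C%C * tpi R).
  rewrite zeta6X; have -> : (5 / 6 : R) = - 6^-1 + 1 by field.
  by rewrite rmorphD mulrDl cexpD rmorph1 mul1r cexp_tpi mulr1.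
exact: Q.
Qed.

Lemma hol_s2 : hol (nu1 R) zeta6 zeta6 1 s2.
Proof.
have [Q Z] := theta_sfun (6^-1 : R).
have e3 : cexp (3 * (6^-1 : R)%:C%C * tpi R) = -1.
  rewrite -(cexp_half_odd 0); congr cexp.
  have -> : (3 * (6^-1 : R)%:C%C : R[i]) = (3 * 6^-1)%:C%C by rewrite rmorphM rmorphMn.
  have -> : (3 * 6^-1 : R) = 2^-1 by field.
  by rewrite -half2 mul0r addr0.
by split; [exact: Q|exact: Z|apply: (sfun_rot1 e3); rewrite gtr0_norm ?invr_gt0 //; lra].
Qed.

Section Degree.
Variable M : nat.
Hypothesis M0 : (0 < M)%N.

(** The number of exponents (a, b, c) with a + b + c = M, c < 3 and a, b in the
    same class e modulo 3: then c is the residue of M + e, and a = e + 3 x. *)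
Definition edim (e : nat) : nat := ((M + e) %/ 3 + 1 - e)%N.

Definition mono (e x : nat) : fct := fun p =>
  (s0 p ^+ (e + 3 * x) * s1 p ^+ (e + 3 * ((edim e).-1 - x))) * s2 p ^+ ((M + e) %% 3).

Lemma edim_sum : (edim 0 + (edim 1 + edim 2) = M)%N.
Proof. by rewrite /edim; lia. Qed.

(** The condition that a and b agree modulo 3 makes the multiplier independent of
    the monomial: it is the sixth root of unity to the power a * 3 + b * 5 + c. *)
Lemma hol_mono e x : (e < 3)%N -> (x < edim e)%N ->
  hol (M%:R * nu1 R) (zeta6 ^+ M) (zeta6 ^+ M) (om ^+ e) (mono e x).
Proof.
move=> e3 xd.
have := hol_mul (hol_mul (holX (e + 3 * x) hol_s0)
  (holX (e + 3 * ((edim e).-1 - x)) hol_s1)) (holX ((M + e) %% 3) hol_s2).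
rewrite -/(mono e x) -!exprM !expr1n !mulr1 -!exprD -!mulrDl -!natrD.
have -> : (e + 3 * x + (e + 3 * ((edim e).-1 - x)) + (M + e) %% 3 = M)%N.
  by rewrite /edim in xd *; lia.
have -> : (3 * (e + 3 * x) + 5 * (e + 3 * ((edim e).-1 - x)) + (M + e) %% 3 =
    M + 6 * (e + x + 2 * ((edim e).-1 - x)))%N.
  by rewrite /edim in xd *; lia.
rewrite exprD exprM zeta6_6 expr1n mulr1 [om ^+ (e + _)]exprD exprM.
have o3 : om ^+ 3 = 1 by rewrite !exprS expr0 mulr1 mulrA; exact: omega3.
by rewrite o3 expr1n mulr1.
Qed.

End Degree.

End Monomials.

(** * The dimension of the lowest level *)

Section LowestLevel.
Variable R : realType.
Local Notation Re := (@complex.Re R).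
Local Notation Im := (@complex.Im R).
Local Notation om := (cstar_val (omega R)).
Local Notation h := (Im om).
Local Notation fct := (heis R -> R[i]^o).
Implicit Types (p : heis R) (z w : R[i]) (f g : fct).

(** A nonzero polynomial has finitely many roots, but small nonzero roots can be
    produced one after the other, each smaller than the previous ones. *)
Lemma root_accumulation (p : {poly R[i]}) :
  (forall e : R, 0 < e -> exists w, [/\ w != 0, cmod w < e & root p w]) -> p = 0.
Proof.
move=> H; apply: contrapT => /eqP p0.
suff [s [us rs ss]] : exists s : seq R[i], [/\ uniq s, all (root p) s & size s = size p].
  by have := max_poly_roots p0 rs us; rewrite ss ltnn.
suff [s [us rs ss _]] : exists s : seq R[i],
    [/\ uniq s, all (root p) s, size s = size p & all (fun w => w != 0) s] by exists s.
elim: (size p) => [|n [s [us rs ss s0]]]; first by exists [::].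
have [e e0 he] : exists2 e : R, 0 < e & forall w, w \in s -> e <= cmod w.
  elim: s s0 {us rs ss} => [|w s IH] /=; first by exists 1.
  case/andP=> w0 /IH[e e0 he].
  have cw : 0 < cmod w by rewrite lt_def cmod_ge0 cmod_eq0 w0.
  exists (Num.min e (cmod w)); first by rewrite lt_min e0.
  by move=> u; rewrite in_cons ge_min => /orP[/eqP->|/he ->]; rewrite ?lexx ?orbT.
have [w [w0 we rw]] := H e e0.
exists (w :: s); split; rewrite /= ?rw ?w0 ?ss //.
rewrite us andbT; apply/negP => /he; by rewrite leNgt we.
Qed.

Lemma nonzero_near (g : R -> R) d : is_derive (0 : R) (1 : R) (g : R^o -> R^o) d -> d != 0 -> g 0 = 0 ->
  \forall s \near (0 : R)^', g s != 0.
Proof.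
move=> [D E] d0 g0.
have : (h^-1 *: ((g \o shift (0 : R)) (h *: (1 : R)) - g 0)) @[h --> (0 : R)^'] --> (d : R^o).
  by rewrite -E; exact: D.
move=> /cvgr_neq0 /(_ d0); apply: filterS => s /=.
rewrite addr0 g0 subr0; apply: contra => /eqP.
have -> : s *: (1 : R) = s by exact: mulr1.
by move=> ->; rewrite scaler0.
Qed.

(** The real axis through the origin. *)
Definition xline (s : R) : heis R := hline (dirx R) (Heis 0 0) s.

Lemma xline0 : xline 0 = Heis 0 0.
Proof. exact: hline0. Qed.

Lemma continuous_xline f : smooth f -> 
  {for (0 : R), continuous (fun s : R => Re (f (xline s)) : R^o)} /\
  {for (0 : R), continuous (fun s : R => Im (f (xline s)) : R^o)}.
Proof.
move=> sf; have H := hdrv_at (smooth_chain (dirx R) sf) (Heis 0 0) 0.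
by have /cvg_complexP[c1 c2] := cdrv_cont H; split.
Qed.

Lemma continuous_sqr_xline f : smooth f ->
  {for (0 : R), continuous (fun s : R => cmod (f (xline s)) ^+ 2 : R^o)}.
Proof.
move=> /continuous_xline[c1 c2].
have -> : (fun s : R => cmod (f (xline s)) ^+ 2) =
  (fun s => Re (f (xline s)) * Re (f (xline s)) + Im (f (xline s)) * Im (f (xline s))).
  by apply/funext => s; rewrite cmod_sqr !expr2.
exact: (cvgD (cvgM c1 c1) (cvgM c2 c2)).
Qed.

Lemma s0_near : \forall s \near (0 : R)^', s0 (xline s) != 0.
Proof.
have D0 := origin_derivative R.
have H := hdrv_at (smooth_chain (dirx R) (smooth_sfun (2^-1 : R))) (Heis 0 0) 0.
have : cdrv (fun s => s0 (xline s)) 0 (Fser (dcoef (thc (2^-1 : R))) (Heis 0 0)).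
  apply: (cdrv_eq H); rewrite hline0 /dirx; cbn [fst snd].
  rewrite [hderive (dirx R) _ _]hderive_sfun_origin [(dirx R).1]/(1 : R[i]) Re1 Im1 rmorph1 rmorph0.
  move: (Fser _ _ : R[i]) (hderive _ _ _ : R[i]) (hderive _ _ _ : R[i]) => D A B.
  by ring.
move: (Fser _ _ : R[i]) D0 => D D0 [h1 h2].
have z0 : s0 (xline 0) = 0 by rewrite xline0 /s0 sfun_origin origin_odd.
have [d0|d0] := eqVneq (Re D) 0.
  have d1 : Im D != 0.
    by apply: contra D0 => /eqP d1; apply/eqP; apply: complexP.
  have := nonzero_near h2 d1; rewrite z0 Im0 => /(_ erefl).
  by apply: filterS => s; apply: contra => /eqP ->.
have := nonzero_near h1 d0; rewrite z0 Re0 => /(_ erefl).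
by apply: filterS => s; apply: contra => /eqP ->.
Qed.

Lemma s1_origin : s1 (Heis 0 0 : heis R) != 0.
Proof.
rewrite /s1 sfun_origin; apply: origin_neq0.
by rewrite normrN gtr0_norm ?invr_gt0 //; lra.
Qed.

Lemma s2_origin : s2 (Heis 0 0 : heis R) != 0.
Proof.
rewrite /s2 sfun_origin; apply: origin_neq0.
by rewrite gtr0_norm ?invr_gt0 //; lra.
Qed.

Lemma cmod_near f : smooth f -> f (Heis 0 0) != 0 -> \forall s \near (0 : R)^', f (xline s) != 0.
Proof.
move=> sf f0; apply: nbhs_dnbhs.
have := continuous_sqr_xline sf => /cvgr_neq0.
rewrite xline0 sqrf_eq0 cmod_eq0 => /(_ f0); apply: filterS => s.
by rewrite sqrf_eq0 cmod_eq0.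
Qed.

(** Along the real axis [s0] vanishes at the origin to first order, while [s1] and
    [s2] do not vanish there. *)
Lemma small_ratio (e : R) : 0 < e -> exists q : heis R,
  [/\ s0 q != 0, s1 q != 0, s2 q != 0 & cmod ((s0 q / s1 q) ^+ 3) < e].
Proof.
move=> e0; have m0 : 0 < Num.min 1 e by rewrite lt_min ltr01.
have K : cmod (s1 (xline 0)) ^+ 2 != 0 by rewrite sqrf_eq0 cmod_eq0 xline0 s1_origin.
have cQ : {for (0 : R), continuous (fun s : R => cmod (s0 (xline s)) ^+ 2 / cmod (s1 (xline s)) ^+ 2 : R^o)}.
  apply: cvgM; first exact: (continuous_sqr_xline (smooth_sfun _)).
  by apply: cvgV => //; exact: (continuous_sqr_xline (smooth_sfun _)).
have z0 : s0 (xline 0) = 0 by rewrite xline0 /s0 sfun_origin origin_odd.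
have Q0 : cmod (s0 (xline 0)) ^+ 2 / cmod (s1 (xline 0)) ^+ 2 < Num.min 1 e ^+ 2.
  rewrite z0; have -> : cmod (0 : R[i]) = 0 by apply/eqP; rewrite cmod_eq0.
  by rewrite expr0n mul0r exprn_gt0.
have n1 : \forall s \near (0 : R)^', cmod (s0 (xline s)) ^+ 2 / cmod (s1 (xline s)) ^+ 2 < Num.min 1 e ^+ 2.
  by apply: nbhs_dnbhs; exact: (cvgr_lt _ cQ _ Q0).
have n2 := s0_near.
have n3 := cmod_near (smooth_sfun _) s1_origin.
have n4 := cmod_near (smooth_sfun _) s2_origin.
have [s [[h1 h2] [h3 h4]]] : exists s, (cmod (s0 (xline s)) ^+ 2 / cmod (s1 (xline s)) ^+ 2 < Num.min 1 e ^+ 2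
    /\ s0 (xline s) != 0) /\ (s1 (xline s) != 0 /\ s2 (xline s) != 0).
  by apply: (@filter_ex _ (0 : R)^'); exact: (filterI (filterI n1 n2) (filterI n3 n4)).
exists (xline s); split => //.
have ratio : cmod (s0 (xline s) / s1 (xline s)) < Num.min 1 e.
  rewrite -(@ltr_pXn2r _ 2) ?nnegrE ?cmod_ge0 ?(ltW m0) //.
  apply: le_lt_trans h1; rewrite cmodM exprMn.
  suff -> : cmod (s1 (xline s))^-1 = (cmod (s1 (xline s)))^-1 by rewrite exprVn.
  have c1 : cmod (s1 (xline s)) != 0 by rewrite cmod_eq0.
  by apply: (mulfI c1); rewrite -cmodM !divff // cmod_real normr1.
move: (s0 _ / s1 _ : R[i]) ratio => w; rewrite lt_min => /andP[w1 we].
rewrite !exprS expr0 mulr1 !cmodM.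
have w0 := cmod_ge0 w; move: (cmod w) w0 w1 we => x x0 x1 xe.
apply: le_lt_trans xe; rewrite -[leRHS]mulr1 ler_wpM2l //.
by rewrite -[leRHS]mulr1; apply: ler_pM => //; exact: ltW.
Qed.

Definition i3 (n : nat) (n3 : (n < 3)%N) : 'I_3 := Ordinal n3.

Lemma sum3 (F : 'I_3 -> R[i]) : \sum_e F e = F (@i3 0 isT) + F (@i3 1 isT) + F (@i3 2 isT).
Proof.
rewrite !big_ord_recl big_ord0 addr0 addrA.
by congr (F _ + F _ + F _); exact: val_inj.
Qed.

(** Applying the rotation twice gives the three equations of a Vandermonde system
    in the cube roots of unity. *)
Lemma eigen_split (G : 'I_3 -> fct) :
  (forall e : 'I_3, inv_by (rot R) (om ^+ e) (G e)) ->
  (forall p, \sum_e G e p = 0) -> forall e p, G e p = 0.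
Proof.
move=> H S e p.
have := S p; have := S (sim_act (rot R) p).
have := S (sim_act (rot R) (sim_act (rot R) p)).
rewrite !sum3 !H -![nat_of_ord _]/(0%N) -![nat_of_ord (@i3 1 isT)]/(1%N)
  -![nat_of_ord (@i3 2 isT)]/(2%N) expr0 expr1 expr2.
have := omega_poly R.
have -> : G e p = if val e == 0%N then G (@i3 0 isT) p else
    if val e == 1%N then G (@i3 1 isT) p else G (@i3 2 isT) p.
  case: e => -[|[|[|//]]] He /=; congr (G _ p); exact: val_inj.
move: (G _ p : R[i]) (G _ p : R[i]) (G _ p : R[i]) om => u2 u1 u0 o o2 E3 E2 E1.
have oo : o * o = - 1 - o.
  by apply/eqP; rewrite -subr_eq0 -o2; apply/eqP; ring.
have n3 : (3 : R[i]) != 0 by rewrite pnatr_eq0.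
have o4 : o * o * (o * o) = o by rewrite oo; ring: oo.
have C (a b c : R[i]) : a * (u0 + u1 + u2) + b * (u0 + o * u1 + (-1 - o) * u2) +
   c * (u0 + (-1 - o) * u1 + o * u2) = 0.
  move: E1 E2 E3; rewrite !mul1r (mulrA o o) (mulrA (o * o) (o * o)) o4 oo => -> -> ->.
  by rewrite !mulr0 !addr0.
case: eqP => _; last case: eqP => _; apply: (mulfI n3); rewrite mulr0.
- apply: (etrans _ (C 1 1 1)); ring: oo.
- apply: (etrans _ (C 1 (-1 - o) o)); ring: oo.
- apply: (etrans _ (C 1 o (-1 - o))); ring: oo.
Qed.

Section Degree.
Variable M : nat.
Hypothesis M0 : (0 < M)%N.

Lemma mono_ratio e x (q : heis R) : (x < edim M e)%N -> s1 q != 0 ->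
  mono M e x q = s0 q ^+ e * s1 q ^+ (e + 3 * (edim M e).-1) * s2 q ^+ ((M + e) %% 3)
    * ((s0 q / s1 q) ^+ 3) ^+ x.
Proof.
move=> xd q1; rewrite /mono.
have -> : (e + 3 * (edim M e).-1 = 3 * x + (e + 3 * ((edim M e).-1 - x)))%N.
  by move: (edim M e) xd => d; lia.
move: (e + 3 * (_ - x))%N ((M + e) %% 3)%N => A B.
move: (s0 q : R[i]) (s1 q : R[i]) (s2 q : R[i]) q1 => a b c b0.
rewrite (exprD a e (3 * x)) (exprD b (3 * x) A) -!exprM [(a / b) ^+ _]expr_div_n.
have bx : b ^+ (3 * x) != 0 by rewrite expf_neq0.
move: (b ^+ (3 * x)) (a ^+ (3 * x)) bx => bb aa bx. by field.
Qed.

(** Divided by a common factor, a relation is a polynomial equation for the cube of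
    the ratio of [s0] and [s1], which takes arbitrarily small nonzero values. *)
Lemma mono_free e (a : 'I_(edim M e) -> R[i]) :
  (forall p, \sum_x a x * mono M e x p = 0) -> forall x, a x = 0.
Proof.
move=> H.
(* oapp and insub extend the coefficients from 'I_(edim M e) to nat. *)
pose P := \poly_(i < edim M e) oapp a 0 (insub i).
suff P0 : P = 0.
  move=> x; have : P`_x = 0 by rewrite P0 coef0.
  by rewrite coef_poly ltn_ord valK.
apply: root_accumulation => eps eps0; have [q [q0 q1 q2 hq]] := small_ratio eps0.
exists ((s0 q / s1 q) ^+ 3); split => //.
  by rewrite expf_neq0 // mulf_neq0 // invr_eq0.
rewrite /root horner_poly.
pose C := s0 q ^+ e * s1 q ^+ (e + 3 * (edim M e).-1) * s2 q ^+ ((M + e) %% 3).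
have C0 : C != 0 by rewrite !mulf_neq0 ?expf_neq0.
apply/eqP; apply: (mulfI C0); rewrite mulr0 -[RHS](H q) mulr_sumr.
apply: eq_bigr => x _; rewrite valK (mono_ratio (ltn_ord x) q1) -/C /=.
exact: mulrCA.
Qed.

Lemma cmod_zeta6 n : cmod (zeta6 R ^+ n) = 1.
Proof.
rewrite zeta6X cmod_cexp.
have -> : Re ((n%:R / 6)%:C%C * tpi R) = 0 by rewrite /tpi !ReImE /=; ring.
exact: expR0.
Qed.

Lemma sum_unit (I : finType) (F : unit + I -> R[i]) : \sum_i F i = F (inl tt) + \sum_i F (inr i).
Proof. by rewrite big_sumType /= (big_pred1 tt) //; case. Qed.

(** The theta functions of degree M span at most M dimensions. An element of
    one eigenspace together with all M monomials is therefore linearly dependent;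
    splitting the relation by rotation eigenvalues and using the
    independence of each family expresses it through its own family. *)
Lemma has_dim_level0 e : (e < 3)%N ->
  has_dim (level (M%:R * nu1 R) 0 (zeta6 R ^+ M) (zeta6 R ^+ M) (om ^+ e)) (edim M e).
Proof.
move=> e3.
have nu0 : 0 < M%:R * nu1 R by rewrite mulr_gt0 ?nu1_gt0 // ltr0n.
have lev := level0P _ _ nu0 (cmod_zeta6 M) (cmod_zeta6 M).
exists (fun x : 'I_(edim M e) => mono M e x); split.
- by move=> x; apply/lev; exact: hol_mono.
- move=> a E; apply: mono_free => p.
  by have := congr1 (fun F : fct => F p) E; rewrite combinationE.
move=> f /lev[Qf Zf rf].
(* The M monomials, and one more index for the given function. *)
pose J := {e' : 'I_3 & 'I_(edim M e')}.
pose F (i : unit + J) : fct := match i with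
  | inl _ => f | inr j => mono M (tag j) (tagged j) end.
have card : (M < #|{: unit + J}|)%N.
  rewrite card_sum card_unit card_tagged sumnE big_map big_enum /=.
  under eq_bigr do rewrite card_ord.
  by rewrite !big_ord_recl big_ord0 /= addn0 (edim_sum M0) add1n.
have dE : zeta6 R ^+ M = cexp ((M%:R / 6 : R)%:C%C * tpi R) := zeta6X R M.
have tF i : theta (M%:R * nu1 R) (zeta6 R ^+ M) (M%:R / 6) (F i).
  rewrite /theta -dE; case: i => [u|j]; first by split.
  by have [] := hol_mono R M0 (ltn_ord (tag j)) (ltn_ord (tagged j)).
have nuM : 2 * (M%:R * nu1 R) * h = pi * M%:R.
  by have := nu1E R; rewrite mulr1 => <-; ring.
have b0 : zeta6 R ^+ M != 0 by rewrite dE cexp_neq0.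
have [c [[i0 ci0] E]] := theta_dependent M0 nuM b0 card tF.
(* The part of the relation with rotation eigenvalue omega^e'. *)
pose G (e' : 'I_3) : fct := fun p => (if val e' == e then c (inl tt) * f p else 0) +
   \sum_(x < edim M e') c (inr (Tagged _ x)) * mono M e' x p.
have rG e' : inv_by (rot R) (om ^+ val e') (G e').
  move=> p; rewrite /G mulrDr mulr_sumr; congr (_ + _).
    case: eqP => [->|_]; last by rewrite mulr0.
    by rewrite rf; exact: mulrCA.
  apply: eq_bigr => x _.
  have [_ _ r] := hol_mono R M0 (ltn_ord e') (ltn_ord x).
  by rewrite r; exact: mulrCA.
have SG p : \sum_e' G e' p = 0.
  have := congr1 (fun F : fct => F p) E.
  have -> : (\sum_i c i *: F i) p = \sum_i c i * F i p.
    by elim/big_ind2: _ => [//|f1 c1 f2 c2 <- <- //|i _ //].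
  rewrite sum_unit => E1; apply: (etrans _ E1).
  rewrite big_split /=; congr (_ + _).
    by rewrite -big_mkcond /= (big_pred1 (Ordinal e3)).
  rewrite sig_big_dep.
  by apply: eq_bigr => -[e1 x1] _.
have G0 := eigen_split rG SG.
have cN : c (inl tt) != 0.
  apply/eqP => c0; move/negP: ci0; apply; apply/eqP.
  case: i0 => [[]//|[e' x]].
  apply: (@mono_free e' (fun x => c (inr (Tagged _ x)))) => p.
  have := G0 e' p; rewrite /G c0 mul0r.
  by case: ifP => _; rewrite add0r.
exists (fun x => - (c (inl tt))^-1 * c (inr (Tagged (fun e' : 'I_3 => 'I_(edim M e')) (x : 'I_(edim M (Ordinal e3)))))).
apply/funext => p; rewrite combinationE; apply: (mulfI cN).
have := G0 (Ordinal e3) p; rewrite /G /= eqxx => /eqP; rewrite addr_eq0 => /eqP ->.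
rewrite mulr_sumr -sumrN; apply: eq_bigr => x _.
have K (u v w : R[i]) : u != 0 -> - (v * w) = u * (- u^-1 * v * w).
  by move=> u0; field.
exact: K.
Qed.

End Degree.
End LowestLevel.

(** * Generators of the group after recentring *)

Section Recentring.
Variable R : realType.
Local Notation Re := (@complex.Re R).
Local Notation Im := (@complex.Im R).
Local Notation om := (cstar_val (omega R)).
Local Notation h := (Im om).
Local Notation fct := (heis R -> R[i]^o).
Implicit Types (p : heis R) (z w : R[i]) (f g : fct).

Program Definition stabilizer f : subgroup (sim R) :=
  @Subgroup _ [set x | forall p, f (sim_act x p) = f p] _ _ _.
Next Obligation. by move=> f p; rewrite sim_act1. Qed.
Next Obligation. by move=> f x y /= fx fy p; rewrite sim_actM fx fy. Qed.
Next Obligation. by move=> f x /= fx p; rewrite -[LHS]fx -sim_actM mulgV sim_act1. Qed.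

Lemma generated_sub (G : groupType) (S : set G) (H : subgroup G) :
  S `<=` H -> generated S `<=` H.
Proof. by move=> SH x; apply; exact: SH. Qed.

Lemma sub_generated (G : groupType) (S : set G) : S `<=` generated S.
Proof. by move=> x Sx H SH; exact: SH. Qed.

Lemma heis_in_simM (g g' : heis R) : heis_in_sim (g * g')%g = (heis_in_sim g * heis_in_sim g')%g.
Proof.
rewrite /heis_in_sim /mul /= /sim_mul; congr Sim; last by rewrite mulg1.
by rewrite /= mu1.
Qed.

Program Definition heis_preimage (H : subgroup (sim R)) : subgroup (heis R) :=
  @Subgroup _ [set g | subgroup_set H (heis_in_sim g)] _ _ _.
Next Obligation. by move=> H; exact: (subgroup1 H). Qed.
Next Obligation. by move=> H x y /= Hx Hy; rewrite heis_in_simM; exact: subgroupM. Qed.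
Next Obligation.
move=> H x /= Hx.
have -> : heis_in_sim x^-1%g = (heis_in_sim x)^-1%g; last exact: subgroupV.
apply: (@mulgI _ (heis_in_sim x)).
by rewrite -heis_in_simM !mulgV.
Qed.

Definition sigma c : sim R := Sim (Heis (om / 2) (2 * c / 3 + h / 6)) (omega R).

(** The stabilizer of f is a subgroup, and so is its preimage in the Heisenberg
    group, so it suffices to test the generators. *)
Lemma invariant_fun_generators c f : invariant_fun (Gamma' c) f <->
  [/\ inv_by (heis_in_sim (Heis 1 0)) 1 f, inv_by (heis_in_sim (Heis om 0)) 1 f,
      inv_by (heis_in_sim (Heis 0 c)) 1 f & inv_by (sigma c) 1 f].
Proof.
split=> [H|[h1 h2 h3 h4]].
  have L (g : heis R) : subgroup_set (Lambda om c) g -> inv_by (heis_in_sim g) 1 f.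
    move=> Lg p; rewrite mul1r; apply: H; apply: sub_generated.
    by left; exists g.
  split; [| | |move=> p; rewrite mul1r; apply: H; apply: sub_generated; by right];
    apply: L; apply: sub_generated; by [left; left|left; right|right].
have stab x : inv_by x 1 f -> subgroup_set (stabilizer f) x by move=> hx p; rewrite hx mul1r.
suff sub : Gamma' c `<=` stabilizer f by move=> x p Gx; exact: sub.
apply: generated_sub => x [[g Lg <-]|->]; last exact: stab.
have : Lambda om c `<=` heis_preimage (stabilizer f).
  by apply: generated_sub => y [[->|->]|->]; exact: stab.
by apply.
Qed.

(** The translation by this point moves the fixed axis of the rotation
    generator to the axis z = 0. *)
Definition centre : R[i] := (om - 1) / 6.

Lemma heis_act (g : heis R) p : sim_act (heis_in_sim g) p =
  Heis (hz g + hz p) (ht g + ht p + 2 * Im (hz g * (hz p)^*%C)).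
Proof. by rewrite /sim_act /heis_in_sim /= mu1. Qed.

Lemma omega_act (g : heis R) p : sim_act (Sim g (omega R)) p =
  Heis (hz g + om * hz p) (ht g + ht p + 2 * Im (hz g * (om * hz p)^*%C)).
Proof.
have -> : sim_act (Sim g (omega R)) p = Heis (hz g + om * hz p)
  (ht g + cmod om ^+ 2 * ht p + 2 * Im (hz g * (om * hz p)^*%C)) by [].
by rewrite (cmod_omega R) expr1n mul1r.
Qed.

Lemma recentre_trans w s p : sim_act (trans centre) (sim_act (heis_in_sim (Heis w s)) p) =
  sim_act (heis_in_sim (Heis w (s - 4 * Im (w * centre^*%C)))) (sim_act (trans centre) p).
Proof.
rewrite !trans_act !heis_act; move: centre => P.
by apply: heisP; rewrite /= !ReImE; ring.
Qed.

Lemma centreE : centre = (6^-1)%:C%C * (om - 1).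
Proof.
rewrite /centre mulrC; congr (_ * _).
by rewrite -[6 in LHS](rmorph_nat (real_complex R)) -fmorphV.
Qed.

Lemma centre_1 : 4 * Im (1 * centre^*%C) = - (2 * h / 3).
Proof.
by rewrite centreE; move: om => o; rewrite !ReImE; field.
Qed.

Lemma centre_om : 4 * Im (om * centre^*%C) = - (2 * h / 3).
Proof.
by rewrite centreE; move: om => o; rewrite !ReImE; field.
Qed.

(** The choice of [centre] cancels both the translation part in z and the extra
    central term in the generator. *)
Lemma recentre_sigma c p :
  sim_act (trans centre) (sim_act (Sim (Heis 0 (2 * c / 3)) (omega R)) p) =
  sim_act (sigma c) (sim_act (trans centre) p).
Proof.
have e1 := centre_1; have o2 := omega_poly R.
rewrite /sigma !trans_act !omega_act.
have hzE w t : hz (Heis w t : heis R) = w by [].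
have htE w t : ht (Heis w t : heis R) = t by [].
rewrite !hzE !htE.
have o1 := unit_conj (cmod_omega R).
have n6 : (6 : R[i]) != 0 by rewrite pnatr_eq0.
have n2 : (2 : R[i]) != 0 by rewrite pnatr_eq0.
have fix0 : om / 2 + om * centre = centre.
  by rewrite /centre; move: om o2 => o o2; have oo : o * o = - 1 - o; [
    apply/eqP; rewrite -subr_eq0 -o2; apply/eqP; ring | field: oo].
have ImP : Im centre = h / 6.
  by have := centre_1; rewrite mul1r ImJ => E; lra.
have JM (x y : R[i]) : (x * y)^*%C = x^*%C * y^*%C.
  by apply: complexP; rewrite !ReImE; ring.
have A w : om / 2 * (om * w)^*%C = w^*%C / 2.
  move: om o1 => o o1; rewrite JM.
  by move: (o^*%C : R[i]) (w^*%C : R[i]) o1 => oc wc o1; field: o1.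
have B w : centre * (om * w)^*%C = centre * w^*%C + w^*%C / 2.
  rewrite /centre; have := omegaJ R; move: om o1 o2 => o o1 o2 oJ; rewrite JM.
  have : o + o^*%C = -1 by rewrite oJ; apply/eqP; rewrite -subr_eq0 -o2; apply/eqP; ring.
  move: (o^*%C : R[i]) (w^*%C : R[i]) o1 => oc wc o1 osum.
  have -> : oc = -1 - o by rewrite -osum; ring.
  have oo : o * o = - 1 - o by apply/eqP; rewrite -subr_eq0 -o2; apply/eqP; ring.
  by field: oo.
rewrite A !add0r mul0r Im0 B; congr Heis.
  by rewrite mulrDr addrA fix0.
move: h centre ImP (hz p) (ht p) => y P ImP z t.
by rewrite half2 !ReImE ImP; field.
Qed.

End Recentring.

(** * Recentring the eigenspaces *)

Section Transport.
Variable R : realType.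
Local Notation Re := (@complex.Re R).
Local Notation Im := (@complex.Im R).
Local Notation om := (cstar_val (omega R)).
Local Notation h := (Im om).
Local Notation fct := (heis R -> R[i]^o).
Local Notation tau := (trans (centre R)).
Implicit Types (p : heis R) (z w : R[i]) (f g : fct).

Definition recentred f : fct := fun p => f (sim_act tau p).

Lemma act_surj x (P : heis R -> Prop) : (forall p, P (sim_act x p)) -> forall p, P p.
Proof. by move=> H p; have := H (sim_act x^-1%g p); rewrite -sim_actM mulgV sim_act1. Qed.

Lemma inv_by_conj x y f : (forall p, sim_act tau (sim_act y p) = sim_act x (sim_act tau p)) ->
  inv_by x 1 f <-> inv_by y 1 (recentred f).
Proof.
move=> H; split=> K; first by move=> p; rewrite /recentred H K.
by apply: (act_surj (x := tau)) => p; rewrite -H; exact: K.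
Qed.

Lemma invariant_recentred c f : invariant_fun (Gamma' c) f <->
  [/\ inv_by (heis_in_sim (Heis 1 (- (2 * h / 3)))) 1 (recentred f),
      inv_by (heis_in_sim (Heis om (- (2 * h / 3)))) 1 (recentred f),
      inv_by (heis_in_sim (Heis 0 c)) 1 (recentred f) &
      inv_by (Sim (Heis 0 (2 * c / 3)) (omega R)) 1 (recentred f)].
Proof.
have T w s s' : s - 4 * Im (w * (centre R)^*%C) = s' ->
    inv_by (heis_in_sim (Heis w s')) 1 f <-> inv_by (heis_in_sim (Heis w s)) 1 (recentred f).
  by move=> E; apply: inv_by_conj => p; rewrite recentre_trans E.
have t1 := T 1 (- (2 * h / 3)) 0 (etrans (congr1 (fun x => - (2 * h / 3) - x) (centre_1 R)) (subrr _)).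
have t2 := T om (- (2 * h / 3)) 0 (etrans (congr1 (fun x => - (2 * h / 3) - x) (centre_om R)) (subrr _)).
have t3 : inv_by (heis_in_sim (Heis 0 c)) 1 f <-> inv_by (heis_in_sim (Heis 0 c)) 1 (recentred f).
  by apply: T; rewrite mul0r Im0 mulr0 subr0.
have t4 : inv_by (sigma c) 1 f <-> inv_by (Sim (Heis 0 (2 * c / 3)) (omega R)) 1 (recentred f).
  by apply: inv_by_conj => p; exact: recentre_sigma.
by split=> [/invariant_fun_generators|] [/t1 h1 /t2 h2 /t3 h3 /t4 h4];
  [|apply/invariant_fun_generators]; split.
Qed.

Lemma smooth_recentred f : smooth (recentred f) <-> smooth f.
Proof.
split=> H; last exact: smooth_act.
have -> : f = fun p => recentred f (sim_act tau^-1%g p); last exact: smooth_act.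
by apply/funext => p; rewrite /recentred -sim_actM mulgV sim_act1.
Qed.

Lemma Tfield_recentred f : smooth f -> Tfield (recentred f) = recentred (Tfield f).
Proof.
move=> sf; apply/funext => p; rewrite /recentred (Tfield_act tau sf) cmod_trans.
by rewrite expr1n rmorph1; exact: mul1r.
Qed.

Lemma Zfield_recentred f : smooth f -> Zfield (recentred f) = recentred (Zfield f).
Proof.
by move=> sf; apply/funext => p; rewrite /recentred (Zfield_act tau sf); exact: mul1r.
Qed.

Lemma Zbarfield_recentred f : smooth f -> Zbarfield (recentred f) = recentred (Zbarfield f).
Proof.
move=> sf; apply/funext => p; rewrite /recentred (Zbarfield_act tau sf).
by rewrite -[siml _ : R[i]]/(1 : R[i]) rmorph1; exact: mul1r.
Qed.

Lemma recentred_eq f g (u : R[i]) : (forall p, g p = u * f p) <->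
  (forall p, recentred g p = u * recentred f p).
Proof.
split=> H p; first exact: H.
exact: (act_surj (x := tau) (P := fun p => g p = u * f p)).
Qed.

Lemma has_dim_recentred (V W : set fct) m :
  (forall f, V f -> smooth f) -> (forall g, W g -> smooth g) ->
  (forall f, smooth f -> V f <-> W (recentred f)) -> has_dim W m -> has_dim V m.
Proof.
move=> Vs Ws VW.
pose S : fct -> fct := fun g p => 1 * g (sim_act tau^-1%g p).
pose T : fct -> fct := fun g p => 1 * g (sim_act tau p).
have TE f : T f = recentred f by apply/funext => p; exact: mul1r.
have ST f : S (T f) = f.
  by apply/funext => p; rewrite /S /T -sim_actM mulgV sim_act1 !mul1r.
have TS f : T (S f) = f.
  by apply/funext => p; rewrite /S /T -sim_actM mulVg sim_act1 !mul1r.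
apply: (@has_dim_iso R[i] fct fct _ _ id id T S) => //.
- exact: combination_comp.
- exact: combination_comp.
- by move=> f Vf; rewrite TE; apply/VW => //; exact: Vs.
- move=> g Wg; apply/VW; last by rewrite -TE TS.
  by apply/smooth_recentred; rewrite -TE TS; exact: Ws.
Qed.

(** A central element acts on functions of central frequency nu by a scalar, which is
    moved into the multiplier. *)
Lemma central_inv_trans f nu w s : smooth f -> central nu f ->
  inv_by (heis_in_sim (Heis w s)) 1 f <-> inv_by (trans w) (cexp (- ('i%C * (nu * s)%:C%C))) f.
Proof.
move=> sf H.
have K p : f (sim_act (heis_in_sim (Heis w s)) p) =
    cexp ('i%C * (nu * s)%:C%C) * f (sim_act (trans w) p).
  rewrite trans_act heis_act -(central_shift _ _ _ sf H).
  by congr (f (Heis _ _)); rewrite /=; ring.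
have N := cexpN ('i%C * (nu * s)%:C%C); have e0 := cexp_neq0 ('i%C * (nu * s)%:C%C).
split=> I p.
  have := I p; rewrite K mul1r N => <-.
  by apply: esym; exact: (@mulKf R[i] _ e0).
by rewrite K I N mul1r; exact: (@mulVKf R[i] _ e0).
Qed.

Lemma central_inv_rot f nu s : smooth f -> central nu f ->
  inv_by (Sim (Heis 0 s) (omega R)) 1 f <-> inv_by (rot R) (cexp (- ('i%C * (nu * s)%:C%C))) f.
Proof.
move=> sf H.
have K p : f (sim_act (Sim (Heis 0 s) (omega R)) p) =
    cexp ('i%C * (nu * s)%:C%C) * f (sim_act (rot R) p).
  rewrite rot_act omega_act -(central_shift _ _ _ sf H).
  have hzE w t : hz (Heis w t : heis R) = w by [].
  have htE w t : ht (Heis w t : heis R) = t by [].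
  by rewrite hzE htE mul0r Im0 mulr0 addr0 add0r addrC.
have N := cexpN ('i%C * (nu * s)%:C%C); have e0 := cexp_neq0 ('i%C * (nu * s)%:C%C).
split=> I p.
  have := I p; rewrite K mul1r N => <-.
  by apply: esym; exact: (@mulKf R[i] _ e0).
by rewrite K I N mul1r; exact: (@mulVKf R[i] _ e0).
Qed.

Lemma reeb_central r b f : 0 < r ->
  (forall p, 'i%C^-1 * reeb r f p = b%:C%C * f p) <-> central (r * b) f.
Proof.
move=> r0; have rC : (r%:C%C : R[i]) != 0 by rewrite fmorph_eq0 gt_eqF.
have i0 : ('i%C : R[i]) != 0 by rewrite neq0Ci.
have i2 : 'i%C * 'i%C = -1 :> R[i] by rewrite -expr2 sqr_i.
have rV : ((r^-1)%:C%C : R[i]) = (r%:C%C)^-1 by rewrite fmorphV.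
have rb : ((r * b)%:C%C : R[i]) = r%:C%C * b%:C%C by rewrite rmorphM.
rewrite /reeb /central; split=> H p; have := H p; rewrite -/(Tfield f) rV rb;
  move: (Tfield f p : R[i]) (f p : R[i]) (r%:C%C : R[i]) rC (b%:C%C : R[i]) => T F rc rC bc E.
  have -> : T = 'i%C * rc * ('i%C^-1 * (rc^-1 * T)) by field; rewrite ?i0 ?rC.
  by rewrite E; ring.
by rewrite E; field; rewrite ?i0 ?rC.
Qed.

(** The two products of Z and its conjugate differ by the scalar 2 nu. *)
Lemma sub_laplacian_central r nu (k : nat) a f : 0 < r -> smooth f -> central nu f ->
  r * a = (2 * k%:R + 1) * nu ->
  (forall p, sub_laplacian r f p = a%:C%C * f p) <->
  (forall p, Zfield (Zbarfield f) p = - (2 * k%:R * nu)%:C%C * f p).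
Proof.
move=> r0 sf H ra.
have rC : (r%:C%C : R[i]) != 0 by rewrite fmorph_eq0 gt_eqF.
have n2 : (2 : R[i]) != 0 by rewrite pnatr_eq0.
have r2 : (((2 * r)^-1)%:C%C : R[i]) = (2 * r%:C%C)^-1 by rewrite fmorphV rmorphM rmorphMn.
have raC : (r%:C%C : R[i]) * a%:C%C = (2 * k%:R + 1) * nu%:C%C.
  by rewrite -rmorphM ra rmorphM rmorphD rmorphM rmorphMn rmorph1 rmorph_nat.
have k2 : ((2 * k%:R * nu)%:C%C : R[i]) = 2 * k%:R * nu%:C%C.
  by rewrite !rmorphM rmorphMn rmorph_nat.
have n2C : ((2 * nu)%:C%C : R[i]) = 2 * nu%:C%C by rewrite rmorphM rmorphMn.
have E p : Zbarfield (Zfield f) p = Zfield (Zbarfield f) p - 2 * nu%:C%C * f p.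
  have := commutator_central p sf H; rewrite n2C => <-.
  by rewrite opprB addrC subrK.
rewrite /sub_laplacian; split=> K p; have := K p; rewrite E r2 k2;
  move: (Zfield (Zbarfield f) p : R[i]) (f p : R[i]) (a%:C%C : R[i]) (nu%:C%C : R[i])
    (k%:R : R[i]) (r%:C%C : R[i]) raC rC => Z F ac nc kc rc raC rC K1.
  have -> : Z = - rc * (- (2 * rc)^-1 * (Z + (Z - 2 * nc * F))) + nc * F by field.
  by rewrite K1 mulrA mulNr raC; ring.
have -> : ac = (2 * kc + 1) * nc / rc by rewrite -raC; field.
by rewrite K1; field.
Qed.

End Transport.

(** * Multiplicities with nonzero central frequency *)

Section Multiplicity.
Variable R : realType.
Local Notation Re := (@complex.Re R).
Local Notation Im := (@complex.Im R).
Local Notation om := (cstar_val (omega R)).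
Local Notation h := (Im om).
Local Notation fct := (heis R -> R[i]^o).
Local Notation tau := (trans (centre R)).
Implicit Types (p : heis R) (z w : R[i]) (f g : fct).

Lemma has_dim_level_iter nu (k n : nat) a b m : 0 < nu ->
  has_dim (level nu 0 a b (om ^+ (n + k))) m -> has_dim (level nu k a b (om ^+ n)) m.
Proof.
move=> nu0; elim: k n => [|k IH] n; first by rewrite addn0.
by rewrite addnS -addSn => /IH; rewrite exprS => /(has_dim_level nu0).
Qed.

Lemma omX (n : nat) : om ^+ n = cexp ((n%:R / 3)%:C%C * tpi R).
Proof.
have -> : om = cexp ((3^-1)%:C%C * tpi R).
  rewrite /cexp; have -> : Re ((3^-1)%:C%C * tpi R) = 0 by rewrite /tpi !ReImE /=; ring.
  have -> : Im ((3^-1)%:C%C * tpi R) = 2 * pi / 3 by rewrite /tpi !ReImE /=; ring.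
  by rewrite expR0 mul1r.
by rewrite cexpX mulrA -[n%:R](rmorph_nat (real_complex R)) -rmorphM.
Qed.

Lemma omX_mod (n : nat) : om ^+ n = om ^+ (n %% 3).
Proof.
have o3 : om ^+ 3 = 1 by rewrite !exprS expr0 mulr1 mulrA; exact: omega3.
by rewrite {1}(divn_eq n 3) exprD mulnC exprM o3 expr1n mul1r.
Qed.

Section Positive.
Variables (N n k : nat) (c r : R).
Hypotheses (N0 : (0 < N)%N) (n0 : (0 < n)%N) (r0 : 0 < r).
Hypothesis hc : c = 4 * h / N%:R.

Let M := (n * N)%N.
Let nu := M%:R * nu1 R.
Let b := 2 * pi * n%:R / (c * r).
Let a := (4 * k%:R + 2) * pi * n%:R / (c * r).

Lemma h_neq0 : h != 0.
Proof. by rewrite gt_eqF // Im_omega_gt0. Qed.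

Lemma N_neq0 : N%:R != 0 :> R.
Proof. by rewrite pnatr_eq0 -lt0n. Qed.

Lemma rb_nu : r * b = nu.
Proof.
rewrite /b /nu /nu1 /M natrM hc; have := h_neq0; have := N_neq0; have := r0.
move: h N%:R n%:R (pi : R) => x y z P /gt_eqF/negbT rr y0 x0.
by field; rewrite y0 x0 rr.
Qed.

Lemma ra_nu : r * a = (2 * k%:R + 1) * nu.
Proof.
rewrite -rb_nu /a /b hc; have := h_neq0; have := N_neq0; have := r0.
move: h N%:R n%:R k%:R (pi : R) => x y z t P /gt_eqF/negbT rr y0 x0.
by field; rewrite y0 x0 rr.
Qed.

Lemma nu_c : nu * c = 2 * pi * n%:R.
Proof.
rewrite /nu /nu1 /M natrM hc; have := h_neq0; have := N_neq0.
move: h N%:R n%:R (pi : R) => x y z P y0 x0.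
by field; rewrite y0 x0.
Qed.

Lemma nu_h : nu * (2 * h / 3) = pi * M%:R / 3.
Proof.
rewrite /nu /nu1; have := h_neq0; move: h M%:R (pi : R) => x y P x0.
by field.
Qed.

Lemma i_tpi (x : R) : 'i%C * (2 * pi * x)%:C%C = x%:C%C * tpi R.
Proof. by apply: complexP; rewrite /tpi !ReImE /=; ring. Qed.

Lemma multiplier_lattice : cexp (- ('i%C * (nu * (- (2 * h / 3)))%:C%C)) = zeta6 R ^+ M.
Proof.
rewrite mulrN nu_h zeta6X -i_tpi; congr cexp.
have -> : 2 * pi * (M%:R / 6) = pi * M%:R / 3 :> R by field.
by rewrite rmorphN mulrN opprK.
Qed.

Lemma multiplier_centre : cexp (- ('i%C * (nu * c)%:C%C)) = 1.
Proof.
rewrite nu_c i_tpi -mulNr; apply: (etrans _ (cexp_tpi_int R (- n%:Z))).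
by rewrite rmorph_nat intrN.
Qed.

Lemma multiplier_rot : cexp (- ('i%C * (nu * (2 * c / 3))%:C%C)) = om ^+ n.
Proof.
have -> : nu * (2 * c / 3) = 2 * pi * (2 * n%:R / 3) :> R.
  have -> : nu * (2 * c / 3) = (nu * c) * (2 / 3) by ring.
  by rewrite nu_c; field.
rewrite i_tpi omX.
have -> : 2 * n%:R / 3 = - (n%:R / 3) + n%:R :> R by field.
rewrite rmorphD mulrDl opprD cexpD -[X in _ = X]mulr1; congr (_ * _).
  by rewrite rmorphN mulNr opprK.
by rewrite -mulNr rmorph_nat; apply: (etrans _ (cexp_tpi_int R (- n%:Z))); rewrite intrN.
Qed.

Lemma eigenspace_level f : smooth f ->
  joint_eigenspace r (Gamma' c) (a, b) f <->
  level nu k (zeta6 R ^+ M) (zeta6 R ^+ M) (om ^+ n) (recentred f).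
Proof.
move=> sf; have sF := (smooth_recentred f).2 sf.
have lap : central nu f -> (forall p, sub_laplacian r f p = a%:C%C * f p) <->
   (forall p, Zfield (Zbarfield (recentred f)) p = - (2 * k%:R * nu)%:C%C * recentred f p).
  move=> H; apply: (iff_trans (sub_laplacian_central r0 sf H ra_nu)).
  rewrite (Zbarfield_recentred sf) (Zfield_recentred (smooth_Zbar sf)).
  exact: recentred_eq.
have cen : (forall p, 'i%C^-1 * reeb r f p = b%:C%C * f p) <-> central nu (recentred f).
  apply: (iff_trans (reeb_central b f r0)); rewrite rb_nu.
  by rewrite /central (Tfield_recentred sf); exact: recentred_eq.
have cen' : (forall p, 'i%C^-1 * reeb r f p = b%:C%C * f p) <-> central nu f.
  by apply: (iff_trans (reeb_central b f r0)); rewrite rb_nu.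
split.
  move=> [_ /invariant_recentred [h1 h2 h3 h4] hl hb].
  have H := cen.1 hb; have H' := cen'.1 hb.
  split; last exact: (lap H').1.
    split => //; rewrite -multiplier_lattice; exact/(central_inv_trans _ _ sF H).
  by rewrite -multiplier_rot; exact/(central_inv_rot _ sF H).
move=> [[_ H h1 h2] h4 hl]; have hb := cen.2 H; have H' := cen'.1 hb.
split => //; last exact: (lap H').2.
apply/invariant_recentred; split.
- by apply/(central_inv_trans _ _ sF H); rewrite multiplier_lattice.
- by apply/(central_inv_trans _ _ sF H); rewrite multiplier_lattice.
- apply/(central_inv_trans _ _ sF H); rewrite multiplier_centre => p.
  by rewrite trans_act mul0r Im0 mulr0 add0r addr0 mul1r; case: p.
- by apply/(central_inv_rot _ sF H); rewrite multiplier_rot.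
Qed.

(** The rotation eigenvalue omega^n of the group at level k becomes
    omega^(n + k) at level 0. *)
Lemma has_dim_positive :
  has_dim (joint_eigenspace r (Gamma' c) (a, b)) (edim M ((n + k) %% 3)).
Proof.
have M0 : (0 < M)%N by rewrite muln_gt0 n0.
have nu0 : 0 < nu by rewrite mulr_gt0 ?nu1_gt0 // ltr0n.
have mod3 : ((n + k) %% 3 < 3)%N by rewrite ltn_mod.
have := has_dim_level0 R M0 mod3; rewrite -omX_mod => /(has_dim_level_iter nu0).
apply: has_dim_recentred; last exact: eigenspace_level.
  by move=> f [].
by move=> g [[]].
Qed.

End Positive.

(** Conjugation exchanges Z with its conjugate field, which preserves the
    sub-Laplacian, and reverses the sign of the central frequency. *)
Lemma eigenspaceJ r c (a b : R) f : joint_eigenspace r (Gamma' c) (a, b) f ->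
  joint_eigenspace r (Gamma' c) (a, - b) (fun p => (f p)^*%C).
Proof.
move=> [sf I L B]; split; first exact: smoothJ.
- by move=> x p Gx; rewrite I.
- move=> p; have := congr1 (@conjc R) (L p).
  rewrite /sub_laplacian ZfieldJ // ZbarfieldJ // (ZfieldJ (smooth_Z sf)) (ZbarfieldJ (smooth_Zbar sf)).
  move: (Zfield _ p : R[i]) (Zbarfield _ p : R[i]) (f p : R[i]) => u v w E.
  have -> : (a, - b).1%:C%C * w^*%C = (a%:C%C * w)^*%C.
    by apply: complexP; rewrite /= !ReImE; ring.
  by rewrite -E; apply: complexP; rewrite !ReImE; ring.
- move=> p; have := congr1 (@conjc R) (B p).
  rewrite /reeb -/(Tfield (fun p => (f p)^*%C)) -/(Tfield f) TfieldJ //.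
  move: (Tfield f p : R[i]) (f p : R[i]) => u w E.
  have -> : (a, - b).2%:C%C * w^*%C = - (b%:C%C * w)^*%C.
    by apply: complexP; rewrite /= !ReImE; ring.
  have iv : ('i%C^-1 : R[i]) = - 'i%C.
    have i0 : ('i%C : R[i]) != 0 by rewrite neq0Ci.
    by apply: (mulfI i0); rewrite divff // mulrN -expr2 sqr_i opprK.
  by rewrite -E iv; apply: complexP; rewrite !ReImE; ring.
Qed.

Lemma combination_conj (V : set fct) :
  @combination_on R[i] fct fct V (@conjc R) (fun f p => (f p)^*%C).
Proof.
move=> m a b _; apply/funext => p; rewrite !combinationE.
have -> : (\sum_i a i * b i p)^*%C = \sum_i (a i * b i p)^*%C by exact: rmorph_sum.
apply: eq_bigr => i _; move: (a i) (b i p : R[i]) => u v.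
by apply: complexP; rewrite !ReImE; ring.
Qed.

Lemma has_dim_conj r c (a b : R) m : has_dim (joint_eigenspace r (Gamma' c) (a, b)) m ->
  has_dim (joint_eigenspace r (Gamma' c) (a, - b)) m.
Proof.
have KK (f : fct) : (fun p => ((f p)^*%C)^*%C) = f by apply/funext => p; rewrite conjcK.
apply: (@has_dim_iso R[i] fct fct _ _ (@conjc R) (@conjc R)
  (fun f p => (f p)^*%C) (fun f p => (f p)^*%C)).
- exact: conjc0.
- exact: conjcK.
- exact: conjcK.
- exact: combination_conj.
- exact: combination_conj.
- by move=> f /eigenspaceJ; rewrite opprK.
- by move=> f; exact: eigenspaceJ.
- by move=> f _; exact: KK.
- by move=> f _; exact: KK.
Qed.

Lemma cos_omX (x : nat) : cos (2 * pi * x%:R / 3) = Re (om ^+ x).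
Proof.
rewrite omX -i_tpi /cexp; have -> : Re ('i%C * (2 * pi * (x%:R / 3))%:C%C) = 0.
  by rewrite !ReImE; ring.
have -> : Im ('i%C * (2 * pi * (x%:R / 3))%:C%C) = 2 * pi * x%:R / 3.
  by rewrite !ReImE; ring.
by rewrite expR0 mul1r.
Qed.

Lemma sin_omX (x : nat) : sin (2 * pi * x%:R / 3) = Im (om ^+ x).
Proof.
rewrite omX -i_tpi /cexp; have -> : Re ('i%C * (2 * pi * (x%:R / 3))%:C%C) = 0.
  by rewrite !ReImE; ring.
have -> : Im ('i%C * (2 * pi * (x%:R / 3))%:C%C) = 2 * pi * x%:R / 3.
  by rewrite !ReImE; ring.
by rewrite expR0 mul1r.
Qed.

(** The left side is the real part of omega^x plus its imaginary part divided by
    2 h, where h = sqrt 3 / 2. *)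
Lemma cos_residue (x : nat) :
  2 / Num.sqrt 3 * cos (2 * pi * x%:R / 3 - pi / 6) = 1 - (x %% 3)%:R :> R.
Proof.
have h0 := Im_omega_gt0 R; have h2 := Im_omega_sqr R; have re := Re_omega R.
have s3 : Num.sqrt 3 = 2 * h.
  have -> : 3 = (2 * h) ^+ 2 :> R by rewrite exprMn h2; field.
  by rewrite sqrtr_sqr ger0_norm // mulr_ge0 // ltW.
have o1 := cos_omX 1; have o1' := sin_omX 1; rewrite expr1 mulr1 in o1 o1'.
have e6 : 2 * pi / 3 = pi / 6 + pi / 2 :> R by field.
have c6 : cos (pi / 6) = h :> R.
  by rewrite -o1' e6 sinDpihalf.
have s6 : sin (pi / 6) = 2^-1 :> R.
  have : cos (2 * pi / 3 : R) = - sin (pi / 6) by rewrite e6 cosDpihalf.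
  by rewrite o1 re => /oppr_inj.
rewrite cosB c6 s6 s3 cos_omX sin_omX omX_mod.
have : (x %% 3 < 3)%N by rewrite ltn_mod.
have hn := h_neq0; have o2 := omega_sqr R.
case: (x %% 3)%N => [|[|[|//]]] _.
- by rewrite expr0 Re1 Im1; move: h hn => y y0; field.
- by rewrite expr1 re; move: h hn => y y0; field.
- rewrite expr2 o2; move: om hn re => o hn re; rewrite !ReImE re.
  by move: (Im o) hn => y y0; field.
Qed.

Lemma edim_formula (M n k : nat) : (0 < M)%N -> (edim M ((n + k) %% 3))%:R = 3^-1 *
  (M%:R + 4 / Num.sqrt 3 * cos (2 * pi * (n%:R + k%:R) / 3 - pi / 6)
   + 2 / Num.sqrt 3 * cos (2 * pi * (n%:R + k%:R + M%:R) / 3 - pi / 6)) :> R.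
Proof.
move=> M0; rewrite -!natrD cos_residue.
have -> : 4 / Num.sqrt 3 * cos (2 * pi * (n + k)%:R / 3 - pi / 6) =
    2 * (1 - ((n + k) %% 3)%:R) :> R.
  by rewrite -cos_residue; move: (Num.sqrt _) (cos _) => x y; ring.
rewrite -[((n + k + M) %% 3)%N]modnDml [(_ %% 3 + M)%N]addnC.
have e3 : ((n + k) %% 3 < 3)%N by rewrite ltn_mod.
move: ((n + k) %% 3)%N e3 => e e3.
have -> : (M%:R : R) = ((M + e) %/ 3)%:R * 3 + ((M + e) %% 3)%:R - e%:R.
  by rewrite -natrM -natrD -divn_eq natrD addrK.
rewrite /edim natrB; last by lia.
by rewrite natrD; move: (((M + e) %/ 3)%:R) (((M + e) %% 3)%:R) (e%:R) => x y z; field.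
Qed.

Lemma multiplicity_nonzero (N : nat) (c r : R) (n : int) (k : nat) :
  (0 < N)%N -> c = 4 * h / N%:R -> 0 < r -> n != 0 ->
  multiplicity r (Gamma' c) ((4 * k%:R + 2) * pi * `|n|%N%:R / (c * r), 2 * pi * n%:~R / (c * r))
    (edim (`|n|%N * N) ((`|n|%N + k) %% 3)).
Proof.
move=> N0 hc r0 n0; have an0 : (0 < `|n|)%N by rewrite absz_gt0.
have H := has_dim_positive k N0 an0 r0 hc; rewrite /multiplicity.
case: n {n0} an0 H => [n|n] _ //= /has_dim_conj.
have -> // : - (2 * pi * n.+1%:R / (c * r)) = 2 * pi * (Negz n)%:~R / (c * r).
by rewrite NegzE intrN -[(n.+1%:Z)%:~R]/(n.+1%:R : R) mulrN mulNr.
Qed.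

End Multiplicity.

(** * Means over a lattice cell *)

Section Cell.
Variable R : realType.
Local Notation Re := (@complex.Re R).
Local Notation Im := (@complex.Im R).
Local Notation om := (cstar_val (omega R)).
Local Notation h := (Im om).
Local Notation fct := (heis R -> R[i]^o).
Implicit Types (p : heis R) (z w : R[i]) (f g G : fct) (u v : R).

Definition cellpt u v : heis R := Heis (u%:C%C + v%:C%C * om) 0.

Lemma continuous_cell G : smooth G -> continuous (fun q : R * R => G (cellpt q.2 q.1)).
Proof.
by move=> sG; exact: (continuous_comp_all (@continuous_line R om) (smooth_cont sG)).
Qed.

Lemma cdrv_cell_u G u v : smooth G ->
  cdrv (fun u => G (cellpt u v)) u (hderive (dirx R) G (cellpt u v)).
Proof.
move=> sG; have H := hdrv_at (smooth_hdrv (@cdx R) sG) (cellpt 0 v) u.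
have E s : hline (dirx R) (cellpt 0 v) s = cellpt s v.
  rewrite /hline /cellpt /dirx; cbn [fst snd hz ht]; congr Heis; last by rewrite mulr0 addr0.
  by rewrite mulr1 rmorph0 add0r addrC.
by apply: cdrv_ext (cdrv_eq H _) => [s|]; rewrite E.
Qed.

Lemma continuous_cell_u G v : smooth G -> continuous (fun u => G (cellpt u v)).
Proof. by move=> sG u; exact: (cdrv_cont (cdrv_cell_u u v sG)). Qed.

(** The derivative in the direction of omega. *)
Definition dom G : fct := fun p =>
  (Re om)%:C%C * hderive (dirx R) G p + h%:C%C * hderive (diry R) G p.

Lemma smooth_dom G : smooth G -> smooth (dom G).
Proof.
move=> sG; apply: smoothD; apply: smoothZ; apply: smooth_hderive => //;
  [exact: cdx|exact: cdy].
Qed.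

Lemma cdrv_cell_v G u v : smooth G -> cdrv (fun v => G (cellpt u v)) v (dom G (cellpt u v)).
Proof.
move=> sG; have H := hdrv_at (smooth_chain (om, 0) sG) (cellpt u 0) v.
have E s : hline (om, 0) (cellpt u 0) s = cellpt u s.
  rewrite /hline /cellpt; cbn [fst snd hz ht]; congr Heis; last by rewrite mulr0 addr0.
  by rewrite rmorph0 mul0r addr0.
apply: cdrv_ext (cdrv_eq H _) => [s|]; rewrite E //.
by rewrite /dom [(om, 0).1]/om [(om, 0).2]/(0 : R) rmorph0 mul0r addr0.
Qed.

Definition strip G v : R[i]^o := intC (fun u => G (cellpt u v)).

Lemma cdrv_strip G v : smooth G -> cdrv (strip G) v (strip (dom G) v).
Proof.
move=> sG; apply: (@intC_param R (fun v u => G (cellpt u v)) (fun v u => dom G (cellpt u v))).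
- by move=> u y; exact: cdrv_cell_v.
- by move=> y; exact: continuous_cell_u.
- exact: (continuous_cell (smooth_dom sG)).
Qed.

Lemma continuous_strip G : smooth G -> continuous (strip G).
Proof. by move=> sG v; exact: (cdrv_cont (cdrv_strip v sG)). Qed.

(** The mean value of G over a fundamental cell of the lattice. *)
Definition cell G : R[i] := intC (strip G).

Lemma cellD f g : smooth f -> smooth g -> cell (fun p => f p + g p) = cell f + cell g.
Proof.
move=> sf sg; rewrite /cell -intCD; [|exact: contI_T (@continuous_strip _ sf)
  |exact: contI_T (@continuous_strip _ sg)].
apply: eq_intC => v _.
exact: (intCD (contI_T (@continuous_cell_u _ v sf)) (contI_T (@continuous_cell_u _ v sg))).
Qed.

Lemma cellZ (c : R[i]) f : smooth f -> cell (fun p => c * f p) = c * cell f.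
Proof.
move=> sf; rewrite /cell -intCZ; last exact: contI_T (@continuous_strip _ sf).
apply: eq_intC => v _.
exact: (intCZ c (contI_T (@continuous_cell_u _ v sf))).
Qed.

Lemma quasi0_plane f p : quasi 0 1 1 f -> f p = f (Heis (hz p) 0).
Proof.
move=> [sf H _ _]; rewrite (central_character sf H) mul0r rmorph0 mulr0 cexp0.
exact: mul1r.
Qed.

Lemma quasi0_period f w z : (w = 1 \/ w = om) -> quasi 0 1 1 f ->
  f (Heis (w + z) 0) = f (Heis z 0).
Proof.
move=> hw Q; have [_ _ h1 h2] := Q.
have E : inv_by (trans w) 1 f by case: hw => ->.
have := E (Heis z 0); rewrite trans_act mul1r => <-.
by rewrite [RHS](quasi0_plane _ Q).
Qed.

Lemma cell_dx f : quasi 0 1 1 f -> cell (hderive (dirx R) f) = 0.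
Proof.
move=> Q; have [sf _ _ _] := Q.
apply: (etrans _ (intC_cst (0 : R[i]))); apply: eq_intC => v _.
have sx : smooth (hderive (dirx R) f) by apply: smooth_hderive => //; exact: cdx.
rewrite /strip (intC_FTC (fun u => cdrv_cell_u u v sf) (@continuous_cell_u _ v sx)).
apply/eqP; rewrite subr_eq0; apply/eqP; rewrite /cellpt rmorph1 rmorph0 add0r.
by apply: quasi0_period => //; left.
Qed.

(** The integral over a period in the direction 1 is a periodic function of the
    coordinate in the direction omega, and integration commutes with its derivative. *)
Lemma cell_dom f : quasi 0 1 1 f -> cell (dom f) = 0.
Proof.
move=> Q; have [sf _ _ _] := Q.
rewrite /cell (intC_FTC (fun v => cdrv_strip v sf) (@continuous_strip _ (smooth_dom sf))).
apply/eqP; rewrite subr_eq0; apply/eqP; apply: eq_intC => u _.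
rewrite /cellpt rmorph1 rmorph0 mul1r mul0r addr0 addrC.
by apply: quasi0_period => //; right.
Qed.

Lemma cell_dy f : quasi 0 1 1 f -> cell (hderive (diry R) f) = 0.
Proof.
move=> Q; have [sf _ _ _] := Q.
have sx : smooth (hderive (dirx R) f) by apply: smooth_hderive => //; exact: cdx.
have sy : smooth (hderive (diry R) f) by apply: smooth_hderive => //; exact: cdy.
have hC : (h%:C%C : R[i]) != 0 by rewrite fmorph_eq0 h_neq0.
apply: (mulfI hC); rewrite mulr0 -(cellZ _ sy).
have := cell_dom Q; rewrite /dom.
rewrite (cellD (smoothZ (Re om)%:C%C sx) (smoothZ h%:C%C sy)) (cellZ _ sx) (cell_dx Q).
by rewrite mulr0 add0r.
Qed.

(** A total derivative of a periodic function has mean zero, which is integration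
    by parts on the torus. *)
Lemma cell_Z f : quasi 0 1 1 f -> cell (Zfield f) = 0.
Proof.
move=> Q; have [sf H _ _] := Q.
have sx : smooth (hderive (dirx R) f) by apply: smooth_hderive => //; exact: cdx.
have sy : smooth (hderive (diry R) f) by apply: smooth_hderive => //; exact: cdy.
have -> : Zfield f = fun p => 2^-1 * hderive (dirx R) f p + (- (2^-1 * 'i%C)) * hderive (diry R) f p.
  apply/funext => p; rewrite ZfieldE /Xfield /Yfield H rmorph0 mulr0 mul0r !mulr0 addr0 subr0.
  by move: (hderive _ f p : R[i]) (hderive _ f p : R[i]) => A B; ring.
rewrite (cellD (smoothZ _ sx) (smoothZ _ sy)) (cellZ _ sx) (cellZ _ sy) cell_dx // cell_dy //.
by rewrite !mulr0 addr0.
Qed.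

Lemma cell_Zbar f : quasi 0 1 1 f -> cell (Zbarfield f) = 0.
Proof.
move=> Q; have [sf H _ _] := Q.
have sx : smooth (hderive (dirx R) f) by apply: smooth_hderive => //; exact: cdx.
have sy : smooth (hderive (diry R) f) by apply: smooth_hderive => //; exact: cdy.
have -> : Zbarfield f = fun p => 2^-1 * hderive (dirx R) f p + (2^-1 * 'i%C) * hderive (diry R) f p.
  apply/funext => p; rewrite ZbarfieldE /Xfield /Yfield H rmorph0 mulr0 mul0r !mulr0 addr0 subr0.
  by move: (hderive _ f p : R[i]) (hderive _ f p : R[i]) => A B; ring.
rewrite (cellD (smoothZ _ sx) (smoothZ _ sy)) (cellZ _ sx) (cellZ _ sy) cell_dx // cell_dy //.
by rewrite !mulr0 addr0.
Qed.

Lemma quasi_mul f g : quasi 0 1 1 f -> quasi 0 1 1 g -> quasi 0 1 1 (fun p => f p * g p).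
Proof.
move=> [sf Tf af bf] [sg Tg ag bg]; have [_ MT _] := derivation_T R.
split; [exact: smoothM| |by move=> p; rewrite af ag !mul1r|by move=> p; rewrite bf bg !mul1r].
by move=> p; rewrite MT // Tf Tg rmorph0 mulr0 !mul0r mulr0 addr0.
Qed.

End Cell.

(** * Characters of the torus *)

Section Characters.
Variable R : realType.
Local Notation Re := (@complex.Re R).
Local Notation Im := (@complex.Im R).
Local Notation om := (cstar_val (omega R)).
Local Notation h := (Im om).
Local Notation fct := (heis R -> R[i]^o).
Implicit Types (p : heis R) (z w : R[i]) (f g G : fct) (u v : R) (q : int * int).

(** The element of the dual lattice whose pairings with 1 and omega are the
    coordinates of q. *)
Definition zeta q : R[i] := Complex q.1%:~R ((q.2%:~R + q.1%:~R / 2) / h).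

Definition chi_exponent q : fct := fun p =>
  (tpi R / 2) * (zeta q * (hz p)^*%C + (zeta q)^*%C * hz p).
Definition chi q : fct := fun p => cexp (chi_exponent q p).

Lemma chi_exponentE q p : chi_exponent q p = (Re (zeta q * (hz p)^*%C))%:C%C * tpi R.
Proof.
rewrite /chi_exponent half2; move: (zeta q) (hz p) => w z.
by apply: complexP; rewrite /tpi !ReImE /=; field.
Qed.

Lemma Re_zeta_cell q u v : Re (zeta q * (u%:C%C + v%:C%C * om)^*%C) = u * q.1%:~R + v * q.2%:~R.
Proof.
have rz : Re (zeta q) = q.1%:~R by [].
have iz : Im (zeta q) = (q.2%:~R + q.1%:~R / 2) / h by [].
have hn := h_neq0 R; have re := Re_omega R; move: (zeta q) rz iz => w rz iz.
move: om hn re iz => o hn re iz; rewrite !ReImE rz iz re.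
by move: (Im o) hn => y y0; field.
Qed.

Lemma chi_cell q u v : chi q (cellpt u v) = ee q.1 u * ee q.2 v.
Proof.
rewrite /chi chi_exponentE /ee -cexpD; congr cexp.
have -> : Re (zeta q * (hz (cellpt u v))^*%C) = u * q.1%:~R + v * q.2%:~R := Re_zeta_cell q u v.
have E n : (n%:~R : R[i]) = (n%:~R : R)%:C%C by rewrite rmorph_int.
rewrite !E rmorphD !rmorphM; ring.
Qed.

Lemma smooth_chi q : smooth (chi q).
Proof.
apply: smooth_cexp; apply: smoothZ; apply: smoothD; apply: smoothZ.
  by apply: smoothJ; exact: smooth_hz.
exact: smooth_hz.
Qed.

Lemma hderive_chi d q p : hderive d (chi q) p =
  (tpi R / 2) * (zeta q * d.1^*%C + (zeta q)^*%C * d.1) * chi q p.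
Proof.
have h0 : hdrv d (chi_exponent q) (fun=> (tpi R / 2) * (zeta q * d.1^*%C + (zeta q)^*%C * d.1)).
  by move=> x; apply: cdrvZ; apply: cdrvD; apply: cdrvZ;
    [exact: (hdrvJ (@hdrv_hz R d))|exact: hdrv_hz].
by rewrite (hdrvE (hdrv_cexp h0)).
Qed.

Lemma central_chi q : central 0 (chi q).
Proof.
move=> p; rewrite /Tfield hderive_chi [(dirt R).1]/(0 : R[i]) !rmorph0.
by rewrite !(mulr0, addr0, mul0r).
Qed.

Lemma Z_chi q : Zfield (chi q) = fun p => (tpi R / 2) * (zeta q)^*%C * chi q p.
Proof.
apply/funext => p; rewrite ZfieldE /Xfield /Yfield central_chi !hderive_chi.
rewrite /dirx /diry; cbn [fst snd]; rewrite rmorph0 mulr0 mul0r !mulr0 addr0 subr0.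
have -> : ((1 : R[i])^*%C) = 1 by apply: complexP; rewrite !ReImE ?oppr0.
have -> : (('i%C : R[i])^*%C) = - 'i%C by apply: complexP; rewrite !ReImE ?oppr0.
have i2 : 'i%C * 'i%C = -1 :> R[i] by rewrite -expr2 sqr_i.
have n2 : (2 : R[i]) != 0 by rewrite pnatr_eq0.
move: (chi q p : R[i]) (tpi R) ((zeta q)^*%C : R[i]) (zeta q) => A T w w'.
by field: i2.
Qed.

Lemma Zbar_chi q : Zbarfield (chi q) = fun p => (tpi R / 2) * zeta q * chi q p.
Proof.
apply/funext => p; rewrite ZbarfieldE /Xfield /Yfield central_chi !hderive_chi.
rewrite /dirx /diry; cbn [fst snd]; rewrite rmorph0 mulr0 mul0r !mulr0 addr0 subr0.
have -> : ((1 : R[i])^*%C) = 1 by apply: complexP; rewrite !ReImE ?oppr0.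
have -> : (('i%C : R[i])^*%C) = - 'i%C by apply: complexP; rewrite !ReImE ?oppr0.
have i2 : 'i%C * 'i%C = -1 :> R[i] by rewrite -expr2 sqr_i.
have n2 : (2 : R[i]) != 0 by rewrite pnatr_eq0.
move: (chi q p : R[i]) (tpi R) ((zeta q)^*%C : R[i]) (zeta q) => A T w w'.
by field: i2.
Qed.

Lemma chi_trans q w (m : int) : Re (zeta q * w^*%C) = m%:~R -> inv_by (trans w) 1 (chi q).
Proof.
move=> hm p; rewrite mul1r /chi !chi_exponentE trans_act.
have -> : hz (Heis (w + hz p) (ht p + 2 * Im (w * (hz p)^*%C))) = w + hz p by [].
have -> : Re (zeta q * (w + hz p)^*%C) = m%:~R + Re (zeta q * (hz p)^*%C).
  by rewrite -hm; move: (zeta q) (hz p) => a z; rewrite !ReImE; ring.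
rewrite rmorphD mulrDl cexpD.
have -> : cexp ((m%:~R : R)%:C%C * tpi R) = 1.
  by apply: (etrans _ (cexp_tpi_int R m)); rewrite rmorph_int.
exact: mul1r.
Qed.

Lemma quasi_chi q : quasi 0 1 1 (chi q).
Proof.
split; [exact: smooth_chi|exact: central_chi| |].
  apply: (chi_trans (m := q.1)).
  have := Re_zeta_cell q 1 0; rewrite rmorph1 rmorph0 mul0r addr0 mul1r mul0r addr0.
  by [].
apply: (chi_trans (m := q.2)).
by have := Re_zeta_cell q 0 1; rewrite rmorph1 rmorph0 mul1r add0r mul0r add0r mul1r.
Qed.

Definition negq q : int * int := (- q.1, - q.2).

Definition fourier f q : R[i] := cell (fun p => f p * chi (negq q) p).

Lemma fourier_cell f a b : smooth f ->
  fourier f (a, b) = coef (strip (fun p => f p * chi (- a, 0) p)) b.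
Proof.
move=> sf; have sg : smooth (fun p => f p * chi (- a, 0) p) by apply: smoothM => //; exact: smooth_chi.
apply: eq_intC => v _.
rewrite mulrC /strip.
have -> := esym (intCZ (ee (- b) v) (contI_T (@continuous_cell_u R _ v sg))).
apply: eq_intC => u _; rewrite !chi_cell ee0.
have K (x y t : R[i]) : x * (y * t) = t * (x * (y * 1)) by ring.
exact: K.
Qed.

Lemma fourier_chi q q' : fourier (chi q) q' = (q == q')%:R.
Proof.
case: q q' => a b [a' b'].
rewrite /fourier /cell.
rewrite (eq_intC (G := fun v => intC (ee (a - a')) * ee (b - b') v)); last first.
  move=> v _; rewrite mulrC -(intCZ (ee (b - b') v) (contI_ee (a - a'))).
  apply: eq_intC => u _; rewrite !chi_cell /= !eeD.
  have K (x y s t : R[i]) : x * y * (s * t) = y * t * (x * s) by ring.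
  exact: K.
rewrite (intCZ (intC (ee (a - a'))) (contI_ee (b - b'))) !intC_ee !subr_eq0.
by rewrite -natrM mulnb.
Qed.

Lemma fourierD f g q : smooth f -> smooth g ->
  fourier (fun p => f p + g p) q = fourier f q + fourier g q.
Proof.
move=> sf sg; have sc := smooth_chi (negq q).
rewrite /fourier -(cellD (smoothM sf sc) (smoothM sg sc)).
by congr cell; apply/funext => p; exact: mulrDl.
Qed.

Lemma fourierZ (c : R[i]) f q : smooth f -> fourier (fun p => c * f p) q = c * fourier f q.
Proof.
move=> sf; have sc := smooth_chi (negq q).
rewrite /fourier -(cellZ c (smoothM sf sc)).
by congr cell; apply/funext => p; apply: esym; exact: (@mulrA R[i]).
Qed.

Lemma fourier_sum (I : eqType) (s : seq I) (a : I -> R[i]) (F : I -> fct) q :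
  (forall i, smooth (F i)) ->
  fourier (fun p => \sum_(i <- s) a i * F i p) q = \sum_(i <- s) a i * fourier (F i) q.
Proof.
move=> sF; have S0 (s' : seq I) : smooth (fun p => \sum_(i <- s') a i * F i p).
  by apply: smooth_sum => i _; exact: smoothZ.
elim: s => [|i s IH].
  rewrite big_nil; have -> : (fun p => \sum_(i <- [::]) a i * F i p) = (fun p => 0 * chi q p).
    by apply/funext => p; rewrite big_nil mul0r.
  by rewrite fourierZ ?mul0r //; exact: smooth_chi.
have -> : (fun p => \sum_(i <- i :: s) a i * F i p) =
    (fun p => a i * F i p + \sum_(i <- s) a i * F i p).
  by apply/funext => p; rewrite big_cons.
by rewrite (fourierD _ (smoothZ (a i) (sF i)) (S0 s)) (fourierZ _ _ (sF i)) big_cons IH.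
Qed.

Lemma fourier_chi_sum (s : seq (int * int)) (c : int * int -> R[i]) q : uniq s ->
  fourier (fun p => \sum_(q' <- s) c q' * chi q' p) q = if q \in s then c q else 0.
Proof.
move=> us; rewrite fourier_sum; last by move=> i; exact: smooth_chi.
case: ifP => qs.
  rewrite (bigD1_seq q) //= fourier_chi eqxx mulr1 big1 ?addr0 // => i /negbTE iq.
  by rewrite fourier_chi iq mulr0.
rewrite big_seq_cond big1 // => i; rewrite andbT => is_; rewrite fourier_chi.
by case: eqVneq => [E|_]; rewrite ?mulr0 //; rewrite -E is_ in qs.
Qed.

Lemma real_zero_limit (g : R -> R) : {for 0, continuous (g : R^o -> R^o)} ->
  (forall s, 0 < s < 1 -> g s = 0) -> g 0 = 0.
Proof.
move=> cg H; apply: contrapT => /eqP g0.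
have : \forall s \near (0 : R), g s != 0 by exact: (cvgr_neq0 _ cg g0).
move=> /nbhs_ballP[e /= e0 He].
pose s := Num.min (e / 2) (2^-1).
have s0 : 0 < s by rewrite lt_min !divr_gt0 //= invr_gt0.
have se : s < e by rewrite gt_min ltr_pdivrMr // ltr_pMr // ltr1n.
have s1 : s < 1 by rewrite gt_min invf_lt1 ?ltr1n ?orbT.
have := He s; rewrite /ball /= sub0r normrN gtr0_norm // => /(_ se).
by rewrite H ?eqxx // s0 s1.
Qed.

Lemma zero_limit (F : R -> R[i]) (l : R[i]) : cdrv F 0 l -> (forall s, 0 < s < 1 -> F s = 0) -> F 0 = 0.
Proof.
move=> dF H; have /cvg_complexP[c1 c2] := cdrv_cont dF.
by apply: complexP; rewrite ?Re0 ?Im0;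
  [apply: (real_zero_limit c1)|apply: (real_zero_limit c2)] => s /H ->.
Qed.

(** Uniqueness of Fourier coefficients is applied in both lattice directions; it
    gives the vanishing in the open cell, which extends to its boundary by
    continuity and to the plane by periodicity. *)
Theorem fourier_zero f : quasi 0 1 1 f -> (forall q, fourier f q = 0) -> f = fun=> 0.
Proof.
move=> Q H; have [sf _ _ _] := Q.
have sg a : smooth (fun p => f p * chi (- a, 0) p) by apply: smoothM => //; exact: smooth_chi.
have inner u v : 0 < u < 1 -> 0 < v < 1 -> f (cellpt u v) = 0.
  move=> u01 v01; apply: (fourier_unique (F := fun u => f (cellpt u v)) _ _ u01).
    by move=> x; exact: (cdrv_cell_u x v sf).
  move=> a; have K b : coef (strip (fun p => f p * chi (- a, 0) p)) b = 0.
    by rewrite -fourier_cell.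
  have := fourier_unique (fun x => cdrv_strip x (sg a)) K v01.
  move=> E; apply: (etrans _ E); apply: eq_intC => u' _.
  by rewrite chi_cell ee0 mulr1.
have edge u v : 0 <= u < 1 -> 0 < v < 1 -> f (cellpt u v) = 0.
  case/andP; rewrite le_eqVlt => /orP[/eqP <-|u0] u1 v01; last by apply: inner; rewrite ?u0.
  by apply: (zero_limit (cdrv_cell_u 0 v sf)) => s s01; exact: inner.
have all u v : 0 <= u < 1 -> 0 <= v < 1 -> f (cellpt u v) = 0.
  move=> u01; case/andP; rewrite le_eqVlt => /orP[/eqP <-|v0] v1; last by apply: edge; rewrite ?v0.
  by apply: (zero_limit (cdrv_cell_v u 0 sf)) => s s01; exact: edge.
have P1 z : f (Heis (1 + z) 0) = f (Heis z 0) by apply: quasi0_period => //; left.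
have Pom z : f (Heis (om + z) 0) = f (Heis z 0) by apply: quasi0_period => //; right.
have shift w : (forall z, f (Heis (w + z) 0) = f (Heis z 0)) ->
    forall (n : int) z, f (Heis (n%:~R * w + z) 0) = f (Heis z 0).
  move=> Pw n; elim/int_ind: n => [z|n IH z|n IH z]; first by rewrite mul0r add0r.
    by rewrite intS intrD mulrDl mul1r -addrA Pw.
  rewrite -(Pw (_ + z)); have -> : w + ((- n.+1%:Z)%:~R * w + z) = (- n%:Z)%:~R * w + z.
    by rewrite intS opprD intrD mulrDl mulN1r !addrA addrN add0r.
  exact: IH.
have top u v : 0 <= u <= 1 -> 0 <= v <= 1 -> f (cellpt u v) = 0.
  case/andP=> u0; rewrite le_eqVlt => /orP[/eqP ->|u1].
    rewrite /cellpt rmorph1 P1 => /andP[v0]; rewrite le_eqVlt => /orP[/eqP ->|v1].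
      rewrite rmorph1 mul1r; have := Pom 0; rewrite addr0 => ->.
      have := all 0 0; rewrite /cellpt rmorph0 mul0r addr0; apply; rewrite lexx ltr01 //.
    have := all 0 v; rewrite /cellpt rmorph0 add0r; apply; [by rewrite lexx ltr01|by rewrite v0].
  case/andP=> v0; rewrite le_eqVlt => /orP[/eqP ->|v1]; last by apply: all; rewrite ?u0 ?v0.
  rewrite /cellpt rmorph1 mul1r addrC Pom.
  have := all u 0; rewrite /cellpt rmorph0 mul0r addr0; apply; [by rewrite u0|by rewrite lexx ltr01].
apply/funext => p; rewrite (quasi0_plane p Q).
have [a [b [u [v [u01 v01 ->]]]]] := lattice_reduce (hz p).
have := shift 1 P1 a (b%:~R * om + (u%:C%C + v%:C%C * om)); rewrite mulr1 => ->.
by rewrite (shift om Pom); exact: top.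
Qed.

(** Integrating by parts twice moves the fields to the character, which is an
    eigenfunction of both. *)
Lemma fourier_laplacian f q : quasi 0 1 1 f ->
  fourier (Zfield (Zbarfield f)) q = - (pi ^+ 2 * cmod (zeta q) ^+ 2)%:C%C * fourier f q.
Proof.
move=> Q; have [sf _ _ _] := Q.
have Qc := quasi_chi (negq q); have sc := smooth_chi (negq q).
have Qb := quasi_Zbar Q; have [sb _ _ _] := Qb.
have [_ ZM _] := derivation_Z R; have [_ BM _] := derivation_Zbar R.
have sZb := smooth_Z sb.
have zN : zeta (negq q) = - zeta q.
  by apply: complexP; rewrite /zeta /negq /= !intrN // mulNr -opprD mulNr.
set T := tpi R / 2.
have e1 : fourier (Zfield (Zbarfield f)) q = T * (zeta q)^*%C * fourier (Zbarfield f) q.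
  have := cell_Z (quasi_mul Qb Qc); rewrite (ZM _ _ sb sc) Z_chi zN.
  have -> : (fun p => Zfield (Zbarfield f) p * chi (negq q) p + Zbarfield f p *
      (tpi R / 2 * (- zeta q)^*%C * chi (negq q) p)) =
     (fun p => Zfield (Zbarfield f) p * chi (negq q) p +
        - (T * (zeta q)^*%C) * (Zbarfield f p * chi (negq q) p)).
    apply/funext => p; congr (_ + _); rewrite -/T.
    have -> : (- zeta q)^*%C = - (zeta q)^*%C.
      by move: (zeta q) => w; apply: complexP; rewrite !ReImE.
    by move: (Zbarfield f p : R[i]) (chi _ p : R[i]) T ((zeta q)^*%C : R[i]) => A B C D; ring.
  rewrite (cellD (smoothM sZb sc) (smoothZ _ (smoothM sb sc))) (cellZ _ (smoothM sb sc)).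
  by move/eqP; rewrite addr_eq0 mulNr opprK => /eqP.
have e2 : fourier (Zbarfield f) q = T * zeta q * fourier f q.
  have := cell_Zbar (quasi_mul Q Qc); rewrite (BM _ _ sf sc) Zbar_chi zN.
  have -> : (fun p => Zbarfield f p * chi (negq q) p + f p *
      (tpi R / 2 * (- zeta q) * chi (negq q) p)) =
     (fun p => Zbarfield f p * chi (negq q) p +
        - (T * zeta q) * (f p * chi (negq q) p)).
    apply/funext => p; congr (_ + _); rewrite -/T.
    by clear e1; move: (f p : R[i]) (chi _ p : R[i]) T (zeta q : R[i]) => A B C D; ring.
  rewrite (cellD (smoothM sb sc) (smoothZ _ (smoothM sf sc))) (cellZ _ (smoothM sf sc)).
  by move/eqP; rewrite addr_eq0 mulNr opprK => /eqP.
rewrite e1 e2 mulrA; congr (_ * _).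
rewrite cmod_sqr; move: (zeta q) => w.
have -> : T = Complex 0 pi by rewrite /T half2; apply: complexP; rewrite /tpi !ReImE /=; field.
by apply: complexP; rewrite !ReImE /=; ring.
Qed.

End Characters.

(** * Rotation orbits in the dual lattice *)

Section FlatEigenvalues.
Variable R : realType.
Local Notation Re := (@complex.Re R).
Local Notation Im := (@complex.Im R).
Local Notation om := (cstar_val (omega R)).
Local Notation h := (Im om).
Local Notation fct := (heis R -> R[i]^o).
Implicit Types (p : heis R) (z w : R[i]) (f g G : fct) (q : int * int).

Lemma dual_lattice_zeta (w : R[i]) :
  dual_lattice (plane_lattice (omega R)) w <-> exists q, w = zeta R q.
Proof.
split=> [H|[q ->] z [a [b ->]]].
  have /intrP[a Ha] := H 1 (ex_intro _ 1 (ex_intro _ 0 (esym (etrans (congr1 _ (mul0r _)) (addr0 _))))).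
  have /intrP[b Hb] := H om (ex_intro _ 0 (ex_intro _ 1 (esym (etrans (add0r _) (mul1r _))))).
  exists (a, b); have hn := h_neq0 R; have re := Re_omega R.
  have E1 : Re w = a%:~R by rewrite -Ha ReM ReJ ImJ Re1 Im1 oppr0 mulr1 mulr0 subr0.
  apply: complexP; first exact: E1.
  have : Re w * - 2^-1 + Im w * h = b%:~R.
    by rewrite -Hb; move: om re => o re; rewrite !ReImE re; ring.
  have -> : Im (zeta R (a, b)) = (b%:~R + a%:~R / 2) / h by [].
  move=> <-; rewrite E1; move: h hn => y y0; field; exact: y0.
have E n : (n%:~R : R[i]) = (n%:~R : R)%:C%C by rewrite rmorph_int.
by rewrite !E Re_zeta_cell rpredD ?rpredM ?intr_int.
Qed.

Lemma cmod_zeta q : cmod (zeta R q) ^+ 2 =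
  4 / 3 * (q.1%:~R ^+ 2 + q.1%:~R * q.2%:~R + q.2%:~R ^+ 2).
Proof.
have rz : Re (zeta R q) = q.1%:~R by [].
have iz : Im (zeta R q) = (q.2%:~R + q.1%:~R / 2) / h by [].
rewrite cmod_sqr rz iz; have := Im_omega_sqr R; move: h => y y2.
move: (q.1%:~R : R) (q.2%:~R : R) => a b.
by rewrite expr_div_n y2 invf_div; field.
Qed.

Lemma zeta_inj : injective (zeta R).
Proof.
move=> [a b] [a' b'] E; have E1 : a = a' := intr_inj (congr1 Re E).
have E2 : (b%:~R + a%:~R / 2) / h = (b'%:~R + a'%:~R / 2) / h := congr1 Im E.
have hn := h_neq0 R; move: E2; rewrite E1 => E2.
have := mulIf (invr_neq0 hn) E2 => /addIr /intr_inj -> //.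
Qed.

(** Multiplication by omega in the coordinates of [zeta]. *)
Definition rho q : int * int := (- q.1 - q.2, q.1).

Lemma rho3 q : rho (rho (rho q)) = q.
Proof. by case: q => a b; rewrite /rho /=; congr pair; lia. Qed.

Lemma rho_inj : injective rho.
Proof. by move=> q q' E; rewrite -(rho3 q) E rho3. Qed.

Lemma cmod_rho q : cmod (zeta R (rho q)) ^+ 2 = cmod (zeta R q) ^+ 2.
Proof.
rewrite !cmod_zeta /rho; cbn [fst snd]; rewrite intrB intrN; congr (_ * _).
by move: (q.1%:~R : R) (q.2%:~R : R) => a b; ring.
Qed.

Lemma chi_rot q p : chi (rho q) (sim_act (rot R) p) = chi q p.
Proof.
have hr : hz (sim_act (rot R) p) = om * hz p by rewrite rot_act.
have E w : Re w = q.1%:~R -> Im w = (q.2%:~R + q.1%:~R / 2) / h ->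
   Re (zeta R (rho q) * (om * hz p)^*%C) = Re (w * (hz p)^*%C).
  have r1 : Re (zeta R (rho q)) = - q.1%:~R - q.2%:~R by rewrite -intrN -intrB.
  have r2 : Im (zeta R (rho q)) = (q.1%:~R + (- q.1%:~R - q.2%:~R) / 2) / h.
    by rewrite -r1.
  have hn := h_neq0 R; have h2 := Im_omega_sqr R; have re := Re_omega R.
  move: (zeta R (rho q)) r1 r2 => w' r1 r2 w1 w2.
  move: (hz p) => z; move: om hn h2 re r2 w2 => o hn h2 re r2 w2.
  rewrite !ReImE r1 r2 w1 w2 re; move: (Im o) hn h2 => y y0 y2.
  have yy : y * y = 3 / 4 by rewrite -expr2.
  have y1 : y / y = 1 by rewrite divff.
  have y3 : y = 3 / 4 / y by rewrite -yy mulfK.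
  move: (y^-1) (Re z) (Im z) (q.1%:~R : R) (q.2%:~R : R) y1 y3 => k x t a b y1 y3.
  clear - y1 y3; apply/eqP; rewrite -subr_eq0; apply/eqP.
  (* Here k = 1 / y, and the difference is a combination of y k = 1 and y = 3/4 k. *)
  transitivity ((y * k - 1) * (a + (- a - b) / 2) * x + (a + b) * t * (y - 3 / 4 * k)); first by field.
  by rewrite y1 -y3 !subrr; ring.
by rewrite /chi !chi_exponentE hr (E (zeta R q)).
Qed.

Lemma chi_rot' q p : chi q (sim_act (rot R) p) = chi (rho (rho q)) p.
Proof. by rewrite -[in LHS](rho3 q) chi_rot. Qed.

(** One representative in each rotation orbit: writing the orbit as the cyclic
    shifts of a triple with sum zero, the largest entry comes first, and in case of
    a tie the last of the two in the cyclic order. *)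
Definition sector q : bool := (q.2 < q.1) && (- q.1 - q.2 <= q.1).

Lemma sector_cover q : q != (0, 0) -> [|| sector q, sector (rho q) | sector (rho (rho q))].
Proof.
case: q => a b; rewrite -pair_eqE /sector /rho /= => H.
apply/or3P.
have [h1|h1] := boolP ((b < a) && (- a - b <= a)); first exact: Or31.
have [h2|h2] := boolP ((a < - a - b) && (- (- a - b) - a <= - a - b)); first exact: Or32.
by apply: Or33; lia.
Qed.

Lemma sector_rho q : sector q -> sector (rho q) = false.
Proof. by case: q => a b; rewrite /sector /rho /=; lia. Qed.

Lemma sector_rho2 q : sector q -> sector (rho (rho q)) = false.
Proof. by case: q => a b; rewrite /sector /rho /=; lia. Qed.

Section Eigenvalue.
Variables (r kappa : R).
Hypotheses (r0 : 0 < r) (kappa0 : 0 < kappa).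

Definition on_circle q : bool := pi ^+ 2 * cmod (zeta R q) ^+ 2 / r == kappa.

Lemma on_circle_rho q : on_circle (rho q) = on_circle q.
Proof. by rewrite /on_circle cmod_rho. Qed.

(** The form 4/3 (a^2 + a b + b^2) is at least a^2 and at least b^2. *)
Lemma circle_bound q : on_circle q -> forall B : nat, kappa * r < B%:R ->
  (absz q.1 < B)%N /\ (absz q.2 < B)%N.
Proof.
rewrite /on_circle => /eqP E B hB; have pp := pi_ge2 R.
have rn : r != 0 by rewrite gt_eqF.
have E2 : pi ^+ 2 * cmod (zeta R q) ^+ 2 = kappa * r by rewrite -E divfK.
have c0 : 0 <= cmod (zeta R q) ^+ 2 by rewrite exprn_ge0 // cmod_ge0.
have le : cmod (zeta R q) ^+ 2 <= kappa * r.
  by rewrite -E2 ler_peMl // expr2; move: (pi : R) pp => P pp; nra.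
rewrite cmod_zeta in le.
have K (m : int) : (m%:~R : R) ^+ 2 <= kappa * r -> (absz m < B)%N.
  move=> hm; rewrite -(ltr_nat R); apply: le_lt_trans hB; apply: le_trans hm.
  have -> : (m%:~R : R) ^+ 2 = (absz m)%:R ^+ 2.
    by rewrite natr_absz intr_norm -normrX ger0_norm // sqr_ge0.
  by rewrite -natrX ler_nat; case: (absz m) => // n; rewrite expnS leq_pmulr // expn_gt0.
move: le => le; split; apply: K; apply: le_trans le; move: (q.1%:~R : R) (q.2%:~R : R) => a b.
  have -> : 4 / 3 * (a ^+ 2 + a * b + b ^+ 2) = a ^+ 2 + (a + 2 * b) ^+ 2 / 3 by field.
  by rewrite lerDl divr_ge0 ?sqr_ge0.
have -> : 4 / 3 * (a ^+ 2 + a * b + b ^+ 2) = b ^+ 2 + (b + 2 * a) ^+ 2 / 3 by field.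
by rewrite lerDl divr_ge0 ?sqr_ge0.
Qed.

Lemma circle_seq : exists s : seq (int * int), uniq s /\ forall q, (q \in s) = on_circle q.
Proof.
have [B hB] : exists B : nat, kappa * r < B%:R.
  by exists (Num.bound (kappa * r)); apply: archi_boundP; rewrite mulr_ge0 // ltW.
pose I := [seq i%:Z - B%:Z | i <- iota 0 (B + B)].
pose s := undup [seq q <- [seq (a, b) | a <- I, b <- I] | on_circle q].
exists s; split; first exact: undup_uniq.
move=> q; rewrite mem_undup mem_filter; case: (boolP (on_circle q)) => //= hq.
have [b1 b2] := circle_bound hq hB.
have mI (m : int) : (absz m < B)%N -> m \in I.
  move=> hm; apply/mapP; exists (absz (m + B%:Z)); last by lia.
  by rewrite mem_iota; lia.
by apply/allpairsP; exists q; rewrite !mI //; case: q {hq b1 b2}.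
Qed.

Lemma circle_nonzero : on_circle (0, 0) = false.
Proof.
apply/negbTE; rewrite /on_circle cmod_zeta expr0n mulr0 !addr0 !mulr0 mul0r.
by rewrite eq_sym gt_eqF.
Qed.

(** The orbits have exactly three elements, since 0 is not on the circle. *)
Lemma perm_sector s t : uniq s -> (forall q, (q \in s) = on_circle q) ->
  t = [seq q <- s | sector q] ->
  perm_eq s (t ++ (map rho t ++ map rho (map rho t))).
Proof.
move=> us hs tE.
have ut : uniq t by rewrite tE filter_uniq.
have tP q : (q \in t) = sector q && on_circle q by rewrite tE mem_filter hs.
have t1 q : (q \in map rho t) = (rho (rho q) \in t).
  by rewrite -[in LHS](rho3 q) mem_map //; exact: rho_inj.
have t2 q : (q \in map rho (map rho t)) = (rho q \in t).
  by rewrite -[in LHS](rho3 q) mem_map ?t1 ?rho3 //; exact: rho_inj.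
apply: uniq_perm => //.
  rewrite !cat_uniq ut !map_inj_uniq ?ut //=; try exact: rho_inj.
  rewrite andbT; apply/andP; split; apply/hasPn => q /=.
    rewrite mem_cat t1 t2 !tP => /orP[/andP[h1 _]|/andP[h1 _]]; apply/negP => /andP[h2 _].
      by rewrite (sector_rho2 h2) in h1.
    by rewrite (sector_rho h2) in h1.
  rewrite t1 t2 !tP => /andP[h1 _]; apply/negP => /andP[h2 _].
  by rewrite (sector_rho h1) in h2.
move=> q; rewrite !mem_cat t1 t2 !tP !on_circle_rho hs.
case: (boolP (on_circle q)) => hq; rewrite ?andbF ?andbT //.
have q0 : q != (0, 0) by apply: contraTneq hq => ->; rewrite circle_nonzero.
by have := sector_cover q0; case: (sector q) => //=; rewrite orbC => ->.
Qed.

End Eigenvalue.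
End FlatEigenvalues.

(** * Multiplicities with zero central frequency *)

Section FlatMultiplicity.
Variable R : realType.
Local Notation Re := (@complex.Re R).
Local Notation Im := (@complex.Im R).
Local Notation om := (cstar_val (omega R)).
Local Notation h := (Im om).
Local Notation fct := (heis R -> R[i]^o).
Local Notation tau := (trans (centre R)).
Implicit Types (p : heis R) (z w : R[i]) (f g G : fct) (q : int * int).

Variables (r kappa : R).
Hypotheses (r0 : 0 < r) (kappa0 : 0 < kappa).

(** The recentred eigenspace for central frequency zero: here the two products of Z
    and its conjugate coincide. *)
Definition flat : set fct := [set f | [/\ quasi 0 1 1 f, inv_by (rot R) 1 f &
  forall p, Zfield (Zbarfield f) p = - (r * kappa)%:C%C * f p]].

Lemma eigenspace_flat c f : smooth f ->
  joint_eigenspace r (Gamma' c) (kappa, 0) f <-> flat (recentred f).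
Proof.
move=> sf; have sF := (smooth_recentred f).2 sf.
have cen : (forall p, 'i%C^-1 * reeb r f p = 0%:C%C * f p) <-> central 0 f.
  by apply: (iff_trans (reeb_central 0 f r0)); rewrite mulr0.
have cen' : central 0 f <-> central 0 (recentred f).
  by rewrite /central (Tfield_recentred sf); exact: recentred_eq.
have lap : central 0 f -> (forall p, sub_laplacian r f p = kappa%:C%C * f p) <->
   (forall p, Zfield (Zbarfield (recentred f)) p = - (r * kappa)%:C%C * recentred f p).
  move=> H; rewrite (Zbarfield_recentred sf) (Zfield_recentred (smooth_Zbar sf)).
  rewrite -recentred_eq.
  have E p : Zbarfield (Zfield f) p = Zfield (Zbarfield f) p.
    have := commutator_central p sf H; rewrite mulr0 rmorph0 mul0r => /eqP.
    by rewrite subr_eq0 => /eqP.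
  have rC : (r%:C%C : R[i]) != 0 by rewrite fmorph_eq0 gt_eqF.
  have n2 : (2 : R[i]) != 0 by rewrite pnatr_eq0.
  have r2 : (((2 * r)^-1)%:C%C : R[i]) = (2 * r%:C%C)^-1 by rewrite fmorphV rmorphM rmorphMn.
  have rk : ((r * kappa)%:C%C : R[i]) = r%:C%C * kappa%:C%C by rewrite rmorphM.
  rewrite /sub_laplacian; split=> K p; have := K p; rewrite E r2 rk;
    move: (Zfield (Zbarfield f) p : R[i]) (f p : R[i]) (kappa%:C%C : R[i]) (r%:C%C : R[i]) rC
      => Z F kc rc rC K1.
    have -> : Z = - rc * (- (2 * rc)^-1 * (Z + Z)) by field.
    by rewrite K1; ring.
  by rewrite K1; field.
have triv s : cexp (- ('i%C * (0 * s)%:C%C)) = 1 :> R[i].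
  by rewrite mul0r rmorph0 mulr0 oppr0 cexp0.
split.
  move=> [_ /invariant_recentred [h1 h2 h3 h4] hl hb].
  have H' := cen.1 hb; have H := cen'.1 H'.
  split; last exact: (lap H').1.
    split => //.
      by have := central_inv_trans 1 (- (2 * h / 3)) sF H; rewrite triv => -[E _]; exact: E.
    by have := central_inv_trans om (- (2 * h / 3)) sF H; rewrite triv => -[E _]; exact: E.
  by have := central_inv_rot (2 * c / 3) sF H; rewrite triv => -[E _]; exact: E.
move=> [[_ H h1 h2] h4 hl]; have H' := cen'.2 H.
split => //; [|exact: (lap H').2|exact: cen.2].
apply/invariant_recentred; split.
- by apply/(central_inv_trans _ _ sF H); rewrite triv.
- by apply/(central_inv_trans _ _ sF H); rewrite triv.
- apply/(central_inv_trans _ _ sF H); rewrite triv => p.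
  by rewrite trans_act mul0r Im0 mulr0 add0r addr0 mul1r; case: p.
- by apply/(central_inv_rot _ sF H); rewrite triv.
Qed.

Lemma has_dim_flat c m : has_dim flat m -> has_dim (joint_eigenspace r (Gamma' c) (kappa, 0)) m.
Proof.
apply: has_dim_recentred; last exact: (eigenspace_flat c).
  by move=> f [].
by move=> g [[]].
Qed.

Lemma quasi0_D f g : quasi 0 1 1 f -> quasi 0 1 1 g -> quasi 0 1 1 (fun p => f p + g p).
Proof.
move=> [sf Tf af bf] [sg Tg ag bg]; have [DT _ _] := derivation_T R.
split; [exact: smoothD| |by move=> p; rewrite af ag !mul1r|by move=> p; rewrite bf bg !mul1r].
by move=> p; rewrite DT // Tf Tg rmorph0 mulr0 !mul0r addr0.
Qed.

Lemma quasi0_sum (s : seq (int * int)) (c : int * int -> R[i]) :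
  quasi 0 1 1 (fun p => \sum_(q <- s) c q * chi q p).
Proof.
elim: s => [|q s IH].
  have -> : (fun p => \sum_(q <- [::]) c q * chi q p) = (fun p => 0 * chi (0, 0) p).
    by apply/funext => p; rewrite big_nil mul0r.
  exact: (quasi_scale 0 (quasi_chi R (0, 0))).
have -> : (fun p => \sum_(q' <- q :: s) c q' * chi q' p) =
    (fun p => c q * chi q p + \sum_(q' <- s) c q' * chi q' p).
  by apply/funext => p; rewrite big_cons.
exact: (quasi0_D (quasi_scale (c q) (quasi_chi R q)) IH).
Qed.

Lemma fourier_flat f q : flat f -> ~~ on_circle r kappa q -> fourier f q = 0.
Proof.
move=> [Q _ E] hq; have [sf _ _ _] := Q.
have := fourier_laplacian q Q.
have -> : Zfield (Zbarfield f) = fun p => - (r * kappa)%:C%C * f p by apply/funext.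
rewrite fourierZ // => /eqP; rewrite -subr_eq0 -mulrBl mulf_eq0 => /orP[|/eqP //].
rewrite opprK addrC subr_eq0 => /eqP e.
move/negP: hq; case; rewrite /on_circle.
have -> : pi ^+ 2 * cmod (zeta R q) ^+ 2 = r * kappa by exact: (congr1 Re e).
by rewrite [r * kappa]mulrC mulfK // gt_eqF.
Qed.

Section Circle.
Variable s : seq (int * int).
Hypotheses (us : uniq s) (hs : forall q, (q \in s) = on_circle r kappa q).

Lemma flat_expansion f p : flat f -> f p = \sum_(q <- s) fourier f q * chi q p.
Proof.
move=> Ff; have [Q _ _] := Ff; have [sf _ _ _] := Q.
pose S : fct := fun p => \sum_(q <- s) fourier f q * chi q p.
have QS : quasi 0 1 1 S := quasi0_sum s (fourier f); have [sS _ _ _] := QS.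
have QG := quasi0_D Q (quasi_scale (-1) QS).
have Z q : fourier (fun p => f p + (-1) * S p) q = 0.
  rewrite (fourierD _ sf (smoothZ (-1) sS)) (fourierZ _ _ sS) (fourier_chi_sum _ _ us) hs.
  case: (boolP (on_circle r kappa q)) => hq; first by rewrite mulN1r addrN.
  by rewrite (fourier_flat Ff hq) mulr0 addr0.
have := congr1 (fun F : fct => F p) (fourier_zero QG Z).
by move/eqP; rewrite mulN1r subr_eq0 => /eqP.
Qed.

Definition orbit_chi q : fct := fun p => chi q p + chi (rho q) p + chi (rho (rho q)) p.

Lemma orbit_chi_rho q : orbit_chi (rho q) = orbit_chi q.
Proof.
apply/funext => p; rewrite /orbit_chi rho3.
by move: (chi q p : R[i]) (chi _ p : R[i]) (chi _ p : R[i]) => a b c; ring.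
Qed.

Lemma smooth_orbit_chi q : smooth (orbit_chi q).
Proof. by apply: smoothD; [apply: smoothD|]; exact: smooth_chi. Qed.

Lemma ZZbar_chi q p : on_circle r kappa q ->
  Zfield (Zbarfield (chi q)) p = - (r * kappa)%:C%C * chi q p.
Proof.
move=> /eqP hq; have [_ _ ZZ] := derivation_Z R.
rewrite Zbar_chi (ZZ _ _ (smooth_chi R q)) Z_chi.
have -> : r * kappa = pi ^+ 2 * cmod (zeta R q) ^+ 2.
  by rewrite -hq mulrC divfK // gt_eqF.
rewrite cmod_sqr; move: (zeta R q) (chi q p : R[i]) => w A.
have -> : tpi R / 2 = Complex 0 pi by rewrite half2; apply: complexP; rewrite /tpi !ReImE /=; field.
by apply: complexP; rewrite !ReImE /=; ring.
Qed.

Lemma flat_orbit_chi q : on_circle r kappa q -> flat (orbit_chi q).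
Proof.
move=> hq; have h1 : on_circle r kappa (rho q) by rewrite on_circle_rho.
have h2 : on_circle r kappa (rho (rho q)) by rewrite on_circle_rho.
have [DZ _ _] := derivation_Z R; have [DB _ _] := derivation_Zbar R.
have sc x := smooth_chi R x.
split.
- by apply: quasi0_D; [apply: quasi0_D|]; exact: quasi_chi.
- move=> p; rewrite /orbit_chi !chi_rot chi_rot'.
  by move: (chi q p : R[i]) (chi _ p : R[i]) (chi _ p : R[i]) => a b c; ring.
move=> p; rewrite /orbit_chi (DB _ _ (smoothD (sc q) (sc (rho q))) (sc _)) (DB _ _ (sc q) (sc _)).
have sb x := smooth_Zbar (sc x).
rewrite (DZ _ _ (smoothD (sb q) (sb (rho q))) (sb _)) (DZ _ _ (sb q) (sb _)).
rewrite (ZZbar_chi p hq) (ZZbar_chi p h1) (ZZbar_chi p h2).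
by rewrite -!mulrDr.
Qed.

(** The Fourier expansion is averaged over the rotation, under which f is invariant. *)
Lemma flat_average f p : flat f ->
  f p = \sum_(q <- s) (fourier f q / 3) * orbit_chi q p.
Proof.
move=> Ff; have [_ rf _] := Ff.
have E0 := flat_expansion p Ff.
have E1 := flat_expansion (sim_act (rot R) p) Ff.
have E2 := flat_expansion (sim_act (rot R) (sim_act (rot R) p)) Ff.
rewrite !rf !mul1r in E1 E2.
have n3 : (3 : R[i]) != 0 by rewrite pnatr_eq0.
apply: (mulfI n3); rewrite mulr_sumr.
have -> : 3 * f p = f p + f p + f p by move: (f p : R[i]) => a; ring.
rewrite {1}E0 {1}E1 E2 -!big_split /=; apply: eq_bigr => q _.
rewrite /orbit_chi !chi_rot' rho3.
move: (fourier f q) (chi q p : R[i]) (chi _ p : R[i]) (chi _ p : R[i]) => J a b c.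
by field.
Qed.

(** Orbit sums are equal along an orbit, so the averaged expansion is regrouped over
    the representatives; the coefficients at representatives separate the orbit sums. *)
Lemma has_dim_flat_sector :
  has_dim flat (size [seq q <- s | sector q]).
Proof.
set t := [seq q <- s | sector q].
have tP q : q \in t -> sector q /\ on_circle r kappa q.
  by rewrite mem_filter hs => /andP.
have ut : uniq t by rewrite filter_uniq.
have nt (i : 'I_(size t)) : nth (0, 0) t i \in t by rewrite mem_nth.
exists (fun i : 'I_(size t) => orbit_chi (nth (0, 0) t i)); split.
- by move=> i; apply: flat_orbit_chi; have [] := tP _ (nt i).
- move=> a E j.
  have := congr1 (fun F => fourier F (nth (0, 0) t j)) E.
  have -> : (\sum_i a i *: orbit_chi (nth (0, 0) t i) : fct) =
      fun p => \sum_i a i * orbit_chi (nth (0, 0) t i) p.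
    by apply/funext => p; exact: combinationE.
  rewrite fourier_sum; last by move=> i; exact: smooth_orbit_chi.
  have -> : fourier (0 : fct) (nth (0, 0) t j) = 0.
    have -> : (0 : fct) = fun p => 0 * chi (0, 0) p by apply/funext => p; rewrite mul0r.
    by rewrite fourierZ ?mul0r //; exact: smooth_chi.
  have K (i : 'I_(size t)) : fourier (orbit_chi (nth (0, 0) t i)) (nth (0, 0) t j) = (i == j)%:R.
    have [si _] := tP _ (nt i); have [sj _] := tP _ (nt j).
    rewrite (fourierD _ (smoothD (smooth_chi R _) (smooth_chi R _)) (smooth_chi R _)).
    rewrite (fourierD _ (smooth_chi R _) (smooth_chi R _)) !fourier_chi nth_uniq //.
    have -> : (rho (nth (0, 0) t i) == nth (0, 0) t j) = false.
      by apply/negbTE/eqP => e; move: sj; rewrite -e sector_rho.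
    have -> : (rho (rho (nth (0, 0) t i)) == nth (0, 0) t j) = false.
      by apply/negbTE/eqP => e; move: sj; rewrite -e sector_rho2.
    by rewrite !addr0.
  rewrite (bigD1 j) //= K eqxx mulr1 big1 ?addr0 // => i /negbTE ij.
  by rewrite K ij mulr0.
move=> f Ff; pose J q := (fourier f q + fourier f (rho q) + fourier f (rho (rho q))) / 3.
exists (fun i => J (nth (0, 0) t i)); apply/funext => p.
rewrite combinationE (flat_average p Ff).
rewrite (perm_big _ (perm_sector kappa0 us hs erefl)) !big_cat !big_map /= -/t.
have -> : \sum_(i < size t) J (nth (0, 0) t i) * orbit_chi (nth (0, 0) t i) p =
    \sum_(q <- t) J q * orbit_chi q p.
  by rewrite (big_nth (0, 0)) big_mkord.
rewrite -!big_split /=; apply: eq_bigr => q _; rewrite !orbit_chi_rho /J.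
move: (fourier f q) (fourier f _) (fourier f _) (orbit_chi q p : R[i]) => a b c d.
by ring.
Qed.

Lemma E_kappaE : E_kappa r kappa = [set` map (zeta R) s].
Proof.
apply/seteqP; split=> [w [/dual_lattice_zeta [q ->] hq]|w /= /mapP[q]].
  by apply/mapP; exists q => //; rewrite hs; apply/eqP.
rewrite hs => /eqP hq ->; split => //.
by apply/dual_lattice_zeta; exists q.
Qed.

Lemma card_E_kappa : #|` fset_set (E_kappa r kappa)|%fset = (3 * size [seq q <- s | sector q])%N.
Proof.
have -> : #|` fset_set (E_kappa r kappa)|%fset = size s.
  have uz : uniq (map (zeta R) s) by rewrite map_inj_uniq //; exact: zeta_inj.
  have -> : E_kappa r kappa = [set` (seq_fset tt (map (zeta R) s))].
    rewrite E_kappaE; apply/seteqP; split => w H; have S := seq_fsetE tt (map (zeta R) s) w.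
      exact: (etrans S H).
    exact: (etrans (esym S) H).
  by rewrite set_fsetK size_seq_fset undup_id // size_map.
rewrite (perm_size (perm_sector kappa0 us hs erefl)) !size_cat !size_map.
by rewrite !mulSn mul0n addn0.
Qed.

End Circle.

Lemma multiplicity_flat c : finite_set (E_kappa r kappa) /\
  exists2 m : nat, multiplicity r (Gamma' c) (kappa, 0) m &
    m%:R = (#|` fset_set (E_kappa r kappa)|%fset)%:R / 3 :> R.
Proof.
have [s [us hs]] := circle_seq r0 kappa0; split.
  by rewrite (E_kappaE hs); exact: finite_seq.
exists (size [seq q <- s | sector q]).
  exact: (has_dim_flat c (has_dim_flat_sector us hs)).
by rewrite (card_E_kappa us hs) natrM [3 * _]mulrC mulfK // pnatr_eq0.
Qed.

End FlatMultiplicity.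

Theorem theorem7p3 (R : realType) (N : nat) (c r : R)
  (hN : (0 < N)%N)
  (hc : c = 4 * complex.Im (omega R) / N%:R)
  (hr : 0 < r)
  (hGamma : heisenberg_bieberbach (Gamma' c)) :
  (forall (n : int) (k : nat), n != 0 ->
     exists2 m : nat,
       multiplicity r (Gamma' c)
         ((4 * k%:R + 2) * pi * `|n|%N%:R / (c * r),
          2 * pi * n%:~R / (c * r)) m &
       m%:R = 3^-1 *
         (`|n|%N%:R * N%:R
          + 4 / Num.sqrt 3
              * cos (2 * pi * (`|n|%N%:R + k%:R) / 3 - pi / 6)
          + 2 / Num.sqrt 3
              * cos (2 * pi * (`|n|%N%:R + k%:R + `|n|%N%:R * N%:R) / 3
                     - pi / 6)) :> R)
  /\
  (forall kappa : R, 0 < kappa ->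
     finite_set (E_kappa r kappa) /\
     exists2 m : nat,
       multiplicity r (Gamma' c) (kappa, 0) m &
       m%:R = (#|` fset_set (E_kappa r kappa)|%fset)%:R / 3 :> R).
Proof.
split=> [n k n0|kappa kappa0]; last exact: multiplicity_flat.
exists (edim (`|n|%N * N) ((`|n|%N + k) %% 3)); first exact: multiplicity_nonzero.
rewrite -natrM; apply: edim_formula.
by rewrite muln_gt0 hN absz_gt0 n0.
Qed.
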